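(* Let $\mathbb{X}$ be a Banach space with a quasi-greedy basis. Assume that $B_{p,0}$ is isomorphic to a complemented subspace of $\mathbb{X}$ for some $1\le p<\infty$. Then $\mathbb{X}$ has a quasi-greedy basis $\mathcal{B}_\kappa$ with $L_m[\mathcal{B}_\kappa,\mathbb{X}]\approx\log m$ for $m\ge2$.
   Context: For $1\le p<\infty$, $B_{p,0}=(\bigoplus_{n=1}^\infty\ell_p^n)_0$ is the direct sum, in the $c_0$-sense, of the $n$-dimensional spaces $\ell_p^n$, $n\in\mathbb{N}$. A basis $\mathcal{B}=(x_j)_{j=1}^\infty$ of a (real or complex) Banach space $\mathbb{X}$ is a Schauder basis, always assumed semi-normalized, i.e. $0<\inf_j\Vert x_j\Vert\le\sup_j\Vert x_j\Vert<\infty$; $(x_j^* )_{j=1}^\infty$ are its coordinate functionals. For $A\subseteq\mathbb{N}$, $S_A(f)=\sum_{j\in A}x_j^*(f)x_j$ (when well defined), and $\operatorname{supp}(f)=\{j: x_j^*(f)\ne0\}$. Define $$L_m[\mathcal{B},\mathbb{X}]=\sup\left\{\frac{\Vert S_A(f)\Vert}{\Vert f\Vert}: f\in\mathbb{X}\setminus\{0\},\ \max(\operatorname{supp}(f))\le m,\ A\subseteq\mathbb{N}\right\}.$$ The basis is quasi-greedy if there is a constant $C$ with $\Vert f-S_F(f)\Vert\le C\Vert f\Vert$ whenever $f\in\mathbb{X}$ and $F\subseteq\mathbb{N}$ (finite) are such that $|x_j^*(f)|\le|x_k^*(f)|$ for all $j\in\mathbb{N}\setminus F$ and all $k\in F$.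 For families of non-negative numbers, $\alpha_i\lesssim\beta_i$ means there is a constant $C$ with $\alpha_i\le C\beta_i$ for all $i$; $\alpha_i\approx\beta_i$ means $\alpha_i\lesssim\beta_i$ and $\beta_i\lesssim\alpha_i$. *)

(* Defs.v *)
From Stdlib Require Import Reals Lra Lia Psatz.
From Stdlib Require Import Classical FunctionalExtensionality.
From Coquelicot Require Import Coquelicot.

Open Scope R_scope.

Set Implicit Arguments.
Unset Strict Implicit.

Lemma fun_norm_opp (K : AbsRing) (V : ModuleSpace K) (N : V -> R)
  (Nscal : forall (l : K) (x : V), N (scal l x) <= abs l * N x) (x : V) :
  N (opp x) <= N x.
Proof.
rewrite <- scal_opp_one.
eapply Rle_trans; [apply Nscal|].
rewrite abs_opp_one; lra.
Qed.

Lemma fun_norm_zero (K : AbsRing) (V : ModuleSpace K) (N : V -> R)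
  (Nscal : forall (l : K) (x : V), N (scal l x) <= abs l * N x) :
  N zero <= 0.
Proof.
assert (H := Nscal zero zero).
rewrite (scal_zero_l (K := K) (V := V)), abs_zero in H; lra.
Qed.

Definition norm_UniformSpace_mixin (K : AbsRing) (V : ModuleSpace K) (N : V -> R)
  (Nplus : forall x y : V, N (plus x y) <= N x + N y)
  (Nscal : forall (l : K) (x : V), N (scal l x) <= abs l * N x) :
  UniformSpace.mixin_of V.
Proof.
apply (UniformSpace.Mixin V zero (fun x e y => N (minus y x) < e)).
- intros x e; rewrite minus_eq_zero.
  eapply Rle_lt_trans; [exact (@fun_norm_zero K V N Nscal)|apply cond_pos].
- intros x y e H; rewrite <- opp_minus.
  eapply Rle_lt_trans; [exact (@fun_norm_opp K V N Nscal _)|exact H].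
- intros x y z e1 e2 H1 H2.
  rewrite (minus_trans y).
  eapply Rle_lt_trans; [apply Nplus|lra].
Defined.

Definition norm_NormedModule (K : AbsRing) (V : Type)
  (c : ModuleSpace.class_of K V) (N : V -> R)
  (Nplus : forall x y : ModuleSpace.Pack K V c V, N (plus x y) <= N x + N y)
  (Nscal : forall (l : K) (x : ModuleSpace.Pack K V c V),
    N (scal l x) <= abs l * N x)
  (Neq0 : forall x : ModuleSpace.Pack K V c V, N x = 0 -> x = zero) :
  NormedModule K.
Proof.
set (b := NormedModuleAux.Class K V c
       (@norm_UniformSpace_mixin K (ModuleSpace.Pack K V c V) N Nplus Nscal)).
refine (NormedModule.Pack K V (NormedModule.Class K V b _) V).
refine (NormedModule.Mixin K (NormedModuleAux.Pack K V b V)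
          N 1 Nplus Nscal _ _ Neq0).
- intros x y e H; exact H.
- intros x y e H; rewrite Rmult_1_l; exact H.
Defined.

(** [Rpower 0 p] is 1, not 0, in the library. *)
Definition rpow (x p : R) : R := if Req_dec_T x 0 then 0 else Rpower x p.

Lemma rpow0 (p : R) : rpow 0 p = 0.
Proof. unfold rpow; destruct (Req_dec_T 0 0); lra. Qed.

Lemma rpow_pos (x p : R) : 0 < x -> rpow x p = Rpower x p.
Proof. intros H; unfold rpow; destruct (Req_dec_T x 0); lra. Qed.

Lemma rpow_gt0 (x p : R) : 0 < x -> 0 < rpow x p.
Proof. intros H; rewrite rpow_pos by easy; apply exp_pos. Qed.

Lemma rpow_ge0 (x p : R) : 0 <= rpow x p.
Proof.
unfold rpow; destruct (Req_dec_T x 0); [lra|].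
apply Rlt_le, exp_pos.
Qed.

Lemma rpow_eq0 (x p : R) : rpow x p = 0 -> x = 0.
Proof.
unfold rpow; destruct (Req_dec_T x 0); [easy|].
intros H; assert (K := exp_pos (p * ln x)); unfold Rpower in H; lra.
Qed.

Lemma rpow_le (x y p : R) : 0 <= p -> 0 <= x <= y -> rpow x p <= rpow y p.
Proof.
intros Hp [Hx Hy].
destruct (Rle_lt_or_eq_dec _ _ Hx) as [H|<-].
- rewrite !rpow_pos by lra; now apply Rle_Rpower_l.
- rewrite rpow0; apply rpow_ge0.
Qed.

Lemma rpowM (x y p : R) : 0 <= x -> 0 <= y -> rpow (x * y) p = rpow x p * rpow y p.
Proof.
intros Hx Hy.
destruct (Rle_lt_or_eq_dec _ _ Hx) as [H1|<-];
  [|now rewrite Rmult_0_l, !rpow0, Rmult_0_l].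
destruct (Rle_lt_or_eq_dec _ _ Hy) as [H2|<-];
  [|now rewrite Rmult_0_r, !rpow0, Rmult_0_r].
rewrite !rpow_pos by nra; now rewrite Rpower_mult_distr.
Qed.

Lemma rpowK (x p : R) : 0 < p -> 0 <= x -> rpow (rpow x p) (/ p) = x.
Proof.
intros Hp Hx.
destruct (Rle_lt_or_eq_dec _ _ Hx) as [H|<-]; [|now rewrite !rpow0].
rewrite (rpow_pos _ (rpow_gt0 p H)), rpow_pos, Rpower_mult by easy.
rewrite Rinv_r by lra; now apply Rpower_1.
Qed.

Lemma rpowVK (x p : R) : 0 < p -> 0 <= x -> rpow (rpow x (/ p)) p = x.
Proof.
intros Hp Hx.
rewrite <- (Rinv_inv p) at 2.
apply rpowK; [now apply Rinv_0_lt_compat|easy].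
Qed.

Lemma rpow_convex (p s t x y : R) : 1 <= p -> 0 <= s -> 0 <= t -> s + t = 1 ->
  0 <= x -> 0 <= y -> rpow (s * x + t * y) p <= s * rpow x p + t * rpow y p.
Proof.
intros Hp Hs Ht Hst Hx Hy.
set (z := s * x + t * y).
assert (Hz : 0 <= z) by (unfold z; nra).
destruct (Rle_lt_or_eq_dec _ _ Hz) as [Hz'|<-].
2:{ rewrite rpow0; assert (A := rpow_ge0 x p); assert (B := rpow_ge0 y p); nra. }
(* tangent line of [rpow _ p] at [z] *)
assert (T : forall w, 0 <= w -> rpow z p * (1 + p * (w / z - 1)) <= rpow w p).
{ intros w Hw.
  assert (Hr : 0 <= w / z) by (apply Rdiv_le_0_compat; lra).
  assert (Ew : rpow w p = rpow z p * rpow (w / z) p).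
  { rewrite <- rpowM by lra; f_equal; field; lra. }
  rewrite Ew; apply Rmult_le_compat_l; [apply rpow_ge0|].
  revert Hr; generalize (w / z); intros r Hr.
  destruct (Rle_lt_or_eq_dec _ _ Hr) as [Hr'|<-]; [|rewrite rpow0; lra].
  rewrite rpow_pos by easy; unfold Rpower.
  rewrite <- (exp_ln r) at 1 by easy.
  generalize (ln r); intros a.
  assert (E1 : exp (p * a) = exp a * exp ((p - 1) * a)).
  { rewrite <- exp_plus; f_equal; ring. }
  assert (E2 : 1 = exp a * exp (- a)).
  { rewrite <- exp_plus, Rplus_opp_r, exp_0; ring. }
  assert (F1 := exp_ineq1_le ((p - 1) * a)).
  assert (F2 := exp_ineq1_le (- a)).
  assert (F3 := exp_pos a).
  assert (G1 : exp a * (1 + (p - 1) * a) <= exp (p * a)) by (rewrite E1; nra).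
  assert (G2 : exp a * (1 - a) <= 1) by (rewrite E2; nra).
  nra. }
assert (Tx := T x Hx); assert (Ty := T y Hy).
assert (E : s * (x / z) + t * (y / z) = 1) by (unfold z in *; field; lra).
apply Rle_trans with (s * (rpow z p * (1 + p * (x / z - 1)))
                      + t * (rpow z p * (1 + p * (y / z - 1)))); [|nra].
apply Req_le.
replace (s * (rpow z p * (1 + p * (x / z - 1))) + t * (rpow z p * (1 + p * (y / z - 1))))
  with (rpow z p * ((s + t) * (1 - p) + p * (s * (x / z) + t * (y / z)))) by ring.
rewrite E, Hst; ring.
Qed.

(** The coordinates of a vector of l_p^n are indexed by [1, ..., n]; the
    underlying sequence is padded with zeros so that equality is pointwise. *)
Record lp_carrier (K : AbsRing) (n : nat) : Type := LpVec {
  lp_coord :> nat -> K;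
  lp_coord_out : forall i : nat, ~ (1 <= i <= n)%nat -> lp_coord i = zero }.

Arguments LpVec {K n}.

Lemma lp_ext (K : AbsRing) (n : nat) (x y : lp_carrier K n) :
  (forall i, x i = y i) -> x = y.
Proof.
destruct x as [x Hx], y as [y Hy]; simpl; intros H.
assert (E : x = y) by now apply functional_extensionality.
subst y; f_equal; apply proof_irrelevance.
Qed.

Definition lp_plus (K : AbsRing) (n : nat) (x y : lp_carrier K n) : lp_carrier K n.
Proof.
refine (LpVec (fun i => plus (x i) (y i)) _).
intros i Hi; rewrite !lp_coord_out by easy; apply plus_zero_r.
Defined.

Definition lp_opp (K : AbsRing) (n : nat) (x : lp_carrier K n) : lp_carrier K n.
Proof.
refine (LpVec (fun i => opp (x i)) _).
intros i Hi; rewrite lp_coord_out by easy; exact (@opp_zero K).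
Defined.

Definition lp_zero (K : AbsRing) (n : nat) : lp_carrier K n :=
  LpVec (fun _ => zero) (fun _ _ => eq_refl).

Definition lp_scal (K : AbsRing) (n : nat) (a : K) (x : lp_carrier K n) :
  lp_carrier K n.
Proof.
refine (LpVec (fun i => mult a (x i)) _).
intros i Hi; rewrite lp_coord_out by easy; exact (@mult_zero_r K a).
Defined.

Definition lp_AbelianGroup_class (K : AbsRing) (n : nat) :
  AbelianGroup.class_of (lp_carrier K n).
Proof.
unshelve refine (AbelianGroup.Class _
  (AbelianMonoid.Mixin _ (@lp_plus K n) (lp_zero K n) _ _ _)
  (AbelianGroup.Mixin (AbelianMonoid.Pack _ _ _) (@lp_opp K n) _)).
- intros x y; apply lp_ext; intros i; apply plus_comm.
- intros x y z; apply lp_ext; intros i; apply plus_assoc.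
- intros x; apply lp_ext; intros i; apply plus_zero_r.
- intros x; apply lp_ext; intros i; exact (@plus_opp_r K (lp_coord x i)).
Defined.

Definition lp_ModuleSpace_class (K : AbsRing) (n : nat) :
  ModuleSpace.class_of K (lp_carrier K n).
Proof.
refine (ModuleSpace.Class K _ (lp_AbelianGroup_class K n)
  (ModuleSpace.Mixin K (AbelianGroup.Pack _ _ (lp_carrier K n))
    (@lp_scal K n) _ _ _ _)).
- intros a b x; apply lp_ext; intros i; exact (@mult_assoc K a b (x i)).
- intros x; apply lp_ext; intros i; exact (@mult_one_l K (x i)).
- intros a x y; apply lp_ext; intros i; exact (@mult_distr_l K a (x i) (y i)).
- intros a b x; apply lp_ext; intros i; exact (@mult_distr_r K a b (x i)).
Defined.

Definition lp_sum (K : AbsRing) (p : R) (n : nat) (x : nat -> K) : R :=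
  sum_n_m (fun i => rpow (abs (x i)) p) 1 n.

Definition lp_norm (K : AbsRing) (p : R) (n : nat) (x : lp_carrier K n) : R :=
  rpow (lp_sum p n x) (/ p).

Lemma lp_sum_ge0 (K : AbsRing) (p : R) (n : nat) (x : nat -> K) : 0 <= lp_sum p n x.
Proof.
unfold lp_sum.
rewrite <- (Rmult_0_r (INR (S n - 1))), <- (sum_n_m_const 1 n 0).
apply sum_n_m_le; intros i; apply rpow_ge0.
Qed.

Lemma sum_Rmult_l (c : R) (u : nat -> R) (n m : nat) :
  c * sum_n_m u n m = sum_n_m (fun k => c * u k) n m.
Proof. symmetry; exact (@sum_n_m_mult_l R_Ring c u n m). Qed.

Lemma sum_Rplus (u v : nat -> R) (n m : nat) :
  sum_n_m u n m + sum_n_m v n m = sum_n_m (fun k => u k + v k) n m.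
Proof. symmetry; exact (@sum_n_m_plus R_AbelianMonoid u v n m). Qed.

Lemma lp_norm_scal (K : AbsRing) (p : R) (Hp : 1 <= p) (n : nat) (a : K)
  (x : lp_carrier K n) : lp_norm p (lp_scal a x) <= abs a * lp_norm p x.
Proof.
unfold lp_norm.
rewrite <- (rpowK (p := p) (x := abs a)) by (try apply abs_ge_0; lra).
rewrite <- rpowM by (apply rpow_ge0 || apply lp_sum_ge0).
apply rpow_le; [apply Rlt_le, Rinv_0_lt_compat; lra|].
split; [apply lp_sum_ge0|].
unfold lp_sum.
rewrite sum_Rmult_l.
apply sum_n_m_le; intros i.
change (rpow (abs (mult a (x i))) p <= rpow (abs a) p * rpow (abs (x i)) p).
rewrite <- rpowM by apply abs_ge_0.
apply rpow_le; [lra|]; split; [apply abs_ge_0|apply abs_mult].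
Qed.

Lemma lp_sum_eq0 (K : AbsRing) (p : R) (n : nat) (x : nat -> K) :
  lp_sum p n x = 0 -> forall i, (1 <= i <= n)%nat -> x i = zero.
Proof.
induction n as [|n IH]; intros H i Hi; [lia|].
unfold lp_sum in H; rewrite sum_n_Sm in H by lia.
fold (lp_sum p n x) in H.
change (lp_sum p n x + rpow (abs (x (S n))) p = 0) in H.
assert (A := lp_sum_ge0 p n x); assert (B := rpow_ge0 (abs (x (S n))) p).
destruct (Nat.eq_dec i (S n)) as [->|Hne].
- apply abs_eq_zero, (@rpow_eq0 _ p); lra.
- apply IH; [lra|lia].
Qed.

Lemma lp_norm_eq0 (K : AbsRing) (p : R) (n : nat) (x : lp_carrier K n) :
  lp_norm p x = 0 -> x = lp_zero K n.
Proof.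
intros H; apply lp_ext; intros i; simpl.
destruct (classic (1 <= i <= n)%nat) as [Hi|Hi]; [|now apply lp_coord_out].
revert i Hi; apply (@lp_sum_eq0 K p), (@rpow_eq0 _ (/ p)), H.
Qed.

Lemma lp_normE (K : AbsRing) (p : R) (Hp : 1 <= p) (n : nat) (x : lp_carrier K n) :
  rpow (lp_norm p x) p = lp_sum p n x.
Proof. apply rpowVK; [lra|apply lp_sum_ge0]. Qed.

Lemma lp_norm_plus (K : AbsRing) (p : R) (Hp : 1 <= p) (n : nat)
  (x y : lp_carrier K n) : lp_norm p (lp_plus x y) <= lp_norm p x + lp_norm p y.
Proof.
set (a := lp_norm p x); set (b := lp_norm p y).
assert (Ha : 0 <= a) by apply rpow_ge0.
assert (Hb : 0 <= b) by apply rpow_ge0.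
destruct (Rle_lt_or_eq_dec _ _ Ha) as [Ha'|Ea].
2:{ assert (Ex : x = lp_zero K n) by (apply (@lp_norm_eq0 K p); now rewrite Ea).
    replace (lp_plus x y) with y; [fold b; lra|].
    apply lp_ext; intros i; rewrite Ex; symmetry; apply plus_zero_l. }
destruct (Rle_lt_or_eq_dec _ _ Hb) as [Hb'|Eb].
2:{ assert (Ey : y = lp_zero K n) by (apply (@lp_norm_eq0 K p); now rewrite Eb).
    replace (lp_plus x y) with x; [fold a; lra|].
    apply lp_ext; intros i; rewrite Ey; symmetry; apply plus_zero_r. }
rewrite <- (rpowK (p := p) (x := a + b)) by lra.
apply rpow_le; [apply Rlt_le, Rinv_0_lt_compat; lra|].
split; [apply lp_sum_ge0|].
set (d := a + b); assert (Hd : 0 < d) by (unfold d; lra).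
apply Rle_trans with
  (rpow d p * (a / d * (/ rpow a p * lp_sum p n x) + b / d * (/ rpow b p * lp_sum p n y))).
- unfold lp_sum.
  set (u := fun i => rpow (abs (x i)) p); set (v := fun i => rpow (abs (y i)) p).
  replace (rpow d p * (a / d * (/ rpow a p * sum_n_m u 1 n)
                       + b / d * (/ rpow b p * sum_n_m v 1 n)))
    with (rpow d p * (a / d * / rpow a p) * sum_n_m u 1 n
          + rpow d p * (b / d * / rpow b p) * sum_n_m v 1 n) by ring.
  rewrite !sum_Rmult_l, sum_Rplus.
  apply sum_n_m_le; intros i; unfold u, v; simpl.
  assert (Ex : rpow (abs (x i)) p = rpow a p * rpow (abs (x i) / a) p).
  { rewrite <- rpowM; [f_equal; field; lra|lra|].
    apply Rdiv_le_0_compat; [apply abs_ge_0|lra]. }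
  assert (Ey : rpow (abs (y i)) p = rpow b p * rpow (abs (y i) / b) p).
  { rewrite <- rpowM; [f_equal; field; lra|lra|].
    apply Rdiv_le_0_compat; [apply abs_ge_0|lra]. }
  assert (Pa := rpow_gt0 p Ha'); assert (Pb := rpow_gt0 p Hb').
  apply Rle_trans with (rpow d p * (a / d * rpow (abs (x i) / a) p
                                    + b / d * rpow (abs (y i) / b) p)).
  2:{ rewrite Ex, Ey; apply Req_le; field; lra. }
  assert (C : rpow (a / d * (abs (x i) / a) + b / d * (abs (y i) / b)) p
    <= a / d * rpow (abs (x i) / a) p + b / d * rpow (abs (y i) / b) p).
  { apply rpow_convex; try easy; try (apply Rdiv_le_0_compat; try apply abs_ge_0; lra).
    unfold d; field; lra. }
  eapply Rle_trans; [|apply Rmult_le_compat_l; [apply rpow_ge0|exact C]].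
  rewrite <- rpowM;
    [|lra|apply Rplus_le_le_0_compat; apply Rmult_le_pos;
          apply Rdiv_le_0_compat; try apply abs_ge_0; lra].
  apply rpow_le; [lra|]; split; [apply abs_ge_0|].
  eapply Rle_trans; [apply abs_triangle|].
  apply Req_le; field; lra.
- rewrite <- (lp_normE Hp x), <- (lp_normE Hp y); fold a b.
  assert (Pa := rpow_gt0 p Ha'); assert (Pb := rpow_gt0 p Hb').
  apply Req_le; unfold d; field; lra.
Qed.

Definition lp (K : AbsRing) (p : R) (Hp : 1 <= p) (n : nat) : NormedModule K :=
  @norm_NormedModule K (lp_carrier K n) (lp_ModuleSpace_class K n)
    (@lp_norm K p n) (@lp_norm_plus K p Hp n) (@lp_norm_scal K p Hp n)
    (@lp_norm_eq0 K p n).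

Record c0_carrier (K : AbsRing) (X : nat -> NormedModule K) : Type := C0Vec {
  c0_coord :> forall n : nat, X n;
  c0_coord_lim : is_lim_seq (fun n => norm (c0_coord n)) 0 }.

Arguments C0Vec {K} X.

Lemma c0_ext (K : AbsRing) (X : nat -> NormedModule K) (x y : c0_carrier X) :
  (forall n, x n = y n) -> x = y.
Proof.
destruct x as [x Hx], y as [y Hy]; simpl; intros H.
assert (E : x = y) by now apply functional_extensionality_dep.
subst y; f_equal; apply proof_irrelevance.
Qed.

Definition c0_plus (K : AbsRing) (X : nat -> NormedModule K) (x y : c0_carrier X) :
  c0_carrier X.
Proof.
refine (C0Vec X (fun n => plus (x n) (y n)) _).
apply is_lim_seq_le_le with (fun _ => 0) (fun n => norm (x n) + norm (y n)).
- intros n; split; [apply norm_ge_0|apply norm_triangle].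
- apply is_lim_seq_const.
- replace (Finite 0) with (Finite (0 + 0)) by (f_equal; ring).
  apply is_lim_seq_plus'; apply c0_coord_lim.
Defined.

Definition c0_scal (K : AbsRing) (X : nat -> NormedModule K) (a : K)
  (x : c0_carrier X) : c0_carrier X.
Proof.
refine (C0Vec X (fun n => scal a (x n)) _).
apply is_lim_seq_le_le with (fun _ => 0) (fun n => abs a * norm (x n)).
- intros n; split; [apply norm_ge_0|apply norm_scal].
- apply is_lim_seq_const.
- replace (Finite 0) with (Rbar_mult (abs a) 0) by (simpl; f_equal; ring).
  apply is_lim_seq_scal_l, c0_coord_lim.
Defined.

Definition c0_opp (K : AbsRing) (X : nat -> NormedModule K) (x : c0_carrier X) :
  c0_carrier X.
Proof.
refine (C0Vec X (fun n => opp (x n)) _).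
apply is_lim_seq_ext with (fun n => norm (x n)); [|apply c0_coord_lim].
intros n; symmetry; apply norm_opp.
Defined.

Definition c0_zero (K : AbsRing) (X : nat -> NormedModule K) : c0_carrier X.
Proof.
refine (C0Vec X (fun n => zero) _).
apply is_lim_seq_ext with (fun _ => 0); [|apply is_lim_seq_const].
intros n; symmetry; apply norm_zero.
Defined.

Definition c0_AbelianGroup_class (K : AbsRing) (X : nat -> NormedModule K) :
  AbelianGroup.class_of (c0_carrier X).
Proof.
unshelve refine (AbelianGroup.Class _
  (AbelianMonoid.Mixin _ (@c0_plus K X) (c0_zero X) _ _ _)
  (AbelianGroup.Mixin (AbelianMonoid.Pack _ _ _) (@c0_opp K X) _)).
- intros x y; apply c0_ext; intros i; apply plus_comm.
- intros x y z; apply c0_ext; intros i; apply plus_assoc.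
- intros x; apply c0_ext; intros i; apply plus_zero_r.
- intros x; apply c0_ext; intros i; exact (@plus_opp_r (X i) (c0_coord x i)).
Defined.

Definition c0_ModuleSpace_class (K : AbsRing) (X : nat -> NormedModule K) :
  ModuleSpace.class_of K (c0_carrier X).
Proof.
refine (ModuleSpace.Class K _ (c0_AbelianGroup_class X)
  (ModuleSpace.Mixin K (AbelianGroup.Pack _ _ (c0_carrier X))
    (@c0_scal K X) _ _ _ _)).
- intros a b x; apply c0_ext; intros i; exact (@scal_assoc K (X i) a b (c0_coord x i)).
- intros x; apply c0_ext; intros i; exact (@scal_one K (X i) (c0_coord x i)).
- intros a x y; apply c0_ext; intros i; exact (@scal_distr_l K (X i) a (c0_coord x i) (c0_coord y i)).
- intros a b x; apply c0_ext; intros i; exact (@scal_distr_r K (X i) a b (c0_coord x i)).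
Defined.

Definition c0_norm (K : AbsRing) (X : nat -> NormedModule K) (x : c0_carrier X) : R :=
  real (Sup_seq (fun n => Finite (norm (x n)))).

Lemma c0_norm_finite (K : AbsRing) (X : nat -> NormedModule K) (x : c0_carrier X) :
  is_sup_seq (fun n => Finite (norm (x n))) (Finite (c0_norm x)).
Proof.
unfold c0_norm.
destruct (@filterlim_bounded R_AbsRing R_NormedModule (fun n => norm (x n))
           (ex_intro _ 0 (c0_coord_lim x))) as [M HM].
assert (H := Sup_seq_correct (fun n => Finite (norm (x n)))).
destruct (Sup_seq (fun n => Finite (norm (x n)))) as [s| |]; simpl; [exact H| |].
- exfalso; destruct (H M) as [n Hn]; simpl in Hn.
  assert (A := HM n); unfold norm at 1 in A; simpl in A; unfold abs in A; simpl in A.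
  assert (B := Rle_abs (norm (x n))); lra.
- exfalso; assert (A := H 0 0%nat); simpl in A.
  assert (B := norm_ge_0 (x 0%nat)); lra.
Qed.

Lemma c0_norm_ub (K : AbsRing) (X : nat -> NormedModule K) (x : c0_carrier X) (n : nat) :
  norm (x n) <= c0_norm x.
Proof.
apply le_epsilon; intros e He.
destruct (c0_norm_finite x (mkposreal e He)) as [H _].
apply Rlt_le, (H n).
Qed.

Lemma c0_norm_lub (K : AbsRing) (X : nat -> NormedModule K) (x : c0_carrier X) (M : R) :
  (forall n, norm (x n) <= M) -> c0_norm x <= M.
Proof.
intros HM; apply le_epsilon; intros e He.
destruct (c0_norm_finite x (mkposreal e He)) as [_ [n Hn]]; simpl in Hn.
assert (A := HM n); lra.
Qed.

Lemma c0_norm_plus (K : AbsRing) (X : nat -> NormedModule K) (x y : c0_carrier X) :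
  c0_norm (c0_plus x y) <= c0_norm x + c0_norm y.
Proof.
apply c0_norm_lub; intros n.
eapply Rle_trans; [apply norm_triangle|].
apply Rplus_le_compat; apply c0_norm_ub.
Qed.

Lemma c0_norm_scal (K : AbsRing) (X : nat -> NormedModule K) (a : K) (x : c0_carrier X) :
  c0_norm (c0_scal a x) <= abs a * c0_norm x.
Proof.
apply c0_norm_lub; intros n.
eapply Rle_trans; [apply @norm_scal|].
apply Rmult_le_compat_l; [apply abs_ge_0|apply c0_norm_ub].
Qed.

Lemma c0_norm_eq0 (K : AbsRing) (X : nat -> NormedModule K) (x : c0_carrier X) :
  c0_norm x = 0 -> x = c0_zero X.
Proof.
intros H; apply c0_ext; intros n; apply norm_eq_zero.
apply Rle_antisym; [rewrite <- H; apply c0_norm_ub|apply norm_ge_0].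
Qed.

Definition c0_sum (K : AbsRing) (X : nat -> NormedModule K) : NormedModule K :=
  @norm_NormedModule K (c0_carrier X) (c0_ModuleSpace_class X)
    (@c0_norm K X) (@c0_norm_plus K X) (@c0_norm_scal K X) (@c0_norm_eq0 K X).

(** The [n]-th summand is l_p^(n+1), because [n] starts at 0. *)
Definition B_p0 (K : AbsRing) (p : R) (Hp : 1 <= p) : NormedModule K :=
  c0_sum (fun n : nat => lp K Hp (S n)).

Definition complemented (K : AbsRing) (X : NormedModule K) (V : X -> Prop) : Prop :=
  exists P : X -> X,
    is_linear P /\ (forall f, V (P f)) /\ (forall f, V f -> P f = f).

Definition isomorphic_to_subspace (K : AbsRing) (Y X : NormedModule K)
  (V : X -> Prop) : Prop :=
  exists T : Y -> X,
    is_linear T /\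
    (exists c : R, 0 < c /\ forall y, c * norm y <= norm (T y)) /\
    (forall f, V f <-> exists y, T y = f).

(** The vectors are indexed from 0: [basis_vec B j] is x_(j+1) and
    [basis_coord B j] is its coordinate functional. *)
Record SchauderBasis (K : AbsRing) (X : NormedModule K) : Type := {
  basis_vec : nat -> X;
  basis_coord : nat -> X -> K;
  basis_expansion : forall f : X,
    is_series (fun j => scal (basis_coord j f) (basis_vec j)) f;
  basis_unique : forall (f : X) (a : nat -> K),
    is_series (fun j => scal (a j) (basis_vec j)) f ->
    forall j, a j = basis_coord j f;
  basis_seminormalized : exists a b : R, 0 < a /\
    forall j, a <= norm (basis_vec j) <= b }.

(** [is_S B A f g] means that S_A(f) is well defined and equal to [g]. *)
Definition is_S (K : AbsRing) (X : NormedModule K) (B : SchauderBasis X)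
  (A : nat -> bool) (f g : X) : Prop :=
  is_series (fun j => if A j then scal (basis_coord B j f) (basis_vec B j) else zero) g.

Definition quasi_greedy (K : AbsRing) (X : NormedModule K) (B : SchauderBasis X) : Prop :=
  exists C : R, forall (f g : X) (F : nat -> bool),
    (exists N : nat, forall j, F j = true -> (j < N)%nat) ->
    (forall j k, F j = false -> F k = true ->
       abs (basis_coord B j f) <= abs (basis_coord B k f)) ->
    is_S B F f g ->
    norm (minus f g) <= C * norm f.

(** Because of the shift of indices, max(supp f) <= m reads: every index of the
    support is [< m]. *)
Definition L_ (K : AbsRing) (X : NormedModule K) (B : SchauderBasis X) (m : nat) : Rbar :=
  Lub_Rbar (fun r : R => exists (f g : X) (A : nat -> bool),
    f <> zero /\
    (forall j, basis_coord B j f <> zero -> (j < m)%nat) /\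
    is_S B A f g /\
    r = norm g / norm f).

Definition lesssim (I : Type) (D : I -> Prop) (a b : I -> Rbar) : Prop :=
  exists C : R, 0 < C /\ forall i, D i -> Rbar_le (a i) (Rbar_mult C (b i)).

Definition approx (I : Type) (D : I -> Prop) (a b : I -> Rbar) : Prop :=
  lesssim D a b /\ lesssim D b a.

(* Main.v *)
Require Import Defs.
From Stdlib Require Import Reals Lra Lia Psatz Arith List Cantor.
From Stdlib Require Import Classical ClassicalEpsilon FunctionalExtensionality.
From Coquelicot Require Import Coquelicot.

(** The basis is built by enlarging the given quasi-greedy basis of X by a
    quasi-greedy but highly conditional system that lives in B_{p,0}.

    _Room for a second system._  Write B for B_{p,0}.  Sending the block l_p^n
    onto n coordinates of l_p^{2n} embeds B isometrically in itself, as the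
    range of a coordinate projection ([copy], with left inverse [uncopy]).
    Since B is complemented in X, it follows that X is isomorphic to
    X (+) U, where U is the span in B of the coordinates outside the copy.  So
    it is enough to give U a quasi-greedy basis whose conditionality grows like
    log m: interlaced with the image of the basis of X, it yields a
    quasi-greedy basis of X ([merged_quasi_greedy]).

    _The system in U._  For each k, take a block of U of length 2^k - 1, cut
    into levels of lengths 1, 2, 4, ..., 2^(k-1), together with k coordinates
    r_0, ..., r_(k-1) from different blocks, which span an l_infty^k.  Let w_l
    be the normalized constant vector on level l, w_l^* the normalized
    averaging functional, and s_l = r_l + ... + r_(k-1) the summing basis of
    l_infty^k.  The system consists of the vectors
    e_i + w_l^*(e_i) (s_l - w_l), for i in level l, and of the w_l; all other
    coordinates keep their unit vectors.  In other words w_l and s_l are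
    exchanged, so that in the new coordinates the deviation of f from its level
    averages is measured in l_p while the averages a_l(f) = w_l^*(f) are
    measured by the largest modulus of a partial sum a_0 + ... + a_l.  The alternating
    vector with averages 1, -1, 1, ... has norm 1, but its even levels add up
    to about k/2, and it lives on fewer than 4^k positions: this gives
    L_m >= c log m ([alternating_vector]).

    _Why the system is quasi-greedy._  Let F be a greedy set, with threshold t,
    for a vector of norm 1; on level l the constant part of
    the coefficients is at most 2 * 2^(-l/p).  On the levels with
    2^(l/p) t <= 4 we compare the projection with the whole level: the removed
    coefficients are at most t, and their averages form a geometric sum.  On
    the remaining levels the constant part is below t/2, so every selected
    coefficient is at most twice the deviation at the same index, and
    w_l^*(e_i) |q_i| <= |q_i|^p there, whence the selected averages are summable
    ([greedy_split]).  As the retained levels form an initial segment, their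
    averages add up to one of the r_l ([split_projection_bound]).  Initial
    segments of the system are treated in the same way ([prefix_split]), which
    makes it a Schauder basis of U.

    _The upper bound._  Every quasi-greedy basis satisfies L_m <= C log m.  If
    all coefficients of a vector have comparable moduli, then its projections
    are bounded, because greedy sums control the vector of signs
    ([truncation_le]) and a vector of signs controls its own subsums
    ([level_le]).  For a vector with support in m positions it remains to add
    up about log m dyadic ranges of moduli and a negligible remainder
    ([projection_le]). *)

Open Scope R_scope.
Set Implicit Arguments.
Unset Strict Implicit.

(** * Scalars *)

(** What the argument needs to know about the scalars; it holds for the real
    and for the complex numbers, which are then treated together. *)
Record real_subfield (K : AbsRing) : Type := {
  ofR : R -> K;
  ofR_plus : forall x y, ofR (x + y) = plus (ofR x) (ofR y);
  ofR_mult : forall x y, ofR (x * y) = mult (ofR x) (ofR y);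
  ofR_one : ofR 1 = one;
  abs_ofR : forall x, abs (ofR x) = Rabs x;
  scalar_comm : forall a b : K, mult a b = mult b a;
  abs_multE : forall a b : K, abs (mult a b) = abs a * abs b;
  scalar_inv : forall a : K, a <> zero -> exists b, mult b a = one }.

Lemma R_real_subfield : real_subfield R_AbsRing.
Proof.
refine (@Build_real_subfield R_AbsRing (fun x => x) _ _ _ _ _ _ _); try easy.
- intros a b; apply Rmult_comm.
- intros a b; apply Rabs_mult.
- intros a Ha; exists (/ a); apply Rinv_l, Ha.
Qed.

Lemma C_real_subfield : real_subfield C_AbsRing.
Proof.
refine (@Build_real_subfield C_AbsRing RtoC _ _ _ _ _ _ _).
- apply RtoC_plus.
- apply RtoC_mult.
- easy.
- apply Cmod_R.
- intros a b; apply Cmult_comm.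
- intros a b; apply Cmod_mult.
- intros a Ha; exists (Cinv a); apply Cinv_l, Ha.
Qed.

Fixpoint bsum (G : AbelianMonoid) (u : nat -> G) (n : nat) : G :=
  match n with O => zero | S n => plus (bsum u n) (u n) end.

Fixpoint rsum (u : nat -> R) (n : nat) : R :=
  match n with O => 0 | S n => rsum u n + u n end.

Section ScalarRing.

Variable K : AbsRing.

(** The same operations are reached through several coercion paths.  Typing
    them on the carrier of [K] gives [ring] a single form to recognize. *)
Definition kadd (a b : K) : K := plus a b.
Definition kmul (a b : K) : K := mult a b.
Definition kopp (a : K) : K := opp a.
Definition ksub (a b : K) : K := minus a b.
Definition kzero : K := zero.
Definition kone : K := one.

Lemma scalar_ring_theory (iota : real_subfield K) :
  ring_theory kzero kone kadd kmul ksub kopp eq.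
Proof.
constructor; intros.
- apply plus_zero_l.
- apply plus_comm.
- apply plus_assoc.
- exact (@mult_one_l K x).
- apply (scalar_comm iota).
- exact (@mult_assoc K x y z).
- exact (@mult_distr_r K x y z).
- reflexivity.
- exact (@plus_opp_r K x).
Qed.

End ScalarRing.

Ltac kring_norm K :=
  repeat match goal with
  | |- context [@plus ?G ?a ?b] => change (@plus G a b) with (@kadd K a b)
  | |- context [@scal ?K' ?G ?a ?b] => change (@scal K' G a b) with (@kmul K a b)
  | |- context [@mult ?G ?a ?b] => change (@mult G a b) with (@kmul K a b)
  | |- context [@minus ?G ?a ?b] => change (@minus G a b) with (@ksub K a b)
  | |- context [@opp ?G ?a] => change (@opp G a) with (@kopp K a)
  | |- context [@zero ?G] => change (@zero G) with (@kzero K)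
  | |- context [@one ?G] => change (@one G) with (@kone K)
  end;
  match goal with |- @eq _ ?x ?y => change (@eq (AbsRing.sort K) x y) end.


(** * Linear identities by reflection *)

Section ModuleReflection.

Variables (K : AbsRing) (V : NormedModule K).

(** Linear expressions over a list of atoms.  Two of them have equal values as
    soon as the coefficients of every atom agree, and these identities between
    scalars are left to [ring]; see the tactic [module_norm]. *)
Inductive mexp : Type :=
  | MVar (n : nat) | MZero | MPlus (a b : mexp) | MOpp (a : mexp)
  | MScal (k : K) (a : mexp).

Fixpoint meval (env : list V) (e : mexp) : V :=
  match e with
  | MVar n => nth n env zero
  | MZero => zero
  | MPlus a b => plus (meval env a) (meval env b)
  | MOpp a => opp (meval env a)
  | MScal k a => scal k (meval env a)
  end.

Fixpoint mcoef (e : mexp) (i : nat) : K :=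
  match e with
  | MVar n => if Nat.eqb n i then one else zero
  | MZero => zero
  | MPlus a b => plus (mcoef a i) (mcoef b i)
  | MOpp a => opp (mcoef a i)
  | MScal k a => mult k (mcoef a i)
  end.

Fixpoint lincomb (c : nat -> K) (env : list V) : V :=
  match env with
  | nil => zero
  | cons v env => plus (scal (c 0%nat) v) (lincomb (fun i => c (S i)) env)
  end.

Lemma lincomb_ext (c d : nat -> K) (env : list V) :
  (forall i, (i < length env)%nat -> c i = d i) -> lincomb c env = lincomb d env.
Proof.
revert c d; induction env as [|v env IH]; intros c d H; simpl; [easy|].
rewrite (H 0%nat) by (simpl; lia).
f_equal; apply IH; intros i Hi; apply H; simpl; lia.
Qed.

Lemma lincomb_zero (env : list V) : lincomb (fun _ => zero) env = zero.
Proof.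
induction env as [|v env IH]; simpl; [easy|].
rewrite IH, plus_zero_r; exact (scal_zero_l v).
Qed.

Lemma meval_lincomb (env : list V) (e : mexp) :
  meval env e = lincomb (mcoef e) env.
Proof.
induction e as [n| |a IHa b IHb|a IHa|k a IHa]; simpl.
- revert n; induction env as [|v env IH]; intros [|n]; simpl; try easy.
  + rewrite lincomb_zero, plus_zero_r; symmetry; exact (scal_one v).
  + etransitivity; [apply IH|]; symmetry.
    etransitivity; [|apply plus_zero_l]; f_equal; exact (scal_zero_l v).
- symmetry; apply lincomb_zero.
- rewrite IHa, IHb; clear; generalize (mcoef a) (mcoef b).
  induction env as [|v env IH]; intros c d; simpl; [apply plus_zero_r|].
  transitivity (plus (plus (scal (c 0%nat) v) (scal (d 0%nat) v))
    (plus (lincomb (fun i => c (S i)) env) (lincomb (fun i => d (S i)) env))).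
  + rewrite <- !plus_assoc; f_equal; rewrite !plus_assoc; f_equal; apply plus_comm.
  + rewrite IH; f_equal; symmetry; exact (scal_distr_r (c 0%nat) (d 0%nat) v).
- rewrite IHa; clear; generalize (mcoef a).
  induction env as [|v env IH]; intros c; simpl; [exact (@opp_zero V)|].
  rewrite <- IH; etransitivity; [exact (@opp_plus V _ _)|]; f_equal.
  symmetry; exact (scal_opp_l (c 0%nat) v).
- rewrite IHa; clear; generalize (mcoef a).
  induction env as [|v env IH]; intros c; simpl; [exact (@scal_zero_r K V k)|].
  rewrite <- IH.
  etransitivity; [exact (@scal_distr_l K V _ _ _)|]; f_equal.
  exact (scal_assoc k (c 0%nat) v).
Qed.

Lemma meval_eq (env : list V) (e1 e2 : mexp) :
  lincomb (mcoef e1) env = lincomb (mcoef e2) env -> meval env e1 = meval env e2.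
Proof. now rewrite !meval_lincomb. Qed.

End ModuleReflection.

Ltac madd x env :=
  let rec go e :=
    lazymatch e with
    | nil => false
    | cons ?y ?t => match goal with
                    | _ => let _ := constr:(eq_refl x : x = y) in true
                    | _ => go t end
    end in
  lazymatch go env with
  | true => env
  | false => match type of env with list ?T => constr:(@cons T x env) end
  end.

Ltac mvars t env :=
  lazymatch t with
  | @plus _ ?a ?b => let env := mvars a env in mvars b env
  | @minus _ ?a ?b => let env := mvars a env in mvars b env
  | @opp _ ?a => mvars a env
  | @zero _ => env
  | @scal _ _ ?k ?a => mvars a env
  | _ => madd t env
  end.

Ltac mfind x env :=
  lazymatch env with
  | cons ?y ?t => match goal with
                  | _ => let _ := constr:(eq_refl x : x = y) in constr:(O)
                  | _ => let n := mfind x t in constr:(S n) end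
  end.

Ltac mreify K t env :=
  lazymatch t with
  | @plus _ ?a ?b => let a := mreify K a env in let b := mreify K b env in
                     constr:(@MPlus K a b)
  | @minus _ ?a ?b => let a := mreify K a env in let b := mreify K b env in
                      constr:(@MPlus K a (@MOpp K b))
  | @opp _ ?a => let a := mreify K a env in constr:(@MOpp K a)
  | @zero _ => constr:(@MZero K)
  | @scal _ _ ?k ?a => let a := mreify K a env in constr:(@MScal K k a)
  | _ => let n := mfind t env in constr:(@MVar K n)
  end.

Ltac module_norm K V :=
  match goal with |- @eq _ ?x ?y =>
    let env := mvars x (@nil (NormedModule.sort K V)) in
    let env := mvars y env in
    let ex := mreify K x env in
    let ey := mreify K y env in
    change (@eq V (meval env ex) (meval env ey));
    apply meval_eq, lincomb_ext;
    let i := fresh "i" in let Hi := fresh "Hi" in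
    intros i Hi; cbn [length] in Hi;
    repeat (destruct i as [|i];
      [cbn [mcoef Nat.eqb]|try (exfalso; lia)])
  end.

(** * Finite sums *)

Lemma bsum_ext (G : AbelianMonoid) (u v : nat -> G) (n : nat) :
  (forall i, (i < n)%nat -> u i = v i) -> bsum u n = bsum v n.
Proof.
induction n as [|n IH]; intros H; simpl; [easy|].
rewrite H, IH by (try intros; auto with arith); easy.
Qed.

Lemma bsum_zero (G : AbelianMonoid) (u : nat -> G) (n : nat) :
  (forall i, (i < n)%nat -> u i = zero) -> bsum u n = zero.
Proof.
induction n as [|n IH]; intros H; simpl; [easy|].
rewrite H, IH by (try intros; auto with arith); apply plus_zero_r.
Qed.

Lemma bsum_plus (G : AbelianMonoid) (u v : nat -> G) (n : nat) :
  bsum (fun i => plus (u i) (v i)) n = plus (bsum u n) (bsum v n).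
Proof.
induction n as [|n IH]; simpl; [now rewrite plus_zero_r|].
rewrite IH, <- !plus_assoc; f_equal.
rewrite !plus_assoc; f_equal; apply plus_comm.
Qed.

Lemma bsum_morph (G H : AbelianMonoid) (f : G -> H) (u : nat -> G) (n : nat) :
  f zero = zero -> (forall x y, f (plus x y) = plus (f x) (f y)) ->
  f (bsum u n) = bsum (fun i => f (u i)) n.
Proof.
intros H0 H1; induction n as [|n IH]; simpl; [easy|now rewrite H1, IH].
Qed.

Lemma bsum_add (G : AbelianMonoid) (u : nat -> G) (m n : nat) :
  bsum u (m + n) = plus (bsum u m) (bsum (fun i => u (m + i)%nat) n).
Proof.
induction n as [|n IH]; simpl.
- now rewrite Nat.add_0_r, plus_zero_r.
- rewrite Nat.add_succ_r; simpl; now rewrite IH, plus_assoc.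
Qed.

Lemma bsum_stop (G : AbelianMonoid) (u : nat -> G) (m n : nat) :
  (m <= n)%nat -> (forall i, (m <= i < n)%nat -> u i = zero) -> bsum u n = bsum u m.
Proof.
intros Hmn H; replace n with (m + (n - m))%nat by lia.
rewrite bsum_add, (@bsum_zero G (fun i => u (m + i)%nat)), plus_zero_r; [easy|].
intros i Hi; apply H; lia.
Qed.

Lemma bsum_single (G : AbelianMonoid) (u : nat -> G) (n k : nat) :
  (k < n)%nat -> (forall i, (i < n)%nat -> i <> k -> u i = zero) -> bsum u n = u k.
Proof.
intros Hk H; rewrite (@bsum_stop G u (S k) n) by (try (intros i Hi; apply H); lia); simpl.
rewrite (@bsum_zero G u k), plus_zero_l; [easy|].
intros i Hi; apply H; lia.
Qed.

Lemma bsum_sum_n (G : AbelianMonoid) (u : nat -> G) (n : nat) :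
  bsum u (S n) = sum_n u n.
Proof.
induction n as [|n IH]; simpl.
- now rewrite plus_zero_l, sum_O.
- now rewrite sum_Sn, <- IH.
Qed.

Lemma rsum_ext (u v : nat -> R) (n : nat) :
  (forall i, (i < n)%nat -> u i = v i) -> rsum u n = rsum v n.
Proof.
induction n as [|n IH]; intros H; simpl; [easy|].
rewrite H, IH by (try intros; auto with arith); easy.
Qed.

Lemma rsum_le (u v : nat -> R) (n : nat) :
  (forall i, (i < n)%nat -> u i <= v i) -> rsum u n <= rsum v n.
Proof.
induction n as [|n IH]; intros H; simpl; [lra|].
apply Rplus_le_compat; [apply IH; intros; apply H; lia|apply H; lia].
Qed.

Lemma rsum_plus (u v : nat -> R) (n : nat) :
  rsum (fun i => u i + v i) n = rsum u n + rsum v n.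
Proof. induction n as [|n IH]; simpl; [|rewrite IH]; ring. Qed.

Lemma rsum_mult (c : R) (u : nat -> R) (n : nat) :
  rsum (fun i => c * u i) n = c * rsum u n.
Proof. induction n as [|n IH]; simpl; [|rewrite IH]; ring. Qed.

Lemma rsum_const (c : R) (n : nat) : rsum (fun _ => c) n = INR n * c.
Proof. induction n as [|n IH]; [simpl; ring|]. rewrite S_INR; simpl; rewrite IH; ring. Qed.

Lemma rsum_ge0 (u : nat -> R) (n : nat) :
  (forall i, (i < n)%nat -> 0 <= u i) -> 0 <= rsum u n.
Proof.
intros H; apply Rle_trans with (rsum (fun _ => 0) n).
- rewrite rsum_const; lra.
- now apply rsum_le.
Qed.

Lemma rsum_add (u : nat -> R) (m n : nat) :
  rsum u (m + n) = rsum u m + rsum (fun i => u (m + i)%nat) n.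
Proof.
induction n as [|n IH]; simpl.
- rewrite Nat.add_0_r; ring.
- rewrite Nat.add_succ_r; simpl; rewrite IH; ring.
Qed.

Lemma rsum_term (u : nat -> R) (n k : nat) :
  (forall i, (i < n)%nat -> 0 <= u i) -> (k < n)%nat -> u k <= rsum u n.
Proof.
intros H Hk; replace n with (k + S (n - S k))%nat by lia.
rewrite rsum_add; change (S (n - S k)) with (1 + (n - S k))%nat.
rewrite rsum_add; simpl; rewrite Nat.add_0_r.
assert (0 <= rsum u k) by (apply rsum_ge0; intros; apply H; lia).
assert (0 <= rsum (fun i => u (k + S i)%nat) (n - S k))
  by (apply rsum_ge0; intros; apply H; lia).
lra.
Qed.

Lemma rsum_le_extend (u : nat -> R) (m n : nat) : (m <= n)%nat ->
  (forall i, 0 <= u i) -> rsum u m <= rsum u n.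
Proof.
intros Hmn H; replace n with (m + (n - m))%nat by lia; rewrite rsum_add.
assert (0 <= rsum (fun i => u (m + i)%nat) (n - m)) by (apply rsum_ge0; auto).
lra.
Qed.

Lemma abs_bsum (K : AbsRing) (u : nat -> K) (n : nat) :
  abs (bsum u n) <= rsum (fun i => abs (u i)) n.
Proof.
induction n as [|n IH]; simpl; [rewrite abs_zero; lra|].
eapply Rle_trans; [apply abs_triangle|lra].
Qed.

Lemma norm_bsum (K : AbsRing) (V : NormedModule K) (u : nat -> V) (n : nat) :
  norm (bsum u n) <= rsum (fun i => norm (u i)) n.
Proof.
induction n as [|n IH]; simpl; [rewrite norm_zero; lra|].
eapply Rle_trans; [apply norm_triangle|lra].
Qed.

(** * Norms, series and linear maps *)

Section NormedModules.

Variable K : AbsRing.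
Variable iota : real_subfield K.
Add Ring K_ring : (scalar_ring_theory iota).
Ltac kring := kring_norm K; ring.

Lemma one_neq_zero : (one : K) <> zero.
Proof.
intros H; assert (E := f_equal abs H).
rewrite abs_zero, abs_one in E; lra.
Qed.

Lemma ofR_zero : ofR iota 0 = zero.
Proof.
apply abs_eq_zero; rewrite abs_ofR, Rabs_R0; easy.
Qed.

Lemma ofR_opp (x : R) : ofR iota (- x) = opp (ofR iota x).
Proof.
assert (H : plus (ofR iota x) (ofR iota (- x)) = zero).
{ rewrite <- ofR_plus, Rplus_opp_r; apply ofR_zero. }
replace (ofR iota (- x)) with (minus (plus (ofR iota x) (ofR iota (- x))) (ofR iota x))
  by kring.
rewrite H; kring.
Qed.

Lemma abs_ofR_ge0 (x : R) : 0 <= x -> abs (ofR iota x) = x.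
Proof. intros H; rewrite abs_ofR; now apply Rabs_pos_eq. Qed.

Lemma kmult_bsum (a : K) (u : nat -> K) (n : nat) :
  mult a (@bsum K u n) = @bsum K (fun i => mult a (u i)) n.
Proof.
apply (@bsum_morph K K (fun x => mult a x)).
- exact (@mult_zero_r K a).
- intros x y; exact (@mult_distr_l K a x y).
Qed.

Variable V : NormedModule K.
Ltac mring := module_norm K V; kring.

Lemma norm_scalE (a : K) (x : V) : norm (scal a x) = abs a * norm x.
Proof.
apply Rle_antisym; [apply @norm_scal|].
destruct (classic (a = zero)) as [->|Ha].
{ rewrite abs_zero, Rmult_0_l; apply norm_ge_0. }
destruct (scalar_inv iota Ha) as [b Hb].
assert (Hab : abs b * abs a = 1) by (rewrite <- (abs_multE iota), Hb; apply abs_one).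
replace x with (scal b (scal a x)) at 1.
2:{ transitivity (scal (mult b a) x); [mring|rewrite Hb; mring]. }
assert (H := @norm_scal K V b (scal a x)).
assert (0 <= abs a) by apply abs_ge_0.
apply Rle_trans with (abs a * (abs b * norm (scal a x))).
- now apply Rmult_le_compat_l.
- rewrite <- Rmult_assoc, (Rmult_comm (abs a)), Hab; lra.
Qed.

Lemma norm_minus_self (x : V) : norm (minus x x) = 0.
Proof. transitivity (norm (@zero V)); [f_equal; mring|apply norm_zero]. Qed.

Lemma norm_minus_sym (x y : V) : norm (minus x y) = norm (minus y x).
Proof. rewrite <- norm_opp; f_equal; mring. Qed.

Lemma norm_minus_le (x y : V) : norm (minus x y) <= norm x + norm y.
Proof. rewrite <- (norm_opp y); apply @norm_triangle. Qed.

Lemma norm_le_minus (x y : V) : norm x <= norm (minus x y) + norm y.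
Proof. replace x with (plus (minus x y) y) at 1 by mring; apply @norm_triangle. Qed.

Lemma bsum_scal (a : K) (u : nat -> V) (n : nat) :
  @bsum V (fun i => scal a (u i)) n = scal a (bsum u n).
Proof.
symmetry; apply (@bsum_morph V V (fun x => scal a x)); [mring|intros; mring].
Qed.

Lemma bsum_minus (u v : nat -> V) (n : nat) :
  @bsum V (fun i => minus (u i) (v i)) n = minus (bsum u n) (bsum v n).
Proof.
induction n as [|n IH]; simpl; [|rewrite IH]; mring.
Qed.

Lemma series_iff (a : nat -> V) (l : V) :
  is_series a l <->
  (forall e, 0 < e -> exists N, forall n, (N <= n)%nat -> norm (minus (bsum a n) l) < e).
Proof.
assert (E := @filterlim_locally_ball_norm K nat V eventually _ (sum_n a) l).
split; intros H; [assert (H1 := proj1 E H)|apply (proj2 E)].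
- intros e He; destruct (H1 (mkposreal e He)) as [N HN].
  exists (S N); intros [|n] Hn; [lia|].
  rewrite bsum_sum_n; apply HN; lia.
- intros e; destruct (H e (cond_pos e)) as [N HN].
  exists N; intros n Hn; unfold ball_norm; rewrite <- bsum_sum_n; apply HN; lia.
Qed.

Lemma norm_small_eq (x y : V) : (forall e, 0 < e -> norm (minus x y) < e) -> x = y.
Proof.
intros H; assert (E : minus x y = zero).
{ apply norm_eq_zero; apply Rle_antisym; [|apply norm_ge_0].
  apply le_epsilon; intros e He; rewrite Rplus_0_l; now apply Rlt_le, H. }
replace x with (plus (minus x y) y) by mring; rewrite E; mring.
Qed.

Lemma series_unique (a : nat -> V) (l l' : V) :
  is_series a l -> is_series a l' -> l = l'.
Proof.
rewrite !series_iff; intros H H'; apply norm_small_eq; intros e He.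
destruct (H (e / 2)) as [N HN]; [lra|]; destruct (H' (e / 2)) as [N' HN']; [lra|].
specialize (HN (N + N')%nat); specialize (HN' (N + N')%nat).
set (s := bsum a (N + N')) in *.
replace (minus l l') with (plus (minus l s) (minus s l')) by mring.
eapply Rle_lt_trans; [apply @norm_triangle|].
rewrite (norm_minus_sym l s).
assert (norm (minus s l) < e / 2) by (apply HN; lia).
assert (norm (minus s l') < e / 2) by (apply HN'; lia).
lra.
Qed.

Lemma series_finite (a : nat -> V) (N : nat) :
  (forall j, (N <= j)%nat -> a j = zero) -> is_series a (bsum a N).
Proof.
intros H; apply series_iff; intros e He; exists N; intros n Hn.
rewrite (@bsum_stop V a N n) by (try intros; try apply H; lia).
rewrite norm_minus_self; easy.
Qed.

Lemma series_eq_finite (a : nat -> V) (N : nat) (l : V) :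
  (forall j, (N <= j)%nat -> a j = zero) -> is_series a l -> l = bsum a N.
Proof. intros H Hl; exact (series_unique Hl (series_finite H)). Qed.

End NormedModules.

Section LinearMaps.

Variable K : AbsRing.
Variable iota : real_subfield K.
Add Ring K_ring : (scalar_ring_theory iota).
Ltac kring := kring_norm K; ring.
Variables V W : NormedModule K.
Variable f : V -> W.
Hypothesis Hf : is_linear f.

Lemma lin_zero : f zero = zero.
Proof.
transitivity (f (scal (zero : K) zero)).
- f_equal; symmetry; exact (scal_zero_l (zero : V)).
- etransitivity; [apply (linear_scal f Hf)|exact (scal_zero_l (f zero))].
Qed.

Lemma lin_opp (x : V) : f (opp x) = opp (f x).
Proof.
transitivity (f (scal (opp one) x)).
- f_equal; module_norm K V; kring.
- etransitivity; [apply (linear_scal f Hf)|module_norm K W; kring].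
Qed.

Lemma lin_minus (x y : V) : f (minus x y) = minus (f x) (f y).
Proof. unfold minus; now rewrite (linear_plus f Hf), lin_opp. Qed.

Lemma lin_bsum (u : nat -> V) (n : nat) : f (bsum u n) = bsum (fun i => f (u i)) n.
Proof. apply (@bsum_morph V W f); [apply lin_zero|apply (linear_plus f Hf)]. Qed.

Lemma lin_series (a : nat -> V) (l : V) :
  is_series a l -> is_series (fun j => f (a j)) (f l).
Proof.
rewrite !series_iff; intros H e He.
destruct (linear_norm f Hf) as [M [HM HMf]].
destruct (H (e / M)) as [N HN]; [now apply Rdiv_lt_0_compat|].
exists N; intros n Hn; rewrite <- lin_bsum, <- lin_minus.
eapply Rle_lt_trans; [apply HMf|].
apply Rlt_le_trans with (M * (e / M)); [now apply Rmult_lt_compat_l, HN|].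
apply Req_le; field; lra.
Qed.

End LinearMaps.

(** * Quasi-greedy bases: at most logarithmic conditionality *)

Lemma list_argmin (L : list nat) (P : nat -> Prop) (w : nat -> R) :
  (exists j, In j L /\ P j) ->
  exists j0, In j0 L /\ P j0 /\ forall j, In j L -> P j -> w j0 <= w j.
Proof.
induction L as [|i L IH]; intros [j [Hj Pj]]; [easy|].
destruct (classic (exists j, In j L /\ P j)) as [H|H].
- destruct (IH H) as [j0 [H0 [P0 M0]]].
  destruct (classic (P i /\ w i <= w j0)) as [[Pi Hi]|Hi].
  + exists i; split; [now left|split; [easy|]].
    intros k [<-|Hk] Pk; [lra|]; specialize (M0 k Hk Pk); lra.
  + exists j0; split; [now right|split; [easy|]].
    intros k [<-|Hk] Pk; [|now apply M0].
    destruct (Rle_lt_dec (w i) (w j0)); [tauto|lra].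
- exists i; destruct Hj as [<-|Hj]; [|exfalso; eauto].
  split; [now left|split; [easy|]].
  intros k [<-|Hk] Pk; [lra|exfalso; eauto].
Qed.

Definition Rleb (x y : R) : bool := if Rle_dec x y then true else false.

Lemma Rleb_true (x y : R) : Rleb x y = true <-> x <= y.
Proof. unfold Rleb; destruct (Rle_dec x y); split; easy. Qed.

Lemma Rleb_false (x y : R) : Rleb x y = false <-> y < x.
Proof. unfold Rleb; destruct (Rle_dec x y); split; intros; try easy; lra. Qed.

Section Cube.

Variable K : AbsRing.
Variable iota : real_subfield K.
Add Ring K_ring : (scalar_ring_theory iota).
Ltac kring := kring_norm K; ring.
Variable V : NormedModule K.
Ltac mring := module_norm K V; kring.

Lemma ofR_convex (b : R) : ofR iota (1 - b) = minus one (ofR iota b).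
Proof. unfold Rminus; now rewrite (ofR_plus iota), ofR_opp, ofR_one. Qed.

(** The norm is convex in each weight separately, so over the cube it is
    largest at a vertex.  Rounding one weight at a time spares any ordering of
    the weights. *)
Lemma norm_cube (v : nat -> V) (b : nat -> R) (M : R) (m : nat) :
  (forall j, 0 <= b j <= 1) ->
  forall g : V,
  (forall A : nat -> bool,
     norm (plus g (@bsum V (fun j => if A j then v j else zero) m)) <= M) ->
  norm (plus g (@bsum V (fun j => scal (ofR iota (b j)) (v j)) m)) <= M.
Proof.
intros Hb; induction m as [|m IH]; intros g H; simpl.
{ apply (H (fun _ => true)). }
set (s := @bsum V (fun j => scal (ofR iota (b j)) (v j)) m).
replace (plus g (plus s (scal (ofR iota (b m)) (v m))))
  with (plus (scal (ofR iota (1 - b m)) (plus g s))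
             (scal (ofR iota (b m)) (plus (plus g (v m)) s)))
  by (rewrite ofR_convex; mring).
assert (Hb' := Hb m).
eapply Rle_trans; [apply @norm_triangle|].
rewrite !(norm_scalE iota), !abs_ofR_ge0 by lra.
assert (H1 : norm (plus g s) <= M).
{ apply IH; intros A.
  specialize (H (fun j => if Nat.eqb j m then false else A j)); simpl in H.
  rewrite Nat.eqb_refl in H.
  eapply Rle_trans; [|exact H]; apply Req_le; f_equal; f_equal.
  transitivity (plus (@bsum V (fun j => if A j then v j else zero) m) zero); [mring|].
  f_equal; apply bsum_ext; intros i Hi.
  now rewrite (proj2 (Nat.eqb_neq i m)) by lia. }
assert (H2 : norm (plus (plus g (v m)) s) <= M).
{ apply IH; intros A.
  specialize (H (fun j => if Nat.eqb j m then true else A j)); simpl in H.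
  rewrite Nat.eqb_refl in H.
  eapply Rle_trans; [|exact H]; apply Req_le; f_equal.
  transitivity (plus g (plus (@bsum V (fun j => if A j then v j else zero) m) (v m)));
    [mring|].
  f_equal; f_equal; apply bsum_ext; intros i Hi.
  now rewrite (proj2 (Nat.eqb_neq i m)) by lia. }
nra.
Qed.

End Cube.

Section QuasiGreedyUpper.

Variable K : AbsRing.
Variable iota : real_subfield K.
Add Ring K_ring : (scalar_ring_theory iota).
Ltac kring := kring_norm K; ring.
Variable X : NormedModule K.
Ltac mring := module_norm K X; kring.
Variable B : SchauderBasis X.
Notation x := (basis_vec B).

Definition fincomb (a : nat -> K) (N : nat) : X :=
  @bsum X (fun j => scal (a j) (x j)) N.

Definition finproj (F : nat -> bool) (a : nat -> K) (N : nat) : X :=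
  @bsum X (fun j => if F j then scal (a j) (x j) else zero) N.

Definition greedy_set (F : nat -> bool) (a : nat -> K) : Prop :=
  forall j k, F j = false -> F k = true -> abs (a j) <= abs (a k).

Lemma scal_zeroE (v : X) (a : K) : a = zero -> scal a v = zero.
Proof. intros ->; exact (scal_zero_l v). Qed.

Lemma basis_coord_finite (a : nat -> K) (N : nat) :
  (forall j, (N <= j)%nat -> a j = zero) ->
  forall j, basis_coord B j (fincomb a N) = a j.
Proof.
intros H j; symmetry; apply (@basis_unique K X B).
apply (series_finite iota); intros i Hi; now apply scal_zeroE, H.
Qed.

Lemma is_S_finite (A : nat -> bool) (f g : X) (N : nat) :
  (forall j, (N <= j)%nat -> A j = true -> basis_coord B j f = zero) ->
  is_S B A f g -> g = finproj A (fun j => basis_coord B j f) N.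
Proof.
intros H Hg; apply (series_eq_finite iota); [|exact Hg].
intros j Hj; specialize (H j Hj); destruct (A j); [|easy].
now apply scal_zeroE, H.
Qed.

Lemma finproj_is_S (A : nat -> bool) (f : X) (N : nat) :
  (forall j, (N <= j)%nat -> A j = true -> basis_coord B j f = zero) ->
  is_S B A f (finproj A (fun j => basis_coord B j f) N).
Proof.
intros H; apply (series_finite iota).
intros j Hj; specialize (H j Hj); destruct (A j); [|easy].
now apply scal_zeroE, H.
Qed.

Lemma finite_expansion (f : X) (N : nat) :
  (forall j, (N <= j)%nat -> basis_coord B j f = zero) ->
  f = fincomb (fun j => basis_coord B j f) N.
Proof.
intros H; apply (series_eq_finite iota); [|apply basis_expansion].
intros j Hj; now apply scal_zeroE, H.
Qed.

Variable C : R.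
Hypothesis HC0 : 0 <= C.
Hypothesis HC : forall (f g : X) (F : nat -> bool),
  (exists N : nat, forall j, F j = true -> (j < N)%nat) ->
  greedy_set F (fun j => basis_coord B j f) ->
  is_S B F f g -> norm (minus f g) <= C * norm f.

Let D := C + 1.

Lemma greedy_sum_le (a : nat -> K) (N : nat) (F : nat -> bool) :
  (forall j, (N <= j)%nat -> a j = zero) ->
  (forall j, F j = true -> (j < N)%nat) ->
  greedy_set F a ->
  norm (finproj F a N) <= D * norm (fincomb a N).
Proof.
intros Ha HF HG.
set (f := fincomb a N); set (g := finproj F a N).
assert (E : forall j, basis_coord B j f = a j) by now apply basis_coord_finite.
assert (Eg : g = finproj F (fun j => basis_coord B j f) N).
{ apply (@bsum_ext X); intros i Hi; now rewrite E. }
assert (H : norm (minus f g) <= C * norm f).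
{ apply (HC (F := F)).
  - now exists N.
  - intros j k Hj Hk; rewrite !E; now apply HG.
  - rewrite Eg; apply finproj_is_S.
    intros j Hj Fj; specialize (HF j Fj); lia. }
assert (H1 := norm_le_minus iota g f); rewrite (norm_minus_sym iota) in H1.
unfold D; lra.
Qed.

(** Weights in [0,1] that increase with the modulus of the coefficients are
    convex combinations of indicators of greedy sets: if [s] is the smallest
    positive weight, then [w = s * 1_(w > 0) + (1 - s) * w'], where [w'] has the
    same property and takes one value fewer in the open interval.  The list [L]
    of the indices with weight in (0,1) carries the induction. *)
Lemma comonotone_sum_le (a : nat -> K) (N : nat) :
  (forall j, (N <= j)%nat -> a j = zero) ->
  forall (n : nat) (L : list nat), (length L <= n)%nat ->
  forall w : nat -> R,
  (forall j, 0 <= w j <= 1) ->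
  (forall j, (N <= j)%nat -> w j = 0) ->
  (forall i j, w i < w j -> abs (a i) <= abs (a j)) ->
  (forall j, 0 < w j < 1 -> In j L) ->
  norm (@bsum X (fun j => scal (ofR iota (w j)) (scal (a j) (x j))) N)
    <= D * norm (fincomb a N).
Proof.
intros Ha n; induction n as [|n IH]; intros L HL w Hw Hw0 Hmono Hin.
all: destruct (classic (exists j, In j L /\ 0 < w j < 1)) as [Hex|Hex].
- destruct Hex as [j [Hj _]]; destruct L; [easy|simpl in HL; lia].
- assert (HF : greedy_set (fun j => Rleb 1 (w j)) a).
  { intros j k Hj Hk; apply Hmono.
    apply Rleb_false in Hj; apply Rleb_true in Hk; lra. }
  refine (Rle_trans _ _ _ _ (greedy_sum_le Ha _ HF)).
  2:{ intros j Hj; apply Rleb_true in Hj.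
      destruct (le_lt_dec N j) as [H|H]; [|easy].
      rewrite (Hw0 j H) in Hj; lra. }
  apply Req_le; f_equal; apply (@bsum_ext X); intros i Hi.
  destruct (Rleb 1 (w i)) eqn:E.
  + apply Rleb_true in E; replace (w i) with 1 by (specialize (Hw i); lra).
    rewrite (ofR_one iota); mring.
  + apply Rleb_false in E; replace (w i) with 0.
    * rewrite ofR_zero; mring.
    * destruct (Req_dec_T (w i) 0) as [|Hne]; [easy|].
      exfalso; apply Hex; exists i; specialize (Hw i).
      split; [apply Hin|]; lra.
- destruct (list_argmin w Hex) as [j0 [H0 [P0 M0]]].
  set (s := w j0) in *.
  set (w' := fun j => if Rleb (w j) 0 then 0 else (w j - s) / (1 - s)).
  assert (Hs : forall j, 0 < w j -> s <= w j).
  { intros j Hj; destruct (Rlt_le_dec (w j) 1) as [H1|H1]; [|lra].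
    apply M0; [apply Hin|]; lra. }
  assert (Hw' : forall j, 0 <= w' j <= 1).
  { intros j; unfold w'; destruct (Rleb (w j) 0) eqn:E; [lra|].
    apply Rleb_false in E; specialize (Hs j E); specialize (Hw j).
    split; [apply Rdiv_le_0_compat; lra|].
    apply Rmult_le_reg_r with (1 - s); [lra|].
    unfold Rdiv; rewrite Rmult_assoc, Rinv_l; lra. }
  assert (HR : norm (@bsum X (fun j => scal (ofR iota (w' j)) (scal (a j) (x j))) N)
    <= D * norm (fincomb a N)).
  { apply (IH (remove Nat.eq_dec j0 L)); [|easy|..].
    - assert (H := remove_length_lt Nat.eq_dec L j0 H0); lia.
    - intros j Hj; unfold w'; rewrite (Hw0 j Hj).
      now rewrite (proj2 (Rleb_true 0 0)) by lra.
    - intros i j Hij; apply Hmono; apply Rnot_le_lt; intros Hle.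
      apply (Rlt_not_le _ _ Hij); unfold w'.
      destruct (Rleb (w j) 0) eqn:Ej, (Rleb (w i) 0) eqn:Ei;
        try apply Rleb_true in Ej; try apply Rleb_true in Ei;
        try apply Rleb_false in Ej; try apply Rleb_false in Ei; try lra.
      + apply Rdiv_le_0_compat; [specialize (Hs i Ei)|]; lra.
      + apply Rmult_le_compat_r; [apply Rlt_le, Rinv_0_lt_compat|]; lra.
    - intros j [H1 H2]; unfold w' in H1, H2.
      destruct (Rleb (w j) 0) eqn:Ej; [lra|]; apply Rleb_false in Ej.
      apply in_in_remove.
      + intros ->; unfold Rdiv in H1; fold s in H1.
        rewrite Rminus_eq_0, Rmult_0_l in H1; lra.
      + apply Hin; split; [easy|].
        apply Rnot_le_lt; intros Hle.
        assert (Ew : w j = 1) by (specialize (Hw j); lra).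
        rewrite Ew in H2; unfold Rdiv in H2; rewrite Rinv_r in H2; lra. }
  assert (HF : greedy_set (fun j => negb (Rleb (w j) 0)) a).
  { intros j k Hj Hk; apply Hmono.
    apply Bool.negb_false_iff, Rleb_true in Hj.
    apply Bool.negb_true_iff, Rleb_false in Hk; lra. }
  assert (HG : norm (finproj (fun j => negb (Rleb (w j) 0)) a N) <= D * norm (fincomb a N)).
  { apply greedy_sum_le; [easy| |easy].
    intros j Hj; apply Bool.negb_true_iff, Rleb_false in Hj.
    destruct (le_lt_dec N j) as [H|H]; [|easy].
    rewrite (Hw0 j H) in Hj; lra. }
  replace (@bsum X (fun j => scal (ofR iota (w j)) (scal (a j) (x j))) N)
    with (plus (scal (ofR iota s) (finproj (fun j => negb (Rleb (w j) 0)) a N))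
               (scal (ofR iota (1 - s))
                 (@bsum X (fun j => scal (ofR iota (w' j)) (scal (a j) (x j))) N))).
  2:{ unfold finproj; rewrite <- !(bsum_scal iota), <- bsum_plus.
      apply (@bsum_ext X); intros i Hi; unfold w'.
      destruct (Rleb (w i) 0) eqn:E; simpl.
      - apply Rleb_true in E; replace (w i) with 0 by (specialize (Hw i); lra).
        rewrite ofR_zero; mring.
      - apply Rleb_false in E.
        transitivity (scal (ofR iota (s + (1 - s) * ((w i - s) / (1 - s))))
                           (scal (a i) (x i))).
        + rewrite (ofR_plus iota), (ofR_mult iota); mring.
        + f_equal; f_equal; field; lra. }
  eapply Rle_trans; [apply @norm_triangle|].
  rewrite !(norm_scalE iota), !abs_ofR_ge0 by lra.
  assert (0 <= s <= 1) by apply Hw.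
  nra.
- apply (IH nil); simpl; try lia; try easy.
  intros j Hj; exfalso; apply Hex; exists j; auto.
Qed.

(** The unimodular factor of a nonzero scalar. *)
Definition ksign (a : K) : K := mult (ofR iota (/ abs a)) a.

Lemma abs_ksign (a : K) : 0 < abs a -> abs (ksign a) = 1.
Proof.
intros Ha; unfold ksign; rewrite (abs_multE iota), abs_ofR_ge0.
- apply Rinv_l; lra.
- now apply Rlt_le, Rinv_0_lt_compat.
Qed.

Lemma ksignE (a : K) : 0 < abs a -> a = mult (ofR iota (abs a)) (ksign a).
Proof.
intros Ha; unfold ksign.
transitivity (mult (ofR iota (abs a * / abs a)) a).
- rewrite Rinv_r by lra; rewrite (ofR_one iota); kring.
- rewrite (ofR_mult iota); kring.
Qed.

Definition truncsign (a : nat -> K) (tau : R) (j : nat) : K :=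
  if Rleb tau (abs (a j)) then ksign (a j) else zero.

(** On the indices with [tau <= |a_j|], replacing [a_j] by [tau * sign a_j]
    amounts to subtracting the weights [1 - tau / |a_j|] from 1.  These
    weights increase with the modulus. *)
Lemma truncation_le (a : nat -> K) (N : nat) (tau : R) :
  (forall j, (N <= j)%nat -> a j = zero) -> 0 < tau ->
  tau * norm (fincomb (truncsign a tau) N) <= 2 * D * norm (fincomb a N).
Proof.
intros Ha Ht.
set (F := fun j => Rleb tau (abs (a j))).
set (w := fun j => if F j then 1 - tau / abs (a j) else 0).
assert (Fout : forall j, F j = true -> (j < N)%nat).
{ intros j Hj; unfold F in Hj; apply Rleb_true in Hj.
  destruct (le_lt_dec N j) as [H|H]; [|easy].
  rewrite (Ha j H), abs_zero in Hj; lra. }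
assert (H1 : norm (finproj F a N) <= D * norm (fincomb a N)).
{ apply greedy_sum_le; try easy; intros j k Hj Hk.
  unfold F in Hj, Hk; apply Rleb_false in Hj; apply Rleb_true in Hk; lra. }
assert (Hq : forall j, F j = true -> 0 < tau / abs (a j) <= 1).
{ intros j Hj; unfold F in Hj; apply Rleb_true in Hj.
  split; [apply Rdiv_lt_0_compat; lra|].
  apply Rmult_le_reg_r with (abs (a j)); [lra|].
  unfold Rdiv; rewrite Rmult_assoc, Rinv_l; lra. }
assert (H2 : norm (@bsum X (fun j => scal (ofR iota (w j)) (scal (a j) (x j))) N)
             <= D * norm (fincomb a N)).
{ apply (@comonotone_sum_le a N Ha _ (seq 0 N) (le_n _)).
  - intros j; unfold w; destruct (F j) eqn:E; [|lra].
    specialize (Hq j E); lra.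
  - intros j Hj; unfold w; destruct (F j) eqn:E; [|easy].
    specialize (Fout j E); lia.
  - intros i j; unfold w; destruct (F j) eqn:Ej, (F i) eqn:Ei.
    + unfold F in Ei, Ej; apply Rleb_true in Ej; apply Rleb_true in Ei.
      intros Hij; apply Rnot_lt_le; intros Hlt.
      assert (tau / abs (a i) < tau / abs (a j)); [|lra].
      apply Rmult_lt_compat_l; [easy|]; apply Rinv_lt_contravar; nra.
    + intros _; unfold F in Ei, Ej; apply Rleb_true in Ej; apply Rleb_false in Ei; lra.
    + intros H; specialize (Hq i Ei); lra.
    + lra.
  - intros j Hj; apply in_seq; split; [lia|].
    simpl; apply Fout; unfold w in Hj; destruct (F j); [easy|lra]. }
replace (tau * norm (fincomb (truncsign a tau) N))
  with (norm (minus (finproj F a N)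
    (@bsum X (fun j => scal (ofR iota (w j)) (scal (a j) (x j))) N))).
- eapply Rle_trans; [apply norm_minus_le|lra].
- transitivity (norm (scal (ofR iota tau) (fincomb (truncsign a tau) N))).
  2:{ rewrite (norm_scalE iota), abs_ofR_ge0; lra. }
  f_equal; unfold finproj, fincomb.
  rewrite <- (bsum_minus iota), <- (bsum_scal iota).
  apply (@bsum_ext X); intros i Hi; unfold truncsign, w; change (Rleb tau (abs (a i))) with (F i).
  destruct (F i) eqn:E; [|rewrite ofR_zero; mring].
  unfold F in E; apply Rleb_true in E.
  unfold ksign.
  transitivity (scal (mult (ofR iota (tau / abs (a i))) (a i)) (x i)).
  + rewrite ofR_convex; mring.
  + unfold Rdiv; rewrite (ofR_mult iota); mring.
Qed.

(** A vector of signs controls all its subsums, since every subset of its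
    support is a greedy set.  By convexity the same bound holds with
    coefficients between 0 and [2 * tau] in front of the signs, and
    [truncation_le] bounds the vector of signs. *)
Lemma level_le (a : nat -> K) (N : nat) (tau : R) (A : nat -> bool) :
  (forall j, (N <= j)%nat -> a j = zero) -> 0 < tau ->
  (forall j, A j = true -> tau <= abs (a j) <= 2 * tau) ->
  norm (finproj A a N) <= 4 * D * D * norm (fincomb a N).
Proof.
intros Ha Ht HA.
set (b := fun j => if A j then abs (a j) / (2 * tau) else 0).
set (v := fun j => if A j then scal (ofR iota (2 * tau)) (scal (ksign (a j)) (x j)) else zero).
replace (finproj A a N)
  with (plus zero (@bsum X (fun j => scal (ofR iota (b j)) (v j)) N)).
2:{ transitivity (@bsum X (fun j => scal (ofR iota (b j)) (v j)) N); [mring|].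
    apply (@bsum_ext X); intros i Hi; unfold b, v.
    destruct (A i) eqn:E; [|rewrite ofR_zero; mring].
    specialize (HA i E).
    transitivity (scal (mult (ofR iota (abs (a i))) (ksign (a i))) (x i)).
    2:{ f_equal; symmetry; apply ksignE; lra. }
    transitivity (scal (mult (ofR iota (abs (a i) / (2 * tau) * (2 * tau)))
                             (ksign (a i))) (x i)).
    - rewrite (ofR_mult iota (abs (a i) / (2 * tau)) (2 * tau)); mring.
    - f_equal; f_equal; f_equal; field; lra. }
apply norm_cube.
{ intros j; unfold b; destruct (A j) eqn:E; [|lra]; specialize (HA j E).
  split; [apply Rdiv_le_0_compat; lra|].
  apply Rmult_le_reg_r with (2 * tau); [lra|].
  unfold Rdiv; rewrite Rmult_assoc, Rinv_l; lra. }
intros A'.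
set (F := fun j => andb (A' j) (A j)).
replace (plus zero (@bsum X (fun j => if A' j then v j else zero) N))
  with (scal (ofR iota (2 * tau)) (finproj F (truncsign a tau) N)).
2:{ transitivity (@bsum X (fun j => if A' j then v j else zero) N); [|mring].
    unfold finproj; rewrite <- (bsum_scal iota); apply (@bsum_ext X); intros i Hi.
    unfold F, v, truncsign; destruct (A' i); simpl; [|mring].
    destruct (A i) eqn:E; [|mring].
    now rewrite (proj2 (Rleb_true _ _) (proj1 (HA i E))). }
rewrite (norm_scalE iota), abs_ofR_ge0 by lra.
assert (H1 : norm (finproj F (truncsign a tau) N) <= D * norm (fincomb (truncsign a tau) N)).
{ apply greedy_sum_le.
  - intros j Hj; unfold truncsign; rewrite (Ha j Hj), abs_zero.
    now rewrite (proj2 (Rleb_false _ _) Ht).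
  - intros j Hj; unfold F in Hj; apply Bool.andb_true_iff in Hj; destruct Hj as [_ Hj].
    destruct (le_lt_dec N j) as [H|H]; [|easy].
    specialize (HA j Hj); rewrite (Ha j H), abs_zero in HA; lra.
  - intros j k Hj Hk; unfold F in Hk; apply Bool.andb_true_iff in Hk; destruct Hk as [_ Hk].
    specialize (HA k Hk); unfold truncsign.
    rewrite (proj2 (Rleb_true _ _) (proj1 HA)), abs_ksign by lra.
    destruct (Rleb tau (abs (a j))) eqn:E; [|rewrite abs_zero; lra].
    apply Rleb_true in E; rewrite abs_ksign; lra. }
assert (H2 := truncation_le Ha Ht).
assert (0 <= D) by (unfold D; lra).
apply Rle_trans with (2 * D * (tau * norm (fincomb (truncsign a tau) N))).
- nra.
- apply Rle_trans with (2 * D * (2 * D * norm (fincomb a N))); [|lra].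
  apply Rmult_le_compat_l; lra.
Qed.

Lemma levels_le (a : nat -> K) (N : nat) (M : R) (n : nat) (A : nat -> bool) :
  (forall j, (N <= j)%nat -> a j = zero) -> 0 < M ->
  (forall j, A j = true -> M / 2 ^ n < abs (a j) <= M) ->
  norm (finproj A a N) <= INR n * (4 * D * D * norm (fincomb a N)).
Proof.
intros Ha HM; revert A; induction n as [|n IH]; intros A HA.
- unfold finproj; rewrite bsum_zero; [rewrite norm_zero; simpl; lra|].
  intros i Hi; destruct (A i) eqn:E; [|easy].
  specialize (HA i E); simpl in HA; lra.
- set (A1 := fun j => andb (A j) (negb (Rleb (abs (a j)) (M / 2 ^ n)))).
  set (A2 := fun j => andb (A j) (Rleb (abs (a j)) (M / 2 ^ n))).
  replace (finproj A a N) with (plus (finproj A1 a N) (finproj A2 a N)).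
  2:{ unfold finproj; rewrite <- bsum_plus; apply (@bsum_ext X); intros i Hi.
      unfold A1, A2; destruct (A i); simpl; [|mring].
      destruct (Rleb (abs (a i)) (M / 2 ^ n)); simpl; mring. }
  eapply Rle_trans; [apply @norm_triangle|].
  rewrite S_INR, Rmult_plus_distr_r, Rmult_1_l; apply Rplus_le_compat.
  + apply IH; intros j Hj; unfold A1 in Hj.
    apply Bool.andb_true_iff in Hj; destruct Hj as [Hj1 Hj2].
    apply Bool.negb_true_iff, Rleb_false in Hj2; specialize (HA j Hj1); lra.
  + assert (Hp : 0 < 2 ^ n) by (apply pow_lt; lra).
    apply (@level_le a N (M / 2 ^ S n)); [easy|simpl; apply Rdiv_lt_0_compat; lra|].
    intros j Hj; unfold A2 in Hj.
    apply Bool.andb_true_iff in Hj; destruct Hj as [Hj1 Hj2].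
    apply Rleb_true in Hj2; specialize (HA j Hj1).
    split; [lra|]; eapply Rle_trans; [exact Hj2|].
    apply Req_le; simpl; field; lra.
Qed.

(** Let [M] be the largest modulus.  The coefficients above [M / 2 ^ n] lie in
    [n] dyadic ranges; the others contribute at most
    [N * M / 2 ^ n <= M] times the norm of a basis vector, and [M] itself is
    controlled by a greedy sum with one term. *)
Lemma projection_le (alpha beta : R) (a : nat -> K) (N n : nat) (A : nat -> bool) :
  0 < alpha -> (forall j, alpha <= norm (x j) <= beta) ->
  (forall j, (N <= j)%nat -> a j = zero) -> (INR N <= 2 ^ n) ->
  norm (finproj A a N) <= (4 * D * D * INR n + D * beta / alpha) * norm (fincomb a N).
Proof.
intros Hal Hx Ha HN.
assert (HD : 0 <= D) by (unfold D; lra).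
assert (Hbeta : 0 < beta) by (specialize (Hx 0%nat); lra).
assert (Hn0 := norm_ge_0 (fincomb a N)).
assert (Hpos : 0 <= 4 * D * D * INR n + D * beta / alpha).
{ assert (0 <= INR n) by apply pos_INR.
  assert (0 <= D * beta / alpha) by (apply Rdiv_le_0_compat; nra).
  assert (0 <= D * D) by nra; nra. }
destruct (classic (exists j, In j (seq 0 N) /\ a j <> zero)) as [Hex|Hex].
2:{ unfold finproj; rewrite bsum_zero; [rewrite norm_zero; nra|].
    intros i Hi; destruct (A i); [|easy]; apply scal_zeroE.
    apply NNPP; intros H; apply Hex; exists i; split; [apply in_seq; lia|easy]. }
destruct (list_argmin (fun j => - abs (a j)) Hex) as [j0 [H0 [P0 M0]]].
set (M := abs (a j0)).
assert (HM : 0 < M).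
{ destruct (abs_ge_0 (a j0)) as [H|H]; [easy|].
  exfalso; apply P0, abs_eq_zero; now symmetry. }
assert (Hmax : forall j, abs (a j) <= M).
{ intros j; destruct (classic (a j = zero)) as [E|E]; [rewrite E, abs_zero; lra|].
  assert (In j (seq 0 N)).
  { apply in_seq; split; [lia|]; destruct (le_lt_dec N j) as [H|H]; [|easy].
    exfalso; apply E, Ha, H. }
  specialize (M0 j H E); unfold M; lra. }
apply in_seq in H0.
assert (HMf : M * alpha <= D * norm (fincomb a N)).
{ assert (HF : norm (finproj (fun j => Nat.eqb j j0) a N) <= D * norm (fincomb a N)).
  { apply greedy_sum_le; [easy| |].
    - intros j Hj; apply Nat.eqb_eq in Hj; lia.
    - intros j k _ Hk; apply Nat.eqb_eq in Hk; rewrite Hk; apply Hmax. }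
  eapply Rle_trans; [|exact HF].
  unfold finproj; rewrite (@bsum_single X _ N j0).
  - rewrite Nat.eqb_refl, (norm_scalE iota); apply Rmult_le_compat_l; [apply abs_ge_0|apply Hx].
  - lia.
  - intros i Hi Hne; now rewrite (proj2 (Nat.eqb_neq i j0) Hne). }
set (A1 := fun j => andb (A j) (negb (Rleb (abs (a j)) (M / 2 ^ n)))).
set (A2 := fun j => andb (A j) (Rleb (abs (a j)) (M / 2 ^ n))).
replace (finproj A a N) with (plus (finproj A1 a N) (finproj A2 a N)).
2:{ unfold finproj; rewrite <- bsum_plus; apply (@bsum_ext X); intros i Hi.
    unfold A1, A2; destruct (A i); simpl; [|mring].
    destruct (Rleb (abs (a i)) (M / 2 ^ n)); simpl; mring. }
eapply Rle_trans; [apply @norm_triangle|].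
rewrite Rmult_plus_distr_r; apply Rplus_le_compat.
- replace (4 * D * D * INR n * norm (fincomb a N))
    with (INR n * (4 * D * D * norm (fincomb a N))) by ring.
  apply (@levels_le a N M); [easy|easy|].
  intros j Hj; unfold A1 in Hj; apply Bool.andb_true_iff in Hj; destruct Hj as [_ Hj].
  apply Bool.negb_true_iff, Rleb_false in Hj; split; [easy|apply Hmax].
- assert (Hp : 0 < 2 ^ n) by (apply pow_lt; lra).
  eapply Rle_trans; [apply norm_bsum|].
  apply Rle_trans with (rsum (fun _ => M / 2 ^ n * beta) N).
  + assert (0 < M / 2 ^ n) by (now apply Rdiv_lt_0_compat).
    apply rsum_le; intros i Hi; unfold A2.
    destruct (A i); simpl; [|rewrite norm_zero; nra].
    destruct (Rleb (abs (a i)) (M / 2 ^ n)) eqn:E; [|rewrite norm_zero; nra].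
    apply Rleb_true in E; rewrite (norm_scalE iota).
    apply Rmult_le_compat; [apply abs_ge_0|apply norm_ge_0|easy|apply Hx].
  + rewrite rsum_const.
    apply Rle_trans with (2 ^ n * (M / 2 ^ n * beta)).
    * apply Rmult_le_compat_r; [|easy].
      apply Rmult_le_pos; [apply Rlt_le, Rdiv_lt_0_compat|]; lra.
    * replace (2 ^ n * (M / 2 ^ n * beta)) with (M * alpha * (beta / alpha)) by (field; lra).
      replace (D * beta / alpha * norm (fincomb a N))
        with (D * norm (fincomb a N) * (beta / alpha)) by (field; lra).
      apply Rmult_le_compat_r; [apply Rdiv_le_0_compat; lra|easy].
Qed.

End QuasiGreedyUpper.

Section LogUpper.

Variable K : AbsRing.
Variable iota : real_subfield K.
Variable X : NormedModule K.

Lemma ln_2_pos : 0 < ln 2.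
Proof. rewrite <- ln_1; apply ln_increasing; lra. Qed.

Lemma ln_pow2 (n : nat) : ln (2 ^ n) = INR n * ln 2.
Proof. apply ln_pow; lra. Qed.

Lemma log2_ln_bounds (m : nat) : (1 <= m)%nat ->
  INR (Nat.log2 m) * ln 2 <= ln (INR m) /\ INR m <= 2 ^ S (Nat.log2 m).
Proof.
intros Hm; destruct (Nat.log2_spec m) as [H1 H2]; [lia|].
assert (H0 : 0 < INR m) by (apply lt_0_INR; lia).
split.
- rewrite <- ln_pow2; apply Rcomplements.ln_le; [apply pow_lt; lra|].
  replace 2 with (INR 2) by (simpl; ring); rewrite <- pow_INR; now apply le_INR.
- replace 2 with (INR 2) by (simpl; ring); rewrite <- pow_INR; apply le_INR; lia.
Qed.

(** The number of dyadic ranges that matter for [m] coefficients is about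
    [log2 m]. *)
Theorem quasi_greedy_L_upper (B : SchauderBasis X) :
  quasi_greedy B ->
  lesssim (fun m : nat => (2 <= m)%nat) (L_ B) (fun m => Finite (ln (INR m))).
Proof.
intros [C0 HC0].
set (C := Rmax C0 0).
assert (HCpos : 0 <= C) by apply Rmax_r.
assert (HC : forall (f g : X) (F : nat -> bool),
  (exists N : nat, forall j, F j = true -> (j < N)%nat) ->
  greedy_set F (fun j => basis_coord B j f) ->
  is_S B F f g -> norm (minus f g) <= C * norm f).
{ intros f g F H1 H2 H3; eapply Rle_trans; [now apply (HC0 f g F)|].
  apply Rmult_le_compat_r; [apply norm_ge_0|apply Rmax_l]. }
destruct (basis_seminormalized B) as [alpha [beta [Hal Hx]]].
assert (Hbeta : 0 < beta) by (specialize (Hx 0%nat); lra).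
assert (Hl := ln_2_pos).
set (D := C + 1); assert (HD : 1 <= D) by (unfold D; lra).
assert (Hba : 0 < D * beta / alpha) by (apply Rdiv_lt_0_compat; nra).
(* There are [S (Nat.log2 m)] ranges, at most [2 * ln m / ln 2] as [m >= 2]. *)
exists ((8 * D * D + D * beta / alpha) / ln 2); split.
{ apply Rdiv_lt_0_compat; nra. }
intros m Hm.
change (Rbar_le (L_ B m) (Finite ((8 * D * D + D * beta / alpha) / ln 2 * ln (INR m)))).
apply (Lub_Rbar_correct _); intros r [f [g [A [Hf [Hsupp [Hg ->]]]]]].
assert (Hs : forall j, (m <= j)%nat -> basis_coord B j f = zero).
{ intros j Hj; apply NNPP; intros H; specialize (Hsupp j H); lia. }
assert (Hf0 : 0 < norm f).
{ destruct (norm_ge_0 f) as [H|H]; [easy|]; exfalso; apply Hf.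
  now apply norm_eq_zero. }
destruct (@log2_ln_bounds m) as [Hm1 Hm2]; [lia|].
assert (Hb := projection_le iota HCpos HC A Hal Hx Hs Hm2).
rewrite <- (finite_expansion iota Hs), <- (is_S_finite iota (N := m) (fun j Hj _ => Hs j Hj) Hg) in Hb.
fold D in Hb.
assert (Hlm : ln 2 <= ln (INR m)).
{ apply Rcomplements.ln_le; [lra|]; replace 2 with (INR 2) by (simpl; ring); now apply le_INR. }
simpl; apply Rmult_le_reg_r with (norm f); [easy|].
unfold Rdiv at 1; rewrite Rmult_assoc, Rinv_l, Rmult_1_r by lra.
eapply Rle_trans; [exact Hb|]; apply Rmult_le_compat_r; [lra|].
apply Rmult_le_reg_r with (ln 2); [easy|].
replace ((8 * D * D + D * beta / alpha) / ln 2 * ln (INR m) * ln 2)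
  with ((8 * D * D + D * beta / alpha) * ln (INR m)) by (field; lra).
rewrite S_INR; set (q := D * beta / alpha) in *.
assert (4 * D * D * ((INR (Nat.log2 m) + 1) * ln 2) <= 4 * D * D * (2 * ln (INR m))).
{ apply Rmult_le_compat_l; nra. }
nra.
Qed.

End LogUpper.

(** * Powers and means *)

Section Powers.

Variable p : R.
Hypothesis Hp : 1 <= p.

Lemma rpow_1 : rpow 1 p = 1.
Proof. rewrite rpow_pos by lra; unfold Rpower; rewrite ln_1, Rmult_0_r; apply exp_0. Qed.

Lemma rpow_le_1 (x : R) : 0 <= x <= 1 -> rpow x p <= 1.
Proof. intros H; rewrite <- rpow_1; apply rpow_le; lra. Qed.

Lemma rpow_ge_self (x : R) : 1 <= x -> x <= rpow x p.
Proof.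
intros H; rewrite rpow_pos by lra.
rewrite <- (Rpower_1 x) at 1 by lra.
destruct (Rle_lt_or_eq_dec 1 x H) as [H1|<-]; [apply Rle_Rpower; lra|].
unfold Rpower; rewrite ln_1, !Rmult_0_r; lra.
Qed.

(** A cheap substitute for the p-th root: it turns bounds on p-th powers into
    bounds on moduli without tracking the exponent. *)
Lemma le_1_rpow (x : R) : 0 <= x -> x <= 1 + rpow x p.
Proof.
intros H; destruct (Rle_lt_dec 1 x) as [H1|H1].
- assert (H2 := rpow_ge_self H1); lra.
- assert (H2 := rpow_ge0 x p); lra.
Qed.

Lemma rpow2_ge1 : 1 <= rpow 2 p.
Proof. assert (H := @rpow_ge_self 2); lra. Qed.

(** A crude triangle inequality for p-th powers.  Constants depending on [p]
    are harmless here, and this form avoids roots of sums. *)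
Lemma rpow_add_le (K : AbsRing) (a b : K) :
  rpow (abs (plus a b)) p <= rpow 2 p * (rpow (abs a) p + rpow (abs b) p).
Proof.
assert (Ha := abs_ge_0 a); assert (Hb := abs_ge_0 b).
assert (H := abs_triangle a b).
set (m := Rmax (abs a) (abs b)).
assert (Hm : 0 <= m) by (unfold m; eapply Rle_trans; [exact Ha|apply Rmax_l]).
apply Rle_trans with (rpow (2 * m) p).
- apply rpow_le; [lra|]; split; [apply abs_ge_0|].
  eapply Rle_trans; [exact H|].
  assert (abs a <= m) by apply Rmax_l; assert (abs b <= m) by apply Rmax_r; lra.
- rewrite rpowM by lra; apply Rmult_le_compat_l; [apply rpow_ge0|].
  assert (Pa := rpow_ge0 (abs a) p); assert (Pb := rpow_ge0 (abs b) p).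
  unfold m; destruct (Rmax_case_strong (abs a) (abs b) (fun x => x = abs a \/ x = abs b))
    as [->| ->]; auto; lra.
Qed.

(** Jensen's inequality for a uniform mean. *)
Lemma rpow_mean_le (v : nat -> R) (n : nat) : (1 <= n)%nat ->
  (forall i, 0 <= v i) ->
  rpow (rsum v n / INR n) p <= rsum (fun i => rpow (v i) p) n / INR n.
Proof.
intros Hn Hv; induction n as [|n IH]; [lia|].
destruct n as [|n].
{ simpl; unfold Rdiv; rewrite !Rplus_0_l, Rinv_1, !Rmult_1_r; lra. }
set (m := S n) in *.
assert (Hm : 0 < INR m) by (apply lt_0_INR; unfold m; lia).
assert (Hm1 : INR (S m) = INR m + 1) by apply S_INR.
assert (Hs : 0 <= rsum v m) by (apply rsum_ge0; auto).
assert (H := @rpow_convex p (INR m / INR (S m)) (1 / INR (S m)) (rsum v m / INR m) (v m) Hp).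
assert (E : INR m / INR (S m) * (rsum v m / INR m) + 1 / INR (S m) * v m
            = rsum v (S m) / INR (S m)).
{ change (rsum v (S m)) with (rsum v m + v m); rewrite Hm1; field; lra. }
rewrite E in H.
eapply Rle_trans.
{ apply H; try easy; try (apply Rdiv_le_0_compat; lra).
  rewrite Hm1; field; lra. }
assert (Hind := IH ltac:(unfold m; lia)).
apply Rle_trans with (INR m / INR (S m) * (rsum (fun i => rpow (v i) p) m / INR m)
  + 1 / INR (S m) * rpow (v m) p).
- apply Rplus_le_compat_r, Rmult_le_compat_l; [apply Rdiv_le_0_compat; lra|easy].
- change (rsum (fun i => rpow (v i) p) (S m))
    with (rsum (fun i => rpow (v i) p) m + rpow (v m) p).
  rewrite Hm1; apply Req_le; field; lra.
Qed.

End Powers.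

(** * One group of dyadic levels *)

Section Dyadic.

Lemma log2_level (l i : nat) : (i < 2 ^ l)%nat -> Nat.log2 (2 ^ l + i) = l.
Proof. intros H; apply Nat.log2_unique; [lia|simpl; lia]. Qed.

Lemma pow2_pos (l : nat) : (1 <= 2 ^ l)%nat.
Proof. assert (H := Nat.pow_nonzero 2 l); lia. Qed.

Lemma INR_pow2 (l : nat) : INR (2 ^ l) = 2 ^ l.
Proof. rewrite pow_INR; f_equal; simpl; ring. Qed.

Lemma rsum_dyadic (u : nat -> R) (k : nat) :
  rsum (fun i => u (S i)) (2 ^ k - 1)
  = rsum (fun l => rsum (fun i => u (2 ^ l + i)%nat) (2 ^ l)) k.
Proof.
induction k as [|k IH]; [easy|].
assert (H := pow2_pos k).
replace (2 ^ S k - 1)%nat with ((2 ^ k - 1) + 2 ^ k)%nat by (simpl; lia).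
rewrite rsum_add, IH; simpl (rsum _ (S k)); f_equal.
apply rsum_ext; intros i Hi; f_equal; lia.
Qed.

Lemma valid_level (k i : nat) : (1 <= i < 2 ^ k)%nat ->
  exists l j, (l < k)%nat /\ (j < 2 ^ l)%nat /\ i = (2 ^ l + j)%nat /\ Nat.log2 i = l.
Proof.
intros Hi; exists (Nat.log2 i), (i - 2 ^ Nat.log2 i)%nat.
destruct (Nat.log2_spec i) as [H1 H2]; [lia|]; simpl in H2.
repeat split; try lia.
apply Nat.log2_lt_pow2; lia.
Qed.

Lemma level_valid (k l j : nat) : (l < k)%nat -> (j < 2 ^ l)%nat ->
  (1 <= 2 ^ l + j < 2 ^ k)%nat.
Proof.
intros Hl Hj; assert (H := pow2_pos l).
assert (2 ^ S l <= 2 ^ k)%nat by (apply Nat.pow_le_mono_r; lia).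
simpl in H0; lia.
Qed.

End Dyadic.

Section Group.

Variable K : AbsRing.
Variable iota : real_subfield K.
Add Ring K_ring : (scalar_ring_theory iota).
Ltac kring := kring_norm K; ring.
Variable p : R.
Hypothesis Hp : 1 <= p.

(** The ratio for which [rho ^ l] is the p-norm of the constant 1 on a level
    with [2 ^ l] elements. *)
Definition rho : R := Rpower 2 (/ p).

Lemma rho_gt1 : 1 < rho.
Proof.
unfold rho; rewrite <- (Rpower_O 2) by lra.
apply Rpower_lt; [lra|]; apply Rinv_0_lt_compat; lra.
Qed.

Lemma rho_pow_pos (l : nat) : 0 < rho ^ l.
Proof. apply pow_lt; assert (H := rho_gt1); lra. Qed.

Lemma rpow_rho (l : nat) : rpow (rho ^ l) p = 2 ^ l.
Proof.
rewrite rpow_pos by apply rho_pow_pos.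
rewrite <- Rpower_pow by (assert (H := rho_gt1); lra).
unfold rho; rewrite !Rpower_mult.
replace (/ p * (INR l * p)) with (INR l) by (field; lra).
apply Rpower_pow; lra.
Qed.

(** The sum of the [a l] times the normalized constant vectors on the levels;
    level [l] consists of the indices from [2 ^ l] to [2 ^ (l + 1) - 1]. *)
Definition level_lift (a : nat -> K) (i : nat) : K :=
  mult (ofR iota (/ rho ^ Nat.log2 i)) (a (Nat.log2 i)).

(** The norm-one functional that is dual to the normalized constant vector
    on level [l]. *)
Definition level_avg (f : nat -> K) (l : nat) : K :=
  mult (ofR iota ((rho / 2) ^ l)) (@bsum K (fun i => f (2 ^ l + i)%nat) (2 ^ l)).

Definition level (f : nat -> K) (l : nat) : R :=
  rsum (fun i => rpow (abs (f (2 ^ l + i)%nat)) p) (2 ^ l).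

(** The p-th power of the p-norm over the first [k] levels. *)
Definition dyadic_sum (k : nat) (f : nat -> K) : R := rsum (level f) k.

Lemma lp_sum_rsum (n : nat) (f : nat -> K) :
  lp_sum p n f = rsum (fun i => rpow (abs (f (S i))) p) n.
Proof.
induction n as [|n IH].
- unfold lp_sum; rewrite sum_n_m_zero by lia; easy.
- unfold lp_sum in *; rewrite sum_n_Sm by lia.
  rewrite IH; easy.
Qed.

Lemma lp_sum_dyadic_sum (k : nat) (f : nat -> K) : lp_sum p (2 ^ k - 1) f = dyadic_sum k f.
Proof.
rewrite lp_sum_rsum; exact (rsum_dyadic (fun i => rpow (abs (f i)) p) k).
Qed.

Lemma level_ge0 (f : nat -> K) (l : nat) : 0 <= level f l.
Proof. apply rsum_ge0; intros; apply rpow_ge0. Qed.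

Lemma level_le_dyadic_sum (f : nat -> K) (k l : nat) : (l < k)%nat -> level f l <= dyadic_sum k f.
Proof. intros H; apply rsum_term; [intros; apply level_ge0|easy]. Qed.

Lemma dyadic_sum_ge0 (k : nat) (f : nat -> K) : 0 <= dyadic_sum k f.
Proof. apply rsum_ge0; intros; apply level_ge0. Qed.

Lemma dyadic_sum_term (f : nat -> K) (k i : nat) : (1 <= i < 2 ^ k)%nat ->
  rpow (abs (f i)) p <= dyadic_sum k f.
Proof.
intros H; destruct (valid_level H) as [l [j [Hl [Hj [-> _]]]]].
eapply Rle_trans; [|apply (level_le_dyadic_sum f Hl)].
apply (@rsum_term (fun j => rpow (abs (f (2 ^ l + j)%nat)) p)); [|easy].
intros; apply rpow_ge0.
Qed.

Lemma dyadic_sum_add_le (k : nat) (f g h : nat -> K) :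
  (forall i, (1 <= i < 2 ^ k)%nat -> h i = plus (f i) (g i)) ->
  dyadic_sum k h <= rpow 2 p * (dyadic_sum k f + dyadic_sum k g).
Proof.
intros H; unfold dyadic_sum; rewrite <- rsum_plus, <- rsum_mult; apply rsum_le; intros l Hl.
unfold level; rewrite <- rsum_plus, <- rsum_mult; apply rsum_le; intros i Hi.
rewrite H by (apply level_valid; easy); now apply rpow_add_le.
Qed.

Lemma dyadic_sum_mono (k : nat) (f g : nat -> K) :
  (forall i, (1 <= i < 2 ^ k)%nat -> abs (f i) <= abs (g i)) -> dyadic_sum k f <= dyadic_sum k g.
Proof.
intros H; apply rsum_le; intros l Hl; apply rsum_le; intros i Hi.
apply rpow_le; [lra|]; split; [apply abs_ge_0|apply H, level_valid; easy].
Qed.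

Lemma abs_zero_minus (x : K) : abs (minus zero x) = abs x.
Proof. transitivity (abs (opp x)); [f_equal; kring|apply abs_opp]. Qed.

Lemma abs_minus_self (x : K) : abs (minus x x) = 0.
Proof. transitivity (abs (zero : K)); [f_equal; kring|apply abs_zero]. Qed.

Lemma abs_minus_zero (x : K) : abs (minus x zero) = abs x.
Proof. f_equal; kring. Qed.

Lemma abs_zeroE (x : K) : x = zero -> abs x = 0.
Proof. intros ->; apply abs_zero. Qed.

Lemma lift_level (a : nat -> K) (l : nat) : level (level_lift a) l = rpow (abs (a l)) p.
Proof.
unfold level.
rewrite (@rsum_ext _ (fun _ => / 2 ^ l * rpow (abs (a l)) p)).
- rewrite rsum_const, INR_pow2; field; apply pow_nonzero; lra.
- intros i Hi; unfold level_lift; rewrite log2_level by easy.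
  assert (H := rho_pow_pos l).
  rewrite (abs_multE iota), abs_ofR_ge0 by (apply Rlt_le, Rinv_0_lt_compat; easy).
  rewrite rpowM; [|apply Rlt_le, Rinv_0_lt_compat; easy|apply abs_ge_0].
  f_equal; rewrite <- rpow_rho.
  apply Rmult_eq_reg_r with (rpow (rho ^ l) p); [|rewrite rpow_rho; apply pow_nonzero; lra].
  rewrite <- rpowM; [|apply Rlt_le, Rinv_0_lt_compat; easy|lra].
  rewrite Rinv_l by lra; rewrite Rinv_l by (rewrite rpow_rho; apply pow_nonzero; lra).
  now apply rpow_1.
Qed.

Lemma dyadic_sum_lift (k : nat) (a : nat -> K) :
  dyadic_sum k (level_lift a) = rsum (fun l => rpow (abs (a l)) p) k.
Proof. apply rsum_ext; intros l _; apply lift_level. Qed.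

Lemma half_rho_pow (l : nat) : (rho / 2) ^ l = rho ^ l / 2 ^ l.
Proof. unfold Rdiv; rewrite Rpow_mult_distr, pow_inv; easy. Qed.

Lemma half_rho_pow_pos (l : nat) : 0 < (rho / 2) ^ l.
Proof. apply pow_lt; assert (H := rho_gt1); lra. Qed.

Lemma abs_avg_le (f : nat -> K) (l : nat) :
  abs (level_avg f l) <= rsum (fun i => (rho / 2) ^ l * abs (f (2 ^ l + i)%nat)) (2 ^ l).
Proof.
unfold level_avg; rewrite (abs_multE iota), abs_ofR_ge0 by apply Rlt_le, half_rho_pow_pos.
rewrite rsum_mult; apply Rmult_le_compat_l; [apply Rlt_le, half_rho_pow_pos|].
apply abs_bsum.
Qed.

(** Jensen's inequality says that [level_avg f l] has modulus at most the p-norm of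
    [f] on level [l]. *)
Lemma avg_level (f : nat -> K) (l : nat) : rpow (abs (level_avg f l)) p <= level f l.
Proof.
set (s := rsum (fun i => abs (f (2 ^ l + i)%nat)) (2 ^ l)).
assert (H2 : 0 < 2 ^ l) by (apply pow_lt; lra).
assert (Hs : 0 <= s) by (apply rsum_ge0; intros; apply abs_ge_0).
apply Rle_trans with (rpow (rho ^ l * (s / INR (2 ^ l))) p).
- apply rpow_le; [lra|]; split; [apply abs_ge_0|].
  eapply Rle_trans; [apply abs_avg_le|]; rewrite rsum_mult; fold s.
  rewrite half_rho_pow, INR_pow2; apply Req_le; field; lra.
- assert (Hq : 0 <= s / INR (2 ^ l)) by (rewrite INR_pow2; apply Rdiv_le_0_compat; lra).
  rewrite rpowM; [|apply Rlt_le, rho_pow_pos|easy].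
  rewrite rpow_rho.
  apply Rle_trans with (2 ^ l * (level f l / INR (2 ^ l))).
  + apply Rmult_le_compat_l; [lra|]; unfold s, level.
    apply (@rpow_mean_le p Hp (fun i => abs (f (2 ^ l + i)%nat))); [apply pow2_pos|].
    intros; apply abs_ge_0.
  + rewrite INR_pow2; apply Req_le; field; lra.
Qed.

Lemma dyadic_sum_lift_avg (k : nat) (f : nat -> K) : dyadic_sum k (level_lift (level_avg f)) <= dyadic_sum k f.
Proof. rewrite dyadic_sum_lift; apply rsum_le; intros l _; apply avg_level. Qed.

Lemma avg_abs_bound (k : nat) (f : nat -> K) (l : nat) :
  (l < k)%nat -> abs (level_avg f l) <= 1 + dyadic_sum k f.
Proof.
intros Hl; eapply Rle_trans; [apply (le_1_rpow Hp), abs_ge_0|].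
apply Rplus_le_compat_l; eapply Rle_trans; [apply avg_level|now apply level_le_dyadic_sum].
Qed.

Lemma avg_ext (f g : nat -> K) (l : nat) :
  (forall i, (i < 2 ^ l)%nat -> f (2 ^ l + i)%nat = g (2 ^ l + i)%nat) ->
  level_avg f l = level_avg g l.
Proof. intros H; unfold level_avg; f_equal; now apply bsum_ext. Qed.

Lemma avg_plus (f g : nat -> K) (l : nat) :
  level_avg (fun i => plus (f i) (g i)) l = plus (level_avg f l) (level_avg g l).
Proof. unfold level_avg; rewrite bsum_plus; kring. Qed.

Lemma avg_scal (c : K) (f : nat -> K) (l : nat) :
  level_avg (fun i => mult c (f i)) l = mult c (level_avg f l).
Proof. unfold level_avg; rewrite <- kmult_bsum; kring. Qed.

Lemma avg_minus (f g : nat -> K) (l : nat) :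
  level_avg (fun i => minus (f i) (g i)) l = minus (level_avg f l) (level_avg g l).
Proof.
transitivity (level_avg (fun i => plus (f i) (mult (opp one) (g i))) l).
- apply avg_ext; intros; kring.
- rewrite avg_plus, avg_scal; kring.
Qed.

Lemma avg_zero (f : nat -> K) (l : nat) :
  (forall i, (i < 2 ^ l)%nat -> f (2 ^ l + i)%nat = zero) -> level_avg f l = zero.
Proof. intros H; unfold level_avg; rewrite bsum_zero by easy; kring. Qed.

Lemma avg_lift (a : nat -> K) (l : nat) : level_avg (level_lift a) l = a l.
Proof.
unfold level_avg.
rewrite (@bsum_ext K _ (fun _ => mult (ofR iota (/ rho ^ l)) (a l))).
2:{ intros i Hi; unfold level_lift; now rewrite log2_level. }
assert (E : forall (c : K) n, @bsum K (fun _ => c) n = mult (ofR iota (INR n)) c).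
{ intros c n; induction n as [|n IH].
  - simpl; rewrite ofR_zero; kring.
  - rewrite S_INR, (ofR_plus iota), (ofR_one iota); simpl; rewrite IH; kring. }
rewrite E, INR_pow2.
transitivity (mult (ofR iota ((rho / 2) ^ l * 2 ^ l * / rho ^ l)) (a l)).
- rewrite !(ofR_mult iota); kring.
- rewrite half_rho_pow.
  replace (rho ^ l / 2 ^ l * 2 ^ l * / rho ^ l) with 1.
  + rewrite (ofR_one iota); kring.
  + assert (H := rho_pow_pos l); field; split; [lra|apply pow_nonzero; lra].
Qed.

(** The coordinates of [r] in the summing basis. *)
Definition diff (r : nat -> K) (l : nat) : K :=
  match l with O => r O | S l' => minus (r (S l')) (r l') end.

Lemma bsum_diff (r : nat -> K) (l : nat) : @bsum K (diff r) (S l) = r l.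
Proof.
induction l as [|l IH]; [simpl; kring|].
change (@bsum K (diff r) (S (S l))) with (plus (@bsum K (diff r) (S l)) (diff r (S l))).
rewrite IH; simpl; kring.
Qed.

Lemma abs_diff_le (r : nat -> K) (k l : nat) :
  (forall l, (l < k)%nat -> abs (r l) <= 1) -> (l < k)%nat -> abs (diff r l) <= 2.
Proof.
intros H Hl; destruct l as [|l]; simpl; [specialize (H 0%nat Hl); lra|].
eapply Rle_trans; [apply abs_triangle|].
rewrite abs_opp; assert (H1 := H _ Hl); specialize (H l ltac:(lia)); lra.
Qed.

(** The coefficients, at the indices of the levels, of the element with l_p
    part [h] and l_infty part [r]: on each level the average of [h] is replaced
    by the summing-basis coordinate of [r]. *)
Definition group_coef (h r : nat -> K) (i : nat) : K :=
  plus (minus (h i) (level_lift (level_avg h) i)) (level_lift (diff r) i).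

(** The l_p part of the element with coefficients [f] on the levels and [d] at
    the normalized constant vectors; [group_sums] is its l_infty part.  These maps
    and the pair ([group_coef], [level_avg]) are inverse to each other. *)
Definition group_synth (f d : nat -> K) (i : nat) : K :=
  plus (minus (f i) (level_lift (level_avg f) i)) (level_lift d i).

Definition group_sums (f : nat -> K) (l : nat) : K := @bsum K (level_avg f) (S l).

Lemma avg_coef (h r : nat -> K) (l : nat) : level_avg (group_coef h r) l = diff r l.
Proof. unfold group_coef; rewrite avg_plus, avg_minus, !avg_lift; kring. Qed.

Lemma synth_h_coef (h r : nat -> K) (i : nat) :
  group_synth (group_coef h r) (level_avg h) i = h i.
Proof. unfold group_synth, level_lift; rewrite avg_coef; unfold group_coef, level_lift; kring. Qed.

Lemma synth_r_coef (h r : nat -> K) (l : nat) : group_sums (group_coef h r) l = r l.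
Proof.
unfold group_sums; rewrite (@bsum_ext K _ (diff r)); [apply bsum_diff|].
intros; apply avg_coef.
Qed.

Lemma avg_synth (f d : nat -> K) (l : nat) : level_avg (group_synth f d) l = d l.
Proof. unfold group_synth; rewrite avg_plus, avg_minus, !avg_lift; kring. Qed.

Lemma diff_synth (f : nat -> K) (l : nat) : diff (group_sums f) l = level_avg f l.
Proof. destruct l as [|l]; unfold group_sums; simpl; kring. Qed.

Lemma coef_synth (f d : nat -> K) (i : nat) :
  group_coef (group_synth f d) (group_sums f) i = f i.
Proof.
unfold group_coef, level_lift; rewrite avg_synth, diff_synth; unfold group_synth, level_lift; kring.
Qed.

(** The part of the coefficients that has mean zero on each level. *)
Lemma deviation_bound (k : nat) (h r : nat -> K) :
  dyadic_sum k h <= 1 -> (forall l, (l < k)%nat -> abs (r l) <= 1) ->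
  dyadic_sum k (fun i => minus (h i) (level_lift (level_avg h) i)) <= 2 * rpow 2 p.
Proof.
intros Hh Hr.
eapply Rle_trans.
- apply (@dyadic_sum_add_le k h (fun i => opp (level_lift (level_avg h) i))); intros; easy.
- assert (H : dyadic_sum k (fun i => opp (level_lift (level_avg h) i)) <= dyadic_sum k h).
  { eapply Rle_trans; [|apply dyadic_sum_lift_avg].
    apply dyadic_sum_mono; intros; rewrite abs_opp; lra. }
  assert (H2 := rpow2_ge1 Hp); nra.
Qed.

Lemma abs_coef_le (k : nat) (h r : nat -> K) (i : nat) :
  dyadic_sum k h <= 1 -> (forall l, (l < k)%nat -> abs (r l) <= 1) -> (1 <= i < 2 ^ k)%nat ->
  abs (group_coef h r i) <= 3 + 2 * rpow 2 p.
Proof.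
intros Hh Hr Hi; assert (Hq := deviation_bound Hh Hr).
unfold group_coef; eapply Rle_trans; [apply abs_triangle|].
assert (H1 : abs (minus (h i) (level_lift (level_avg h) i)) <= 1 + 2 * rpow 2 p).
{ eapply Rle_trans; [apply (le_1_rpow Hp), abs_ge_0|]; apply Rplus_le_compat_l.
  eapply Rle_trans; [|exact Hq].
  exact (@dyadic_sum_term (fun i => minus (h i) (level_lift (level_avg h) i)) k i Hi). }
assert (H2 : abs (level_lift (diff r) i) <= 2); [|lra].
destruct (valid_level Hi) as [l [j [Hl [Hj [_ El]]]]].
unfold level_lift; rewrite El, (abs_multE iota).
assert (Hr1 : 1 <= rho ^ l) by (apply pow_R1_Rle; assert (H := rho_gt1); lra).
rewrite abs_ofR_ge0 by (apply Rlt_le, Rinv_0_lt_compat; lra).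
assert (H2 := abs_diff_le Hr Hl); assert (H3 := abs_ge_0 (diff r l)).
assert (/ rho ^ l <= 1) by (rewrite <- Rinv_1; apply Rinv_le_contravar; lra).
assert (0 < / rho ^ l) by (apply Rinv_0_lt_compat; lra).
nra.
Qed.

Definition restr (F : nat -> bool) (f : nat -> K) (i : nat) : K :=
  if F i then f i else zero.

(** The projection onto [F] is compared with the truncation to the levels below
    [L].  That truncation is harmless: the deviations are merely truncated, and
    the averages telescope to a single coordinate of [r].  All the work lies in
    the error [e], whose averages only have to be absolutely summable. *)
Lemma split_projection_bound (k L : nat) (h r : nat -> K) (F : nat -> bool) (C1 C2 : R) :
  dyadic_sum k h <= 1 -> (forall l, (l < k)%nat -> abs (r l) <= 1) -> (L <= k)%nat ->
  let f := group_coef h r in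
  let e := fun i => minus (restr F f i) (restr (fun i => Nat.ltb (Nat.log2 i) L) f i) in
  dyadic_sum k e <= C1 -> rsum (fun l => abs (level_avg e l)) k <= C2 ->
  dyadic_sum k (group_synth (restr F f) (fun _ => zero)) <= 2 * rpow 2 p * rpow 2 p * (C1 + 1)
    * rpow 2 p /\
  forall l, (l < k)%nat -> abs (group_sums (restr F f) l) <= C2 + 1.
Proof.
intros Hh Hr HL f e H1 H2.
set (lam := restr (fun i => Nat.ltb (Nat.log2 i) L) f).
assert (Hlam : forall l, level_avg lam l = if Nat.ltb l L then diff r l else zero).
{ intros l; destruct (Nat.ltb l L) eqn:El.
  - rewrite <- (avg_coef h r); apply avg_ext; intros i Hi.
    unfold lam, restr; rewrite log2_level by easy; now rewrite El.
  - apply avg_zero; intros i Hi.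
    unfold lam, restr; rewrite log2_level by easy; now rewrite El. }
assert (Hav : forall l, level_avg (restr F f) l = plus (level_avg e l) (level_avg lam l)).
{ intros l; rewrite <- avg_plus; apply avg_ext; intros i Hi; unfold e; fold lam; kring. }
assert (HC1 : 0 <= C1) by (eapply Rle_trans; [apply dyadic_sum_ge0|exact H1]).
assert (Hc := rpow2_ge1 Hp).
split.
- set (q := fun i => minus (h i) (level_lift (level_avg h) i)).
  assert (Hq : dyadic_sum k q <= 2 * rpow 2 p) by apply (deviation_bound Hh Hr).
  set (q' := restr (fun i => Nat.ltb (Nat.log2 i) L) q).
  assert (Hq' : dyadic_sum k q' <= 2 * rpow 2 p).
  { eapply Rle_trans; [|exact Hq]; apply dyadic_sum_mono; intros i Hi; unfold q', restr.
    destruct (Nat.ltb (Nat.log2 i) L); [lra|rewrite abs_zero; apply abs_ge_0]. }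
  set (e' := fun i => minus (e i) (level_lift (level_avg e) i)).
  assert (He' : dyadic_sum k e' <= rpow 2 p * (C1 + C1)).
  { eapply Rle_trans.
    - apply (@dyadic_sum_add_le k e (fun i => opp (level_lift (level_avg e) i))); intros; easy.
    - apply Rmult_le_compat_l; [lra|]; apply Rplus_le_compat; [easy|].
      eapply Rle_trans; [|exact H1]; eapply Rle_trans; [|apply dyadic_sum_lift_avg].
      apply dyadic_sum_mono; intros; rewrite abs_opp; lra. }
  eapply Rle_trans.
  { apply (@dyadic_sum_add_le k e' q'); intros i Hi.
    unfold group_synth, level_lift; rewrite Hav, Hlam; unfold e', q', level_lift, e; fold lam.
    unfold lam, restr; destruct (Nat.ltb (Nat.log2 i) L); [|kring].
    unfold q, f, group_coef, level_lift; kring. }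
  apply Rle_trans with (rpow 2 p * (rpow 2 p * (C1 + C1) + 2 * rpow 2 p)).
  { apply Rmult_le_compat_l; lra. }
  set (c := rpow 2 p) in *.
  replace (c * (c * (C1 + C1) + 2 * c)) with (2 * c * c * (C1 + 1)) by ring.
  assert (0 <= 2 * c * c * (C1 + 1)) by (apply Rmult_le_pos; nra).
  nra.
- intros l Hl; unfold group_sums.
  rewrite (@bsum_ext K _ (fun l => plus (level_avg e l) (level_avg lam l)) (S l)) by (intros; apply Hav).
  rewrite bsum_plus; eapply Rle_trans; [apply abs_triangle|].
  apply Rplus_le_compat.
  + eapply Rle_trans; [apply abs_bsum|]; eapply Rle_trans; [|exact H2].
    apply rsum_le_extend; [lia|intros; apply abs_ge_0].
  + destruct (le_lt_dec L l) as [HLl|HLl].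
    * rewrite (@bsum_stop K _ L (S l)); [|lia|].
      2:{ intros i Hi; rewrite Hlam; now rewrite (proj2 (Nat.ltb_ge i L)) by lia. }
      rewrite (@bsum_ext K _ (diff r) L).
      2:{ intros i Hi; rewrite Hlam; now rewrite (proj2 (Nat.ltb_lt i L)) by lia. }
      destruct L as [|L]; [simpl; rewrite abs_zero; lra|].
      rewrite bsum_diff; apply Hr; lia.
    * rewrite (@bsum_ext K _ (diff r) (S l)).
      2:{ intros i Hi; rewrite Hlam; now rewrite (proj2 (Nat.ltb_lt i L)) by lia. }
      rewrite bsum_diff; now apply Hr.
Qed.

Lemma split_threshold (t : R) (k : nat) : 0 <= t ->
  exists L, (L <= k)%nat /\ (forall l, (l < L)%nat -> rho ^ l * t <= 4) /\
    (forall l, (L <= l < k)%nat -> 4 < rho ^ l * t).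
Proof.
intros Ht; induction k as [|k [L [HL [H1 H2]]]].
- exists 0%nat; repeat split; intros; lia.
- destruct (Rle_lt_dec (rho ^ k * t) 4) as [Hk|Hk].
  + exists (S k); split; [easy|split; [|intros; lia]].
    intros l Hl; eapply Rle_trans; [|exact Hk].
    apply Rmult_le_compat_r; [easy|].
    apply Rle_pow; [assert (H := rho_gt1); lra|lia].
  + exists L; split; [lia|split; [easy|]].
    intros l Hl; destruct (Nat.eq_dec l k) as [->|]; [easy|apply H2; lia].
Qed.

Lemma rsum_pow2 (L : nat) : rsum (fun l => 2 ^ l) L = 2 ^ L - 1.
Proof. induction L as [|L IH]; simpl; [|rewrite IH]; ring. Qed.

Lemma rsum_rho (L : nat) : (rho - 1) * rsum (fun l => rho ^ l) L = rho ^ L - 1.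
Proof. induction L as [|L IH]; simpl; [ring|]. rewrite Rmult_plus_distr_l, IH; ring. Qed.

Lemma rsum_indicator (u : nat -> R) (L k : nat) : (L <= k)%nat ->
  rsum (fun l => if Nat.ltb l L then u l else 0) k = rsum u L.
Proof.
intros H; replace k with (L + (k - L))%nat by lia; rewrite rsum_add.
rewrite (@rsum_ext _ (fun _ => 0) (k - L)), rsum_const.
- rewrite Rmult_0_r, Rplus_0_r; apply rsum_ext; intros i Hi.
  now rewrite (proj2 (Nat.ltb_lt i L)).
- intros i Hi; now rewrite (proj2 (Nat.ltb_ge (L + i) L)) by lia.
Qed.

(** The summand [rpow 2 p * (2 * rpow 2 p)] comes from the high levels, where
    the error is at most twice the deviation, and [2 * rpow 4 p] from the low
    levels, a geometric sum with last term at most [rpow 4 p]. *)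
Definition greedy_const : R := rpow 2 p * (2 * rpow 2 p) + 2 * rpow 4 p.
(** High levels contribute at most twice the p-th power of the norm of the
    deviation, low levels the geometric sum of the [rho ^ l * t], whose terms
    are at most 4. *)
Definition greedy_avg_const : R := 4 * rpow 2 p + 4 * rho / (rho - 1).

(** Level [l] is low when [rho ^ l * t <= 4].  On low levels the error consists
    of rejected coefficients, of modulus at most [t].  On high levels the
    constant part has modulus at most [2 / rho ^ l < t / 2], so a selected
    coefficient is at most twice the deviation [q i]; moreover
    [rho ^ l * |q i| >= 1], and raising this to the power [p] shows that the
    contribution of [i] to the average is at most [|q i| ^ p]. *)
Lemma greedy_split (k : nat) (h r : nat -> K) (F : nat -> bool) (t : R) :
  dyadic_sum k h <= 1 -> (forall l, (l < k)%nat -> abs (r l) <= 1) -> 0 <= t ->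
  let f := group_coef h r in
  (forall i, (1 <= i < 2 ^ k)%nat -> F i = false -> abs (f i) <= t) ->
  (forall i, (1 <= i < 2 ^ k)%nat -> F i = true -> t <= abs (f i)) ->
  exists L, (L <= k)%nat /\
  let e := fun i => minus (restr F f i) (restr (fun i => Nat.ltb (Nat.log2 i) L) f i) in
  dyadic_sum k e <= greedy_const /\ rsum (fun l => abs (level_avg e l)) k <= greedy_avg_const.
Proof.
intros Hh Hr Ht f HF0 HF1.
destruct (split_threshold k Ht) as [L [HL [Hlow Hhigh]]].
exists L; split; [easy|]; intros e.
set (q := fun i => minus (h i) (level_lift (level_avg h) i)).
assert (Hq : dyadic_sum k q <= 2 * rpow 2 p) by apply (deviation_bound Hh Hr).
assert (Hc := rpow2_ge1 Hp).
assert (Hrho := rho_gt1).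
assert (Elow : forall l i, (l < L)%nat -> (i < 2 ^ l)%nat -> abs (e (2 ^ l + i)%nat) <= t).
{ intros l i Hl Hi; unfold e, restr; rewrite log2_level by easy.
  rewrite (proj2 (Nat.ltb_lt l L)) by easy.
  destruct (F (2 ^ l + i)%nat) eqn:E.
  - rewrite abs_minus_self; easy.
  - rewrite abs_zero_minus; apply HF0; [|easy].
    apply level_valid; [lia|easy]. }
assert (Ehigh : forall l i, (L <= l < k)%nat -> (i < 2 ^ l)%nat ->
  abs (e (2 ^ l + i)%nat) <= 2 * abs (q (2 ^ l + i)%nat) /\
  (rho / 2) ^ l * abs (e (2 ^ l + i)%nat) <= 2 * rpow (abs (q (2 ^ l + i)%nat)) p).
{ intros l i Hl Hi; set (j := (2 ^ l + i)%nat).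
  assert (Hj : (1 <= j < 2 ^ k)%nat) by (apply level_valid; [lia|easy]).
  assert (Hqj := abs_ge_0 (q j)); assert (Hpj := rpow_ge0 (abs (q j)) p).
  assert (Ej : Nat.log2 j = l) by now apply log2_level.
  unfold e, restr; rewrite Ej.
  rewrite (proj2 (Nat.ltb_ge l L)) by lia.
  destruct (F j) eqn:E.
  2:{ rewrite abs_minus_self, Rmult_0_r; lra. }
  rewrite abs_minus_zero.
  assert (Htf := HF1 j Hj E).
  assert (Hl4 := Hhigh l Hl); assert (Hrl := rho_pow_pos l).
  assert (Hd : rho ^ l * abs (level_lift (diff r) j) <= 2).
  { unfold level_lift; rewrite Ej.
    rewrite (abs_multE iota), abs_ofR_ge0 by (apply Rlt_le, Rinv_0_lt_compat; easy).
    rewrite <- Rmult_assoc, Rinv_r by lra; rewrite Rmult_1_l.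
    apply (abs_diff_le Hr); lia. }
  assert (Hfq : abs (f j) <= abs (q j) + abs (level_lift (diff r) j)) by apply abs_triangle.
  assert (Hd2 : abs (level_lift (diff r) j) <= t / 2).
  { apply Rmult_le_reg_l with (rho ^ l); [easy|]; nra. }
  assert (Hf2 : abs (f j) <= 2 * abs (q j)) by lra.
  split; [easy|].
  assert (Hq1 : 1 <= rho ^ l * abs (q j)) by nra.
  assert (Hq2 := rpow_ge_self Hp Hq1).
  rewrite rpowM, rpow_rho in Hq2 by lra.
  rewrite half_rho_pow.
  assert (H2l : 0 < 2 ^ l) by (apply pow_lt; lra).
  apply Rmult_le_reg_l with (2 ^ l); [easy|].
  replace (2 ^ l * (rho ^ l / 2 ^ l * abs (f j))) with (rho ^ l * abs (f j)) by (field; lra).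
  apply Rle_trans with (rho ^ l * (2 * abs (q j))); [|lra].
  apply Rmult_le_compat_l; lra. }
split.
- apply Rle_trans with
    (rsum (fun l => rpow 2 p * level q l
                    + (if Nat.ltb l L then 2 ^ l * rpow t p else 0)) k).
  { apply rsum_le; intros l Hl; assert (Hlq := level_ge0 q l).
    destruct (Nat.ltb l L) eqn:El.
    - apply Nat.ltb_lt in El.
      apply Rle_trans with (rsum (fun _ => rpow t p) (2 ^ l)).
      + apply rsum_le; intros i Hi; apply rpow_le; [lra|].
        split; [apply abs_ge_0|now apply Elow].
      + rewrite rsum_const, INR_pow2; nra.
    - apply Nat.ltb_ge in El; rewrite Rplus_0_r.
      unfold level; rewrite <- rsum_mult; apply rsum_le; intros i Hi.
      rewrite <- rpowM; [|lra|apply abs_ge_0].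
      apply rpow_le; [lra|]; split; [apply abs_ge_0|].
      apply Ehigh; [lia|easy]. }
  rewrite rsum_plus, rsum_mult, rsum_indicator by easy.
  fold (dyadic_sum k q); unfold greedy_const; apply Rplus_le_compat.
  { apply Rmult_le_compat_l; lra. }
  rewrite (@rsum_ext _ (fun l => rpow t p * 2 ^ l)) by (intros; ring).
  rewrite rsum_mult, rsum_pow2.
  assert (Ht0 := rpow_ge0 t p); assert (H4 := rpow_ge0 4 p).
  destruct L as [|L]; [simpl; lra|].
  assert (HLt : rpow (rho ^ L * t) p <= rpow 4 p).
  { apply rpow_le; [lra|]; split.
    - assert (H := rho_pow_pos L); nra.
    - apply Hlow; lia. }
  rewrite rpowM, rpow_rho in HLt; [|apply Rlt_le, rho_pow_pos|easy].
  simpl; nra.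
- apply Rle_trans with
    (rsum (fun l => 2 * level q l + (if Nat.ltb l L then t * rho ^ l else 0)) k).
  { apply rsum_le; intros l Hl; assert (Hlq := level_ge0 q l).
    eapply Rle_trans; [apply abs_avg_le|].
    destruct (Nat.ltb l L) eqn:El.
    - apply Nat.ltb_lt in El.
      apply Rle_trans with (rsum (fun _ => (rho / 2) ^ l * t) (2 ^ l)).
      + apply rsum_le; intros i Hi.
        apply Rmult_le_compat_l; [apply Rlt_le, half_rho_pow_pos|now apply Elow].
      + rewrite rsum_const, INR_pow2, half_rho_pow.
        assert (H2l : 0 < 2 ^ l) by (apply pow_lt; lra).
        replace (2 ^ l * (rho ^ l / 2 ^ l * t)) with (t * rho ^ l) by (field; lra).
        lra.
    - apply Nat.ltb_ge in El; rewrite Rplus_0_r.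
      unfold level; rewrite <- rsum_mult; apply rsum_le; intros i Hi.
      apply Ehigh; [lia|easy]. }
  rewrite rsum_plus, rsum_mult, rsum_indicator by easy.
  fold (dyadic_sum k q); unfold greedy_avg_const; apply Rplus_le_compat; [lra|].
  rewrite (rsum_mult t (fun l => rho ^ l)).
  apply Rmult_le_reg_l with (rho - 1); [lra|].
  replace ((rho - 1) * (t * rsum (fun l => rho ^ l) L))
    with (t * ((rho - 1) * rsum (fun l => rho ^ l) L)) by ring.
  rewrite rsum_rho.
  replace ((rho - 1) * (4 * rho / (rho - 1))) with (4 * rho) by (field; lra).
  destruct L as [|L]; [simpl; lra|].
  specialize (Hlow L ltac:(lia)); simpl; nra.
Qed.

(** Here the error lives on the single level that the initial segment cuts. *)
Lemma prefix_split (k : nat) (h r : nat -> K) (F : nat -> bool) (I : nat) :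
  dyadic_sum k h <= 1 -> (forall l, (l < k)%nat -> abs (r l) <= 1) ->
  (1 <= I <= 2 ^ k)%nat ->
  let f := group_coef h r in
  (forall i, (1 <= i < 2 ^ k)%nat -> F i = Nat.ltb i I) ->
  exists L, (L <= k)%nat /\
  let e := fun i => minus (restr F f i) (restr (fun i => Nat.ltb (Nat.log2 i) L) f i) in
  dyadic_sum k e <= rpow 2 p * (2 * rpow 2 p + rpow 2 p) /\
  rsum (fun l => abs (level_avg e l)) k <= 1 + rpow 2 p * (2 * rpow 2 p + rpow 2 p).
Proof.
intros Hh Hr HI f HF.
exists (Nat.log2 I).
assert (HL : (Nat.log2 I <= k)%nat).
{ rewrite <- (Nat.log2_pow2 k) by lia; apply Nat.log2_le_mono; lia. }
split; [easy|]; set (L := Nat.log2 I) in *; intros e.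
set (q := fun i => minus (h i) (level_lift (level_avg h) i)).
assert (Hq : dyadic_sum k q <= 2 * rpow 2 p) by apply (deviation_bound Hh Hr).
assert (Hc := rpow2_ge1 Hp).
destruct (Nat.log2_spec I) as [HI1 HI2]; [lia|]; fold L in HI1, HI2.
assert (E0 : forall l i, (l < k)%nat -> (i < 2 ^ l)%nat -> l <> L ->
             e (2 ^ l + i)%nat = zero).
{ intros l i Hl Hi Hne; unfold e, restr.
  rewrite HF by (apply level_valid; easy); rewrite log2_level by easy.
  destruct (Nat.ltb l L) eqn:El.
  - apply Nat.ltb_lt in El.
    assert (2 ^ S l <= 2 ^ L)%nat by (apply Nat.pow_le_mono_r; lia).
    simpl in H; rewrite (proj2 (Nat.ltb_lt _ _)) by lia; kring.
  - apply Nat.ltb_ge in El.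
    assert (2 ^ S L <= 2 ^ l)%nat by (apply Nat.pow_le_mono_r; lia).
    rewrite (proj2 (Nat.ltb_ge _ _)) by lia; kring. }
assert (E1 : (L < k)%nat -> level e L <= rpow 2 p * (2 * rpow 2 p + rpow 2 p)).
{ intros Hlt.
  apply Rle_trans with (rpow 2 p * (level q L + level (level_lift (diff r)) L)).
  - unfold level; rewrite <- rsum_plus, <- rsum_mult; apply rsum_le; intros i Hi.
    eapply Rle_trans; [|now apply rpow_add_le].
    apply rpow_le; [lra|]; split; [apply abs_ge_0|].
    unfold e, restr; rewrite log2_level by easy; rewrite Nat.ltb_irrefl.
    destruct (F (2 ^ L + i)%nat).
    + apply Req_le; f_equal.
      transitivity (f (2 ^ L + i)%nat); [kring|easy].
    + rewrite abs_minus_self; apply abs_ge_0.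
  - apply Rmult_le_compat_l; [lra|]; apply Rplus_le_compat.
    + eapply Rle_trans; [apply (level_le_dyadic_sum q Hlt)|easy].
    + rewrite lift_level; apply rpow_le; [lra|].
      split; [apply abs_ge_0|now apply (abs_diff_le Hr)]. }
assert (Hsum : forall (u : nat -> R) M, 0 <= M ->
  (forall l, (l < k)%nat -> l <> L -> u l = 0) -> ((L < k)%nat -> u L <= M) ->
  rsum u k <= M).
{ intros u M HM Hu0 HuL; clear - HM Hu0 HuL.
  destruct (le_lt_dec k L) as [H|H].
  - rewrite (@rsum_ext _ (fun _ => 0)), rsum_const; [lra|].
    intros i Hi; apply Hu0; lia.
  - replace k with (L + (1 + (k - S L)))%nat by lia; rewrite !rsum_add; simpl.
    rewrite (@rsum_ext _ (fun _ => 0) L), rsum_const by (intros i Hi; apply Hu0; lia).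
    rewrite (@rsum_ext _ (fun _ => 0) (k - S L)), rsum_const
      by (intros i Hi; apply Hu0; lia).
    rewrite Nat.add_0_r; specialize (HuL H); lra. }
assert (HM : 0 <= rpow 2 p * (2 * rpow 2 p + rpow 2 p)) by nra.
split.
- apply Hsum; [easy| |easy].
  intros l Hl Hne; unfold level; rewrite (@rsum_ext _ (fun _ => 0)), rsum_const; [ring|].
  intros i Hi; rewrite abs_zeroE; [apply rpow0|now apply E0].
- apply Hsum; [lra| |].
  + intros l Hl Hne; apply abs_zeroE, avg_zero.
    intros i Hi; now apply E0.
  + intros Hlt; eapply Rle_trans; [apply (le_1_rpow Hp), abs_ge_0|].
    apply Rplus_le_compat_l; eapply Rle_trans; [apply avg_level|now apply E1].
Qed.

(** The two kinds of sets whose projections are bounded: initial segments and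
    greedy sets with threshold [t]. *)
Definition admissible (k : nat) (F : nat -> bool) (f : nat -> K) : Prop :=
  (exists I, (1 <= I <= 2 ^ k)%nat /\
     forall i, (1 <= i < 2 ^ k)%nat -> F i = Nat.ltb i I) \/
  (exists t, 0 <= t /\
     (forall i, (1 <= i < 2 ^ k)%nat -> F i = false -> abs (f i) <= t) /\
     (forall i, (1 <= i < 2 ^ k)%nat -> F i = true -> t <= abs (f i))).

Theorem group_projection_bound :
  exists C, 1 <= C /\ forall (k : nat) (h r : nat -> K) (F : nat -> bool),
    dyadic_sum k h <= 1 -> (forall l, (l < k)%nat -> abs (r l) <= 1) ->
    admissible k F (group_coef h r) ->
    dyadic_sum k (group_synth (restr F (group_coef h r)) (fun _ => zero)) <= C /\
    forall l, (l < k)%nat -> abs (group_sums (restr F (group_coef h r)) l) <= C.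
Proof.
assert (Hc := rpow2_ge1 Hp); assert (H4 := rpow_ge0 4 p); assert (Hrho := rho_gt1).
set (c := rpow 2 p) in *.
set (C1 := greedy_const + c * (2 * c + c)).
set (C2 := greedy_avg_const + (1 + c * (2 * c + c))).
assert (Hg1 : 0 <= greedy_const) by (unfold greedy_const; fold c; nra).
assert (Hg2 : 0 <= greedy_avg_const).
{ unfold greedy_avg_const; fold c.
  assert (0 <= 4 * rho / (rho - 1)) by (apply Rdiv_le_0_compat; lra); lra. }
assert (HC1 : 0 <= C1) by (unfold C1; nra).
assert (HC2 : 0 <= C2) by (unfold C2; nra).
assert (HT : 0 <= 2 * c * c * (C1 + 1) * c).
{ repeat apply Rmult_le_pos; lra. }
(* [C1] and [C2] bound the error for both kinds of admissible sets. *)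
exists (2 * c * c * (C1 + 1) * c + (C2 + 1)); split; [lra|].
intros k h r F Hh Hr Hadm.
assert (HL : exists L, (L <= k)%nat /\
  let e := fun i => minus (restr F (group_coef h r) i)
             (restr (fun i => Nat.ltb (Nat.log2 i) L) (group_coef h r) i) in
  dyadic_sum k e <= C1 /\ rsum (fun l => abs (level_avg e l)) k <= C2).
{ destruct Hadm as [[I [HI HF]]|[t [Ht [HF0 HF1]]]].
  - destruct (prefix_split Hh Hr HI HF) as [L [HL [A1 A2]]].
    exists L; split; [easy|]; fold c in A1, A2; unfold C1, C2; split.
    + eapply Rle_trans; [exact A1|lra].
    + eapply Rle_trans; [exact A2|lra].
  - destruct (greedy_split Hh Hr Ht HF0 HF1) as [L [HL [A1 A2]]].
    exists L; split; [easy|]; unfold C1, C2; split.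
    + eapply Rle_trans; [exact A1|]; assert (0 <= c * (2 * c + c)) by nra; lra.
    + eapply Rle_trans; [exact A2|]; assert (0 <= c * (2 * c + c)) by nra; lra. }
destruct HL as [L [HL [A1 A2]]].
destruct (split_projection_bound Hh Hr HL A1 A2) as [B1 B2]; fold c in B1.
split; [lra|]; intros l Hl; specialize (B2 l Hl); lra.
Qed.

End Group.

(** * Roles of the coordinates of the mixed-norm space *)

Section Layout.

(** Block [n] has coordinates [1, ..., n + 1].  Cluster [k] consists of the
    blocks from [2 ^ k - 2] to [2 ^ (k + 1) - 3] and contains everything that
    the [k]-th group uses: the levels fill the first block, of length
    [2 ^ k - 1], and the last coordinates of the following odd blocks serve as
    the l_infty part.  The lower halves of the odd blocks hold the copy of the
    whole space.  Since clusters are intervals of blocks, the change of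
    coordinates acts on each of them separately. *)
Definition cluster (n : nat) : nat := Nat.log2 (n + 2).
Definition gblock (k : nat) : nat := (2 ^ k - 2)%nat.
Definition rblock (k l : nat) : nat := (gblock k + (2 * l + 1))%nat.
Definition rindex (n : nat) : nat := Nat.div2 (n - gblock (cluster n)).
Definition valid (n i : nat) : bool := andb (Nat.leb 1 i) (Nat.leb i (S n)).
Definition is_gblock (n : nat) : bool := Nat.eqb n (gblock (cluster n)).
Definition is_rcoord (n i : nat) : bool :=
  andb (Nat.odd n) (andb (Nat.eqb i (S n)) (Nat.ltb (rindex n) (cluster n))).
Definition is_copy (n i : nat) : bool := andb (Nat.odd n) (Nat.leb i (Nat.div2 (S n))).

Lemma valid_iff (n i : nat) : valid n i = true <-> (1 <= i <= S n)%nat.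
Proof. unfold valid; rewrite Bool.andb_true_iff, !Nat.leb_le; easy. Qed.

Lemma cluster_pos (n : nat) : (1 <= cluster n)%nat.
Proof.
unfold cluster; apply (Nat.log2_le_mono 2); lia.
Qed.

Lemma pow2_ge2 (k : nat) : (1 <= k)%nat -> (2 <= 2 ^ k)%nat.
Proof. intros H; destruct k; [lia|]; assert (H1 := pow2_pos k); simpl; lia. Qed.

Lemma cluster_bounds (n : nat) :
  (gblock (cluster n) <= n)%nat /\ (n + 2 < 2 * 2 ^ cluster n)%nat.
Proof.
unfold gblock, cluster; destruct (Nat.log2_spec (n + 2)) as [H1 H2]; [lia|].
rewrite Nat.pow_succ_r' in H2; lia.
Qed.

Lemma S_gblock (k : nat) : (1 <= k)%nat -> S (gblock k) = (2 ^ k - 1)%nat.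
Proof. intros H; assert (H1 := pow2_ge2 H); unfold gblock; lia. Qed.

Lemma valid_gblock (k i : nat) : (1 <= k)%nat ->
  valid (gblock k) i = true <-> (1 <= i < 2 ^ k)%nat.
Proof.
intros H; assert (H1 := pow2_ge2 H); rewrite valid_iff, S_gblock by easy; lia.
Qed.

Lemma cluster_gblock (k : nat) : (1 <= k)%nat -> cluster (gblock k) = k.
Proof.
intros H; assert (H1 := pow2_ge2 H); unfold cluster, gblock.
replace (2 ^ k - 2 + 2)%nat with (2 ^ k)%nat by lia; apply Nat.log2_pow2; lia.
Qed.

Lemma two_k_le (k : nat) : (1 <= k)%nat -> (2 * k <= 2 ^ k)%nat.
Proof.
intros H; induction k as [|[|k] IH]; [lia|simpl; lia|].
specialize (IH ltac:(lia)); rewrite Nat.pow_succ_r'.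
assert (2 <= 2 ^ S k)%nat by (apply pow2_ge2; lia); lia.
Qed.

Lemma cluster_rblock (k l : nat) : (l < k)%nat -> cluster (rblock k l) = k.
Proof.
intros H; assert (H1 := @pow2_ge2 k ltac:(lia)); assert (H2 := @two_k_le k ltac:(lia)).
unfold cluster, rblock, gblock; apply Nat.log2_unique; [lia|simpl; lia].
Qed.

Lemma even_pow2 (k : nat) : (1 <= k)%nat -> exists m, (2 ^ k = 2 * m)%nat /\ (1 <= m)%nat.
Proof.
intros H; destruct k as [|k]; [lia|]; exists (2 ^ k)%nat.
split; [simpl; lia|apply pow2_pos].
Qed.

Lemma odd_2m1 (m : nat) : Nat.odd (2 * m + 1) = true.
Proof. apply Nat.odd_spec; exists m; lia. Qed.

Lemma odd_2m (m : nat) : Nat.odd (2 * m) = false.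
Proof. rewrite Nat.odd_mul; easy. Qed.

Lemma odd_gblock (k : nat) : (1 <= k)%nat -> Nat.odd (gblock k) = false.
Proof.
intros H; destruct (even_pow2 H) as [m [Hm Hm1]]; unfold gblock; rewrite Hm.
replace (2 * m - 2)%nat with (2 * (m - 1))%nat by lia; apply odd_2m.
Qed.

Lemma odd_rblock (k l : nat) : (1 <= k)%nat -> Nat.odd (rblock k l) = true.
Proof.
intros H; destruct (even_pow2 H) as [m [Hm Hm1]]; unfold rblock, gblock; rewrite Hm.
replace (2 * m - 2 + (2 * l + 1))%nat with (2 * (m - 1 + l) + 1)%nat by lia.
apply odd_2m1.
Qed.

Lemma is_gblock_gblock (k : nat) : (1 <= k)%nat -> is_gblock (gblock k) = true.
Proof. intros H; unfold is_gblock; rewrite cluster_gblock by easy; apply Nat.eqb_refl. Qed.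

Lemma is_gblock_rblock (k l : nat) : (l < k)%nat -> is_gblock (rblock k l) = false.
Proof.
intros H; unfold is_gblock; rewrite cluster_rblock by easy.
apply Nat.eqb_neq; unfold rblock; lia.
Qed.

Lemma rindex_rblock (k l : nat) : (l < k)%nat -> rindex (rblock k l) = l.
Proof.
intros H; unfold rindex; rewrite cluster_rblock by easy.
unfold rblock; replace (gblock k + (2 * l + 1) - gblock k)%nat with (S (2 * l)) by lia.
apply Nat.div2_succ_double.
Qed.

Lemma is_rcoord_rblock (k l : nat) : (l < k)%nat ->
  is_rcoord (rblock k l) (S (rblock k l)) = true.
Proof.
intros H; unfold is_rcoord.
rewrite odd_rblock, Nat.eqb_refl, rindex_rblock, cluster_rblock by lia; simpl.
now apply Nat.ltb_lt.
Qed.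

Lemma is_rcoord_inv (n i : nat) : is_rcoord n i = true ->
  exists l, (l < cluster n)%nat /\ n = rblock (cluster n) l /\ i = S n /\ rindex n = l.
Proof.
unfold is_rcoord; rewrite !Bool.andb_true_iff, Nat.eqb_eq, Nat.ltb_lt.
intros [H1 [H2 H3]]; exists (rindex n); repeat split; try easy.
destruct (cluster_bounds n) as [H4 _].
apply Nat.odd_spec in H1; destruct H1 as [m Hm].
destruct (even_pow2 (cluster_pos n)) as [q [Hq Hq1]].
unfold rblock, rindex, gblock in *; rewrite Hq in *.
replace (n - (2 * q - 2))%nat with (S (2 * (m - (q - 1)))) by lia.
rewrite Nat.div2_succ_double; lia.
Qed.

Lemma is_rcoord_not_gblock (n i : nat) : is_rcoord n i = true -> is_gblock n = false.
Proof.
intros H; destruct (is_rcoord_inv H) as [l [Hl [-> _]]]; now apply is_gblock_rblock.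
Qed.

Lemma is_copy_not_gblock (n i : nat) : is_copy n i = true -> is_gblock n = false.
Proof.
unfold is_copy, is_gblock; rewrite Bool.andb_true_iff; intros [H _].
apply Nat.eqb_neq; intros E; rewrite E, odd_gblock in H; [easy|apply cluster_pos].
Qed.

Lemma is_copy_inv (n i : nat) : is_copy n i = true ->
  exists m, n = (2 * m + 1)%nat /\ (i <= S m)%nat.
Proof.
unfold is_copy; rewrite Bool.andb_true_iff, Nat.leb_le; intros [H1 H2].
apply Nat.odd_spec in H1; destruct H1 as [m Hm]; exists m; split; [easy|].
rewrite Hm in H2; replace (S (2 * m + 1)) with (2 * S m)%nat in H2 by lia.
rewrite Nat.div2_double in H2; easy.
Qed.

Lemma is_copy_true (m i : nat) : (i <= S m)%nat -> is_copy (2 * m + 1) i = true.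
Proof.
intros H; unfold is_copy; rewrite odd_2m1, Bool.andb_true_l; apply Nat.leb_le.
replace (S (2 * m + 1)) with (2 * S m)%nat by lia; now rewrite Nat.div2_double.
Qed.

Lemma is_copy_not_rcoord (n i : nat) : is_copy n i = true -> is_rcoord n i = false.
Proof.
intros H; destruct (is_copy_inv H) as [m [Hm Hi]].
destruct (is_rcoord n i) eqn:E; [|easy].
destruct (is_rcoord_inv E) as [l [_ [_ [E1 _]]]]; lia.
Qed.

(** Positions in the lexicographic order of the pairs (block, coordinate); along
    a block they are consecutive. *)
Definition code (n i : nat) : nat := Cantor.to_nat ((n - pred i)%nat, pred i).
Definition dec (j : nat) : nat * nat :=
  let (x, y) := Cantor.of_nat j in ((x + y)%nat, S y).

Lemma code_dec (j : nat) : code (fst (dec j)) (snd (dec j)) = j.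
Proof.
unfold code, dec; assert (H := Cantor.cancel_to_of j).
destruct (Cantor.of_nat j) as [x y]; simpl.
now replace (x + y - y)%nat with x by lia.
Qed.

Lemma dec_code (n i : nat) : valid n i = true -> dec (code n i) = (n, i).
Proof.
rewrite valid_iff; intros H; unfold code, dec; rewrite Cantor.cancel_of_to.
f_equal; lia.
Qed.

Lemma valid_dec (j : nat) : valid (fst (dec j)) (snd (dec j)) = true.
Proof.
rewrite valid_iff; unfold dec; destruct (Cantor.of_nat j) as [x y]; simpl; lia.
Qed.

Lemma code_spec (n i : nat) : valid n i = true ->
  (2 * code n i + 2 = 2 * i + n * S n)%nat.
Proof.
rewrite valid_iff; intros H; unfold code.
assert (E := Cantor.to_nat_spec (n - pred i) (pred i)).
replace (pred i + (n - pred i))%nat with n in E by lia; lia.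
Qed.

Lemma code_le (n i N : nat) : valid n i = true -> (n <= N)%nat ->
  (code n i < (N + 1) * (N + 1))%nat.
Proof.
intros H HN; assert (E := code_spec H); rewrite valid_iff in H; nia.
Qed.

End Layout.

(** * Change of coordinates on arrays *)

Section Arrays.

Variable K : AbsRing.
Variable iota : real_subfield K.
Add Ring K_ring : (scalar_ring_theory iota).
Ltac kring := kring_norm K; ring.
Variable p : R.
Hypothesis Hp : 1 <= p.

Notation avg := (level_avg iota p).
Notation lift := (level_lift iota p).
Notation coef := (group_coef iota p).
Notation synth_h := (group_synth iota p).
Notation synth_r := (group_sums iota p).

Definition rvals (v : nat -> nat -> K) (k l : nat) : K := v (rblock k l) (S (rblock k l)).

(** From coefficients to coordinates; [array_coef] is the inverse map.  Both
    disregard the positions of the copy. *)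
Definition array_synth (a : nat -> nat -> K) (n i : nat) : K :=
  if is_gblock n then synth_h (a n) (rvals a (cluster n)) i
  else if is_rcoord n i then synth_r (a (gblock (cluster n))) (rindex n)
  else if is_copy n i then zero else a n i.

Definition array_coef (v : nat -> nat -> K) (n i : nat) : K :=
  if valid n i then
    if is_gblock n then coef (v n) (rvals v (cluster n)) i
    else if is_rcoord n i then avg (v (gblock (cluster n))) (rindex n)
    else if is_copy n i then zero else v n i
  else zero.

Lemma lift_ext (a b : nat -> K) (k i : nat) : (1 <= i < 2 ^ k)%nat ->
  (forall l, (l < k)%nat -> a l = b l) -> lift a i = lift b i.
Proof.
intros Hi H; unfold level_lift; f_equal; apply H; apply Nat.log2_lt_pow2; lia.
Qed.

Lemma avg_ext_valid (f g : nat -> K) (k l : nat) : (l < k)%nat ->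
  (forall i, (1 <= i < 2 ^ k)%nat -> f i = g i) -> avg f l = avg g l.
Proof. intros Hl H; apply avg_ext; intros i Hi; apply H, level_valid; easy. Qed.

Lemma synth_h_ext (f g d d' : nat -> K) (k i : nat) : (1 <= i < 2 ^ k)%nat ->
  (forall i, (1 <= i < 2 ^ k)%nat -> f i = g i) ->
  (forall l, (l < k)%nat -> d l = d' l) -> synth_h f d i = synth_h g d' i.
Proof.
intros Hi Hf Hd; unfold group_synth; f_equal; [f_equal; [now apply Hf|]|].
- apply (@lift_ext _ _ k); [easy|]; intros l Hl; now apply (@avg_ext_valid _ _ k).
- now apply (@lift_ext _ _ k).
Qed.

Lemma synth_r_ext (f g : nat -> K) (k l : nat) : (l < k)%nat ->
  (forall i, (1 <= i < 2 ^ k)%nat -> f i = g i) -> synth_r f l = synth_r g l.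
Proof.
intros Hl H; unfold group_sums; apply bsum_ext; intros i Hi.
apply (@avg_ext_valid _ _ k); [lia|easy].
Qed.

Lemma coef_ext (h h' r r' : nat -> K) (k i : nat) : (1 <= i < 2 ^ k)%nat ->
  (forall i, (1 <= i < 2 ^ k)%nat -> h i = h' i) ->
  (forall l, (l < k)%nat -> r l = r' l) -> coef h r i = coef h' r' i.
Proof.
intros Hi Hh Hr; unfold group_coef; f_equal; [f_equal; [now apply Hh|]|].
- apply (@lift_ext _ _ k); [easy|]; intros l Hl; now apply (@avg_ext_valid _ _ k).
- apply (@lift_ext _ _ k); [easy|]; intros [|l] Hl; simpl; [now apply Hr|].
  f_equal; apply Hr; lia.
Qed.

Lemma is_gblock_eq (n : nat) : is_gblock n = true -> n = gblock (cluster n).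
Proof. apply Nat.eqb_eq. Qed.

Lemma synth_gblock (a : nat -> nat -> K) (k i : nat) : (1 <= k)%nat ->
  array_synth a (gblock k) i = synth_h (a (gblock k)) (rvals a k) i.
Proof.
intros H; unfold array_synth; now rewrite is_gblock_gblock, cluster_gblock.
Qed.

Lemma synth_rblock (a : nat -> nat -> K) (k l : nat) : (l < k)%nat ->
  rvals (array_synth a) k l = synth_r (a (gblock k)) l.
Proof.
intros H; unfold rvals, array_synth.
now rewrite is_gblock_rblock, is_rcoord_rblock, cluster_rblock, rindex_rblock.
Qed.

Lemma valid_last (n : nat) : valid n (S n) = true.
Proof. apply valid_iff; lia. Qed.

Lemma ana_gblock (v : nat -> nat -> K) (k i : nat) : (1 <= k)%nat ->
  (1 <= i < 2 ^ k)%nat -> array_coef v (gblock k) i = coef (v (gblock k)) (rvals v k) i.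
Proof.
intros H Hi; unfold array_coef.
now rewrite (proj2 (valid_gblock i H) Hi), is_gblock_gblock, cluster_gblock.
Qed.

Lemma ana_rblock (v : nat -> nat -> K) (k l : nat) : (l < k)%nat ->
  rvals (array_coef v) k l = avg (v (gblock k)) l.
Proof.
intros H; unfold rvals, array_coef.
now rewrite valid_last, is_gblock_rblock, is_rcoord_rblock, cluster_rblock, rindex_rblock.
Qed.

Lemma valid_is_gblock (n i : nat) : valid n i = true -> is_gblock n = true ->
  (1 <= i < 2 ^ cluster n)%nat.
Proof.
intros Hv Hg; apply is_gblock_eq in Hg; rewrite Hg in Hv.
now apply (valid_gblock i (cluster_pos n)).
Qed.

Lemma ana_synth (a : nat -> nat -> K) (n i : nat) : valid n i = true ->
  array_coef (array_synth a) n i = if is_copy n i then zero else a n i.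
Proof.
intros Hv.
assert (Hc := cluster_pos n).
destruct (is_gblock n) eqn:Hg.
- assert (Hi := valid_is_gblock Hv Hg); apply is_gblock_eq in Hg.
  set (k := cluster n) in *.
  destruct (is_copy n i) eqn:Ec.
  { apply is_copy_not_gblock in Ec; rewrite Hg, is_gblock_gblock in Ec; easy. }
  rewrite Hg, ana_gblock by easy.
  rewrite <- (coef_synth iota Hp (a (gblock k)) (rvals a k)).
  apply (@coef_ext _ _ _ _ k); [easy| |].
  + intros j _; now apply synth_gblock.
  + intros l Hl; now apply synth_rblock.
- unfold array_coef; rewrite Hv, Hg.
  destruct (is_rcoord n i) eqn:Er.
  + destruct (is_rcoord_inv Er) as [l [Hl [En [Ei El]]]].
    set (k := cluster n) in *.
    destruct (is_copy n i) eqn:Ec; [apply is_copy_not_rcoord in Ec; congruence|].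
    rewrite El.
    transitivity (avg (synth_h (a (gblock k)) (rvals a k)) l).
    * apply avg_ext; intros; now apply synth_gblock.
    * rewrite (avg_synth iota Hp); unfold rvals; now rewrite <- En, Ei.
  + destruct (is_copy n i) eqn:Ec; [easy|].
    unfold array_synth; now rewrite Hg, Er, Ec.
Qed.

Lemma synth_ana (v : nat -> nat -> K) (n i : nat) : valid n i = true ->
  array_synth (array_coef v) n i = if is_copy n i then zero else v n i.
Proof.
intros Hv.
assert (Hc := cluster_pos n).
destruct (is_gblock n) eqn:Hg.
- assert (Hi := valid_is_gblock Hv Hg); apply is_gblock_eq in Hg.
  set (k := cluster n) in *.
  destruct (is_copy n i) eqn:Ec.
  { apply is_copy_not_gblock in Ec; rewrite Hg, is_gblock_gblock in Ec; easy. }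
  rewrite Hg, synth_gblock by easy.
  rewrite <- (synth_h_coef iota Hp (v (gblock k)) (rvals v k)).
  apply (@synth_h_ext _ _ _ _ k); [easy| |].
  + intros j Hj; now apply ana_gblock.
  + intros l Hl; now apply ana_rblock.
- unfold array_synth; rewrite Hg.
  destruct (is_rcoord n i) eqn:Er.
  + destruct (is_rcoord_inv Er) as [l [Hl [En [Ei El]]]].
    set (k := cluster n) in *.
    destruct (is_copy n i) eqn:Ec; [apply is_copy_not_rcoord in Ec; congruence|].
    rewrite El.
    transitivity (synth_r (coef (v (gblock k)) (rvals v k)) l).
    * apply (@synth_r_ext _ _ k); [easy|]; intros; now apply ana_gblock.
    * rewrite (synth_r_coef iota Hp); unfold rvals; now rewrite <- En, Ei.
  + destruct (is_copy n i) eqn:Ec; [easy|].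
    unfold array_coef; now rewrite Hv, Hg, Er, Ec.
Qed.

Lemma ana_ext (v w : nat -> nat -> K) (n i : nat) :
  (forall m j, cluster m = cluster n -> valid m j = true -> v m j = w m j) ->
  array_coef v n i = array_coef w n i.
Proof.
intros H; unfold array_coef; destruct (valid n i) eqn:Hv; [|easy].
assert (Hc := cluster_pos n); set (k := cluster n) in *.
assert (Hgb : forall i, (1 <= i < 2 ^ k)%nat -> v (gblock k) i = w (gblock k) i).
{ intros j Hj; apply H; [now apply cluster_gblock|now apply valid_gblock]. }
destruct (is_gblock n) eqn:Hg.
- assert (Hi := valid_is_gblock Hv Hg); apply is_gblock_eq in Hg; fold k in Hg.
  rewrite Hg; apply (@coef_ext _ _ _ _ k); [easy|easy|].
  intros l Hl; apply H; [now apply cluster_rblock|apply valid_last].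
- destruct (is_rcoord n i) eqn:Er.
  + destruct (is_rcoord_inv Er) as [l [Hl [_ [_ ->]]]]; now apply (@avg_ext_valid _ _ k).
  + destruct (is_copy n i); [easy|now apply H].
Qed.

Lemma synth_ext (v w : nat -> nat -> K) (n i : nat) : valid n i = true ->
  (forall m j, cluster m = cluster n -> valid m j = true -> v m j = w m j) ->
  array_synth v n i = array_synth w n i.
Proof.
intros Hv H; unfold array_synth.
assert (Hc := cluster_pos n); set (k := cluster n) in *.
assert (Hgb : forall i, (1 <= i < 2 ^ k)%nat -> v (gblock k) i = w (gblock k) i).
{ intros j Hj; apply H; [now apply cluster_gblock|now apply valid_gblock]. }
destruct (is_gblock n) eqn:Hg.
- assert (Hi := valid_is_gblock Hv Hg); apply is_gblock_eq in Hg; fold k in Hg.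
  rewrite Hg; apply (@synth_h_ext _ _ _ _ k); [easy|easy|].
  intros l Hl; apply H; [now apply cluster_rblock|apply valid_last].
- destruct (is_rcoord n i) eqn:Er.
  + destruct (is_rcoord_inv Er) as [l [Hl [_ [_ ->]]]]; now apply (@synth_r_ext _ _ k).
  + destruct (is_copy n i); [easy|now apply H].
Qed.

Lemma synth_r_lin (c : K) (f g : nat -> K) (l : nat) :
  synth_r (fun i => plus (f i) (mult c (g i))) l = plus (synth_r f l) (mult c (synth_r g l)).
Proof.
unfold group_sums; rewrite kmult_bsum, <- bsum_plus; apply bsum_ext; intros i _.
rewrite avg_plus, avg_scal; easy.
Qed.

Lemma synth_lin (c : K) (v w : nat -> nat -> K) (n i : nat) :
  array_synth (fun n i => plus (v n i) (mult c (w n i))) n i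
  = plus (array_synth v n i) (mult c (array_synth w n i)).
Proof.
unfold array_synth.
destruct (is_gblock n).
- unfold group_synth, level_lift, rvals; rewrite avg_plus, avg_scal; kring.
- destruct (is_rcoord n i); [apply synth_r_lin|].
  destruct (is_copy n i); kring.
Qed.

Lemma ana_lin (c : K) (v w : nat -> nat -> K) (n i : nat) :
  array_coef (fun n i => plus (v n i) (mult c (w n i))) n i
  = plus (array_coef v n i) (mult c (array_coef w n i)).
Proof.
unfold array_coef; destruct (valid n i); [|kring].
destruct (is_gblock n).
- unfold group_coef, level_lift, rvals; rewrite avg_plus, avg_scal.
  destruct (Nat.log2 i) as [|l]; simpl; kring.
- destruct (is_rcoord n i); [now rewrite avg_plus, avg_scal|].
  destruct (is_copy n i); kring.
Qed.

Lemma synth_zero (n i : nat) : array_synth (fun _ _ => zero) n i = zero.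
Proof.
assert (H := synth_lin (opp one) (fun _ _ => zero) (fun _ _ => zero) n i).
refine (eq_trans _ (eq_trans H _)); [|kring].
f_equal; apply functional_extensionality; intros m.
apply functional_extensionality; intros j; kring.
Qed.

Lemma ana_zero (n i : nat) : array_coef (fun _ _ => zero) n i = zero.
Proof.
assert (H := ana_lin (opp one) (fun _ _ => zero) (fun _ _ => zero) n i).
refine (eq_trans _ (eq_trans H _)); [|kring].
f_equal; apply functional_extensionality; intros m.
apply functional_extensionality; intros j; kring.
Qed.

Definition unit_array (v : nat -> nat -> K) : Prop :=
  forall n, lp_sum p (S n) (v n) <= 1.

Lemma unit_array_coord (v : nat -> nat -> K) (n i : nat) :
  unit_array v -> valid n i = true -> rpow (abs (v n i)) p <= 1 /\ abs (v n i) <= 1.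
Proof.
intros H Hv; apply valid_iff in Hv.
assert (H1 : rpow (abs (v n i)) p <= 1).
{ eapply Rle_trans; [|apply (H n)]; rewrite lp_sum_rsum.
  replace i with (S (pred i)) by lia.
  apply (@rsum_term (fun i => rpow (abs (v n (S i))) p)); [intros; apply rpow_ge0|lia]. }
split; [easy|].
destruct (Rle_lt_dec (abs (v n i)) 1) as [H2|H2]; [easy|].
assert (H3 := @rpow_ge_self p Hp (abs (v n i))); lra.
Qed.

Lemma unit_array_group (v : nat -> nat -> K) (k : nat) :
  unit_array v -> (1 <= k)%nat ->
  dyadic_sum p k (v (gblock k)) <= 1 /\ forall l, (l < k)%nat -> abs (rvals v k l) <= 1.
Proof.
intros H Hk; split.
- assert (E := H (gblock k)); rewrite S_gblock, lp_sum_dyadic_sum in E by easy; exact E.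
- intros l Hl; apply (unit_array_coord H), valid_last.
Qed.

Lemma ana_abs_le (v : nat -> nat -> K) (n i : nat) :
  unit_array v -> abs (array_coef v n i) <= 3 + 2 * rpow 2 p.
Proof.
intros H; assert (Hc := rpow2_ge1 Hp).
destruct (unit_array_group H (cluster_pos n)) as [H1 H2].
unfold array_coef; destruct (valid n i) eqn:Hv; [|rewrite abs_zero; lra].
destruct (is_gblock n) eqn:Hg.
- assert (Hi := valid_is_gblock Hv Hg); apply is_gblock_eq in Hg.
  rewrite Hg at 1; now apply (abs_coef_le iota Hp (k := cluster n)).
- destruct (is_rcoord n i) eqn:Er.
  + destruct (is_rcoord_inv Er) as [l [Hl [_ [_ ->]]]].
    assert (E := avg_abs_bound iota Hp (v (gblock (cluster n))) Hl); lra.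
  + destruct (is_copy n i); [rewrite abs_zero; lra|].
    destruct (unit_array_coord H Hv); lra.
Qed.

Definition restr2 (F : nat -> nat -> bool) (v : nat -> nat -> K) (n i : nat) : K :=
  if F n i then v n i else zero.

Lemma lp_sum_le (n : nat) (f g : nat -> K) :
  (forall i, (1 <= i <= n)%nat -> abs (f i) <= abs (g i)) -> lp_sum p n f <= lp_sum p n g.
Proof.
intros H; rewrite !lp_sum_rsum; apply rsum_le; intros i Hi.
apply rpow_le; [lra|]; split; [apply abs_ge_0|apply H; lia].
Qed.

(** Outside the first block of a cluster, the projection can only decrease
    coordinates, except for the last one, which carries a partial sum of averages.
    In the first block the coefficients at the normalized constant vectors form an
    unconditional part, which is added separately. *)
Lemma synth_bound :
  exists C, 1 <= C /\ forall (v : nat -> nat -> K) (F : nat -> nat -> bool),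
    unit_array v ->
    (forall k, (1 <= k)%nat ->
       admissible k (F (gblock k)) (coef (v (gblock k)) (rvals v k))) ->
    forall n, lp_sum p (S n) (array_synth (restr2 F (array_coef v)) n) <= C.
Proof.
destruct (group_projection_bound iota Hp) as [C [HC HG]].
assert (Hc := rpow2_ge1 Hp); assert (HCp := rpow_ge0 C p).
exists (rpow 2 p * (C + 1) + (2 + rpow C p)); split; [nra|].
intros v F Hv HF n.
assert (Hk := cluster_pos n); set (k := cluster n) in *.
destruct (unit_array_group Hv Hk) as [H1 H2].
destruct (HG k _ _ _ H1 H2 (HF k Hk)) as [B1 B2].
assert (Eg : forall i, (1 <= i < 2 ^ k)%nat -> restr2 F (array_coef v) (gblock k) i
  = restr (F (gblock k)) (coef (v (gblock k)) (rvals v k)) i).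
{ intros i Hi; unfold restr2, restr.
  destruct (F (gblock k) i); [now apply ana_gblock|easy]. }
destruct (is_gblock n) eqn:Hg.
- apply is_gblock_eq in Hg; fold k in Hg; rewrite Hg.
  rewrite S_gblock, lp_sum_dyadic_sum by easy.
  set (d := rvals (restr2 F (array_coef v)) k).
  set (f0 := restr (F (gblock k)) (coef (v (gblock k)) (rvals v k))) in *.
  assert (Hd : dyadic_sum p k (lift d) <= 1).
  { rewrite (dyadic_sum_lift iota Hp); eapply Rle_trans; [|exact H1].
    apply rsum_le; intros l Hl; eapply Rle_trans; [|apply (avg_level iota Hp)].
    apply rpow_le; [lra|]; split; [apply abs_ge_0|].
    unfold d, rvals, restr2; destruct (F _ _); [|rewrite abs_zero; apply abs_ge_0].
    fold (rvals (array_coef v) k l); rewrite ana_rblock by easy; lra. }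
  eapply Rle_trans.
  { apply (@dyadic_sum_add_le K p Hp k (synth_h f0 (fun _ => zero)) (lift d)).
    intros i Hi; rewrite synth_gblock by easy; fold d.
    rewrite (@synth_h_ext _ f0 d d k) by easy.
    unfold group_synth, level_lift; kring. }
  assert (rpow 2 p * (dyadic_sum p k (synth_h f0 (fun _ => zero)) + dyadic_sum p k (lift d))
          <= rpow 2 p * (C + 1)); [|lra].
  apply Rmult_le_compat_l; lra.
- assert (Hvn := Hv n).
  assert (Hlow : forall i, (1 <= i <= S n)%nat -> is_rcoord n i = false ->
    abs (array_synth (restr2 F (array_coef v)) n i) <= abs (v n i)).
  { intros i Hi Er; unfold array_synth; rewrite Hg, Er.
    destruct (is_copy n i) eqn:Ec; [rewrite abs_zero; apply abs_ge_0|].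
    unfold restr2; destruct (F n i); [|rewrite abs_zero; apply abs_ge_0].
    unfold array_coef; rewrite (proj2 (valid_iff n i) Hi), Hg, Er, Ec; lra. }
  assert (Hlast : rpow (abs (array_synth (restr2 F (array_coef v)) n (S n))) p <= 1 + rpow C p).
  { destruct (is_rcoord n (S n)) eqn:Er.
    - destruct (is_rcoord_inv Er) as [l [Hl [_ [_ El]]]]; fold k in Hl.
      unfold array_synth; rewrite Hg, Er, El; fold k.
      assert (rpow (abs (synth_r (restr2 F (array_coef v) (gblock k)) l)) p <= rpow C p); [|lra].
      apply rpow_le; [lra|]; split; [apply abs_ge_0|].
      rewrite (@synth_r_ext _ _ k l Hl Eg); now apply B2.
    - assert (rpow (abs (array_synth (restr2 F (array_coef v)) n (S n))) p <= 1); [|lra].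
      eapply Rle_trans; [|exact (proj1 (unit_array_coord Hv (valid_last n)))].
      apply rpow_le; [lra|]; split; [apply abs_ge_0|apply Hlow; [lia|easy]]. }
  assert (Hfirst : lp_sum p n (array_synth (restr2 F (array_coef v)) n) <= 1).
  { eapply Rle_trans; [|exact Hvn].
    apply Rle_trans with (lp_sum p n (v n)).
    - apply lp_sum_le; intros i Hi; apply Hlow; [lia|].
      destruct (is_rcoord n i) eqn:Er; [|easy].
      destruct (is_rcoord_inv Er) as [l [_ [_ [Ei _]]]]; lia.
    - rewrite !lp_sum_rsum; simpl; assert (H := rpow_ge0 (abs (v n (S n))) p); lra. }
  rewrite lp_sum_rsum in Hfirst |- *; simpl; nra.
Qed.

End Arrays.

(** * The conditional system in the mixed-norm space *)

Section Scaling.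

Variable K : AbsRing.
Variable iota : real_subfield K.
Add Ring K_ring : (scalar_ring_theory iota).
Ltac kring := kring_norm K; ring.
Variable V : NormedModule K.
Ltac mring := module_norm K V; kring.

(** Homogeneity; the invariant [Q] is there because the bounds for greedy
    sets are only available for the vectors for which the set is greedy. *)
Lemma bound_from_unit_ball (N : V -> R) (Q : V -> Prop) (C : R) :
  (forall c x, N (scal c x) = abs c * N x) ->
  (forall c x, Q x -> Q (scal c x)) ->
  (forall x, norm x <= 1 -> Q x -> N x <= C) ->
  forall x, Q x -> N x <= C * norm x.
Proof.
intros HN HQ H x Hx.
destruct (norm_ge_0 x) as [Hpos|Hzero].
- assert (H1 : abs (ofR iota (/ norm x)) = / norm x).
  { apply abs_ofR_ge0, Rlt_le, Rinv_0_lt_compat, Hpos. }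
  assert (H2 : N (scal (ofR iota (/ norm x)) x) <= C).
  { apply H; [|now apply HQ].
    rewrite (norm_scalE iota), H1, Rinv_l; lra. }
  rewrite HN, H1 in H2.
  apply Rmult_le_reg_l with (/ norm x); [now apply Rinv_0_lt_compat|].
  eapply Rle_trans; [exact H2|]; apply Req_le; field; lra.
- assert (E : N x = 0).
  { replace x with (scal (zero : K) x).
    - rewrite HN, abs_zero; ring.
    - transitivity (@zero V); [mring|].
      symmetry; apply norm_eq_zero; now rewrite Hzero. }
  rewrite E, <- Hzero; lra.
Qed.

End Scaling.

Section MixedSpace.

Variable K : AbsRing.
Variable iota : real_subfield K.
Add Ring K_ring : (scalar_ring_theory iota).
Ltac kring := kring_norm K; ring.
Variable p : R.
Hypothesis Hp : 1 <= p.

Notation Bp := (B_p0 K Hp).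

Definition block (b : Bp) (n : nat) : lp K Hp (S n) := @c0_coord K _ b n.
Definition entry (b : Bp) (n i : nat) : K := @lp_coord K (S n) (block b n) i.

Lemma entry_plus (x y : Bp) (n i : nat) : entry (plus x y) n i = plus (entry x n i) (entry y n i).
Proof. reflexivity. Qed.

Lemma entry_scal (a : K) (x : Bp) (n i : nat) : entry (scal a x) n i = mult a (entry x n i).
Proof. reflexivity. Qed.

Lemma entry_minus (x y : Bp) (n i : nat) : entry (minus x y) n i = minus (entry x n i) (entry y n i).
Proof. reflexivity. Qed.

Lemma entry_zero (n i : nat) : entry zero n i = zero.
Proof. reflexivity. Qed.

Lemma entry_out (b : Bp) (n i : nat) : valid n i = false -> entry b n i = zero.
Proof.
intros H; apply (@lp_coord_out K (S n)); intros Hi.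
apply valid_iff in Hi; congruence.
Qed.

Lemma entry_ext (x y : Bp) :
  (forall n i, valid n i = true -> entry x n i = entry y n i) -> x = y.
Proof.
intros H; apply (@c0_ext K (fun n => lp K Hp (S n))); intros n.
apply (@lp_ext K (S n)); intros i.
change (entry x n i = entry y n i).
destruct (valid n i) eqn:E; [now apply H|now rewrite !entry_out].
Qed.

Lemma norm_block (b : Bp) (n : nat) :
  norm (block b n) = rpow (lp_sum p (S n) (entry b n)) (/ p).
Proof. reflexivity. Qed.

Lemma invp_ge0 : 0 <= / p.
Proof. apply Rlt_le, Rinv_0_lt_compat; lra. Qed.

Lemma norm_le_of_blocks (b : Bp) (M : R) : 0 <= M ->
  (forall n, lp_sum p (S n) (entry b n) <= rpow M p) -> norm b <= M.
Proof.
intros HM H; apply (@c0_norm_lub K (fun n => lp K Hp (S n))); intros n.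
change (norm (block b n) <= M); rewrite norm_block.
rewrite <- (rpowK (p := p) (x := M)) by lra.
apply rpow_le; [apply invp_ge0|]; split; [apply lp_sum_ge0|apply H].
Qed.

Lemma block_sum_le_norm (b : Bp) (n : nat) :
  lp_sum p (S n) (entry b n) <= rpow (norm b) p.
Proof.
rewrite <- (rpowVK (p := p) (x := lp_sum p (S n) (entry b n)));
  [|lra|apply lp_sum_ge0].
apply rpow_le; [lra|]; split; [apply rpow_ge0|].
exact (@c0_norm_ub K (fun n => lp K Hp (S n)) b n).
Qed.

Lemma unit_array_of_norm (b : Bp) : norm b <= 1 -> unit_array p (entry b).
Proof.
intros H n; eapply Rle_trans; [apply block_sum_le_norm|].
apply rpow_le_1; [easy|]; split; [apply norm_ge_0|easy].
Qed.

Lemma entry_le_norm (b : Bp) (n i : nat) : valid n i = true -> abs (entry b n i) <= norm b.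
Proof.
intros Hv.
apply Rle_trans with (1 * norm b); [|lra].
apply (@bound_from_unit_ball K iota Bp (fun b => abs (entry b n i)) (fun _ => True)); try easy.
- intros c x; rewrite entry_scal; apply (abs_multE iota).
- intros x Hx _.
  exact (proj2 (unit_array_coord Hp (unit_array_of_norm Hx) Hv)).
Qed.

Definition lp_mask (n : nat) (f : nat -> K) : lp_carrier K n.
Proof.
refine (LpVec (fun i => if andb (Nat.leb 1 i) (Nat.leb i n) then f i else zero) _).
intros i Hi; destruct (andb (Nat.leb 1 i) (Nat.leb i n)) eqn:E; [|easy].
apply Bool.andb_true_iff in E; rewrite !Nat.leb_le in E; easy.
Defined.

Lemma lp_mask_sum (n : nat) (f : nat -> K) : lp_sum p n (lp_mask n f) = lp_sum p n f.
Proof.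
rewrite !lp_sum_rsum; apply rsum_ext; intros i Hi; cbn [lp_mask lp_coord].
now rewrite (proj2 (Nat.leb_le 1 (S i))), (proj2 (Nat.leb_le (S i) n)) by lia.
Qed.

Definition of_array (v : nat -> nat -> K)
  (H : is_lim_seq (fun n => rpow (lp_sum p (S n) (v n)) (/ p)) 0) : Bp.
Proof.
refine (@C0Vec K (fun n => lp K Hp (S n)) (fun n => lp_mask (S n) (v n)) _).
apply is_lim_seq_ext with (2 := H); intros n.
rewrite <- lp_mask_sum; reflexivity.
Defined.

Lemma entry_of_array (v : nat -> nat -> K) H (n i : nat) :
  entry (@of_array v H) n i = if valid n i then v n i else zero.
Proof. reflexivity. Qed.

Lemma lim_dominated (v : nat -> nat -> K) (b : Bp) (s : nat -> nat) :
  filterlim s eventually eventually ->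
  (forall n, lp_sum p (S n) (v n) <= lp_sum p (S (s n)) (entry b (s n))) ->
  is_lim_seq (fun n => rpow (lp_sum p (S n) (v n)) (/ p)) 0.
Proof.
intros Hs H.
apply is_lim_seq_le_le with (fun _ => 0) (fun n => norm (block b (s n))).
- intros n; split; [apply rpow_ge0|].
  rewrite norm_block; apply rpow_le; [apply invp_ge0|].
  split; [apply lp_sum_ge0|apply H].
- apply is_lim_seq_const.
- exact (is_lim_seq_subseq _ _ _ Hs (@c0_coord_lim K (fun n => lp K Hp (S n)) b)).
Qed.

Lemma lp_sum_zero (n : nat) (f : nat -> K) :
  (forall i, (1 <= i <= n)%nat -> f i = zero) -> lp_sum p n f = 0.
Proof.
intros H; rewrite lp_sum_rsum, (@rsum_ext _ (fun _ => 0)), rsum_const; [ring|].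
intros i Hi; rewrite H, abs_zero by lia; apply rpow0.
Qed.

Definition truncate (v : nat -> nat -> K) (N n i : nat) : K :=
  if Nat.ltb n N then v n i else zero.

Lemma lim_truncate (v : nat -> nat -> K) (N : nat) :
  is_lim_seq (fun n => rpow (lp_sum p (S n) (truncate v N n)) (/ p)) 0.
Proof.
apply is_lim_seq_ext_loc with (fun _ => 0); [|apply is_lim_seq_const].
exists N; intros n Hn; symmetry; rewrite lp_sum_zero; [apply rpow0|].
intros i _; unfold truncate; now rewrite (proj2 (Nat.ltb_ge n N)) by lia.
Qed.

Definition fin_array (v : nat -> nat -> K) (N : nat) : Bp := of_array (lim_truncate v N).

Lemma entry_fin_array (v : nat -> nat -> K) (N n i : nat) : valid n i = true ->
  entry (fin_array v N) n i = if Nat.ltb n N then v n i else zero.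
Proof. intros H; unfold fin_array; rewrite entry_of_array, H; easy. Qed.

Lemma lim_div2 : filterlim Nat.div2 eventually eventually.
Proof.
intros Q [N HN]; exists (2 * N)%nat; intros n Hn; apply HN.
rewrite Nat.div2_div; apply Nat.div_le_lower_bound; lia.
Qed.

Lemma lim_double : filterlim (fun n => 2 * n + 1)%nat eventually eventually.
Proof. intros Q [N HN]; exists N; intros n Hn; apply HN; lia. Qed.

(** Block [m] is copied to the lower half of block [2 * m + 1]. *)
Definition copy_array (b : Bp) (n i : nat) : K :=
  if is_copy n i then entry b (Nat.div2 n) i else zero.

Lemma div2_2m1 (m : nat) : Nat.div2 (2 * m + 1) = m.
Proof. rewrite Nat.add_1_r; apply Nat.div2_succ_double. Qed.

Lemma copy_array_sum (b : Bp) (n : nat) :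
  lp_sum p (S n) (copy_array b n) <= lp_sum p (S (Nat.div2 n)) (entry b (Nat.div2 n)).
Proof.
destruct (Nat.Even_or_Odd n) as [[m Hm]|[m Hm]].
- rewrite lp_sum_zero; [apply lp_sum_ge0|].
  intros i _; unfold copy_array, is_copy; now rewrite Hm, odd_2m.
- rewrite Hm, div2_2m1, !lp_sum_rsum.
  replace (S (2 * m + 1)) with (S m + S m)%nat by lia; rewrite rsum_add.
  rewrite (@rsum_ext (fun i => rpow (abs (copy_array b (2 * m + 1) (S (S m + i)))) p)
             (fun _ => 0)), rsum_const.
  + rewrite Rmult_0_r, Rplus_0_r; apply Req_le, rsum_ext; intros i Hi.
    unfold copy_array; now rewrite is_copy_true, div2_2m1 by lia.
  + intros i Hi; unfold copy_array.
    destruct (is_copy (2 * m + 1) (S (S m + i))) eqn:E; [|rewrite abs_zero; apply rpow0].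
    destruct (is_copy_inv E) as [m' [E1 E2]]; lia.
Qed.

Definition copy (b : Bp) : Bp := of_array (lim_dominated lim_div2 (copy_array_sum b)).

Lemma entry_copy (b : Bp) (n i : nat) : valid n i = true ->
  entry (copy b) n i = if is_copy n i then entry b (Nat.div2 n) i else zero.
Proof. intros H; unfold copy; now rewrite entry_of_array, H. Qed.

Definition uncopy_array (b : Bp) (n i : nat) : K := entry b (2 * n + 1) i.

Lemma uncopy_array_sum (b : Bp) (n : nat) :
  lp_sum p (S n) (uncopy_array b n)
  <= lp_sum p (S (2 * n + 1)) (entry b (2 * n + 1)).
Proof.
rewrite !lp_sum_rsum; replace (S (2 * n + 1)) with (S n + S n)%nat by lia.
rewrite rsum_add; unfold uncopy_array.
assert (0 <= rsum (fun i => rpow (abs (entry b (2 * n + 1) (S (S n + i)))) p) (S n));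
  [|lra].
apply rsum_ge0; intros; apply rpow_ge0.
Qed.

Definition uncopy (b : Bp) : Bp := of_array (lim_dominated lim_double (uncopy_array_sum b)).

Lemma entry_uncopy (b : Bp) (n i : nat) : valid n i = true ->
  entry (uncopy b) n i = entry b (2 * n + 1) i.
Proof. intros H; unfold uncopy; now rewrite entry_of_array, H. Qed.

Lemma copy_linear : is_linear copy.
Proof.
constructor.
- intros x y; apply entry_ext; intros n i Hv; rewrite entry_plus, !entry_copy by easy.
  destruct (is_copy n i); [apply entry_plus|kring].
- intros k x; apply entry_ext; intros n i Hv; rewrite entry_scal, !entry_copy by easy.
  destruct (is_copy n i); [apply entry_scal|kring].
- exists 1; split; [lra|]; intros x; rewrite Rmult_1_l.
  apply norm_le_of_blocks; [apply norm_ge_0|]; intros n.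
  eapply Rle_trans; [|apply (block_sum_le_norm x (Nat.div2 n))].
  eapply Rle_trans; [|apply copy_array_sum]; apply Req_le, lp_mask_sum.
Qed.

Lemma uncopy_linear : is_linear uncopy.
Proof.
constructor.
- intros x y; apply entry_ext; intros n i Hv; rewrite entry_plus, !entry_uncopy by easy.
  apply entry_plus.
- intros k x; apply entry_ext; intros n i Hv; rewrite entry_scal, !entry_uncopy by easy.
  apply entry_scal.
- exists 1; split; [lra|]; intros x; rewrite Rmult_1_l.
  apply norm_le_of_blocks; [apply norm_ge_0|]; intros n.
  eapply Rle_trans; [|apply (block_sum_le_norm x (2 * n + 1))].
  eapply Rle_trans; [|apply uncopy_array_sum]; apply Req_le, lp_mask_sum.
Qed.

Lemma uncopy_copy (b : Bp) : uncopy (copy b) = b.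
Proof.
apply entry_ext; intros n i Hv; rewrite entry_uncopy by easy.
assert (Hi := Hv); apply valid_iff in Hi.
rewrite entry_copy by (apply valid_iff; lia).
now rewrite is_copy_true, div2_2m1 by lia.
Qed.

Lemma entry_copy_uncopy (b : Bp) (n i : nat) : valid n i = true ->
  entry (copy (uncopy b)) n i = if is_copy n i then entry b n i else zero.
Proof.
intros Hv; rewrite entry_copy by easy.
destruct (is_copy n i) eqn:E; [|easy].
destruct (is_copy_inv E) as [m [Hm Hi]]; rewrite Hm, div2_2m1.
apply valid_iff in Hv; apply entry_uncopy; apply valid_iff; lia.
Qed.

Lemma uncopy_zero (b : Bp) :
  (forall n i, valid n i = true -> is_copy n i = true -> entry b n i = zero) ->
  uncopy b = zero.
Proof.
intros H; apply entry_ext; intros n i Hv; rewrite entry_uncopy by easy.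
apply valid_iff in Hv; apply H; [apply valid_iff; lia|apply is_copy_true; lia].
Qed.

Notation synth := (array_synth iota p).
Notation ana := (array_coef iota p).

Definition arrof (a : nat -> K) (n i : nat) : K :=
  if valid n i then a (code n i) else zero.

Definition delta (j i : nat) : K := if Nat.eqb i j then one else zero.

(** The factor 2 in the truncation covers the whole cluster of the position
    [j], hence the support of the vector. *)
Definition uvec (j : nat) : Bp :=
  fin_array (synth (arrof (delta j))) (2 * 2 ^ cluster (fst (dec j))).

Definition ucoord (j : nat) (b : Bp) : K := ana (entry b) (fst (dec j)) (snd (dec j)).

Definition copy_pos (j : nat) : bool := is_copy (fst (dec j)) (snd (dec j)).

Lemma ucoord_code (b : Bp) (n i : nat) : valid n i = true ->
  ucoord (code n i) b = ana (entry b) n i.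
Proof. intros H; unfold ucoord; now rewrite dec_code. Qed.

Lemma copy_pos_code (n i : nat) : valid n i = true ->
  copy_pos (code n i) = is_copy n i.
Proof. intros H; unfold copy_pos; now rewrite dec_code. Qed.

Lemma entry_uvec (j n i : nat) : valid n i = true ->
  entry (uvec j) n i = synth (arrof (delta j)) n i.
Proof.
intros Hv; unfold uvec; rewrite entry_fin_array by easy.
destruct (Nat.ltb n (2 * 2 ^ cluster (fst (dec j)))) eqn:E; [easy|].
apply Nat.ltb_ge in E; symmetry.
rewrite <- (synth_zero iota p n i); apply (@synth_ext K iota p); [easy|].
intros m q Hm Hq; unfold arrof; rewrite Hq; unfold delta.
destruct (Nat.eqb (code m q) j) eqn:Ej; [|easy].
exfalso; apply Nat.eqb_eq in Ej; subst j; rewrite dec_code in E by easy; simpl fst in E.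
rewrite Hm in E; destruct (cluster_bounds n); lia.
Qed.

Lemma entry_usum (a : nat -> K) (M n i : nat) : valid n i = true ->
  entry (@bsum Bp (fun j => scal (a j) (uvec j)) M) n i
  = synth (arrof (fun j => if Nat.ltb j M then a j else zero)) n i.
Proof.
intros Hv; induction M as [|M IH].
- transitivity (synth (fun _ _ => zero) n i); [symmetry; apply synth_zero|].
  f_equal; apply functional_extensionality; intros m.
  apply functional_extensionality; intros q; unfold arrof.
  rewrite (proj2 (Nat.ltb_ge (code m q) 0)) by lia; now destruct (valid m q).
- transitivity (plus (entry (@bsum Bp (fun j => scal (a j) (uvec j)) M) n i)
                     (mult (a M) (entry (uvec M) n i))); [reflexivity|].
  rewrite IH, entry_uvec, <- synth_lin by easy.
  f_equal; apply functional_extensionality; intros m.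
  apply functional_extensionality; intros q; unfold arrof, delta.
  destruct (valid m q); [|kring].
  destruct (Nat.eqb (code m q) M) eqn:E.
  + apply Nat.eqb_eq in E; rewrite E, Nat.ltb_irrefl, (proj2 (Nat.ltb_lt M (S M))) by lia.
    kring.
  + apply Nat.eqb_neq in E.
    replace (Nat.ltb (code m q) (S M)) with (Nat.ltb (code m q) M); [kring|].
    destruct (Nat.ltb (code m q) M) eqn:E1; symmetry.
    * apply Nat.ltb_lt in E1; apply Nat.ltb_lt; lia.
    * apply Nat.ltb_ge in E1; apply Nat.ltb_ge; lia.
Qed.

Definition uproj (F : nat -> bool) (M : nat) (b : Bp) : Bp :=
  @bsum Bp (fun j => if F j then scal (ucoord j b) (uvec j) else zero) M.

Definition code_set (F : nat -> bool) (M n i : nat) : bool :=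
  andb (F (code n i)) (Nat.ltb (code n i) M).

Lemma entry_uproj (F : nat -> bool) (M : nat) (b : Bp) (n i : nat) : valid n i = true ->
  entry (uproj F M b) n i = synth (restr2 (code_set F M) (ana (entry b))) n i.
Proof.
intros Hv; unfold uproj.
transitivity (entry (@bsum Bp (fun j => scal (if F j then ucoord j b else zero) (uvec j)) M) n i).
- f_equal; apply (@bsum_ext Bp); intros j _; destruct (F j); [easy|].
  symmetry; exact (scal_zero_l (uvec j)).
- rewrite entry_usum by easy; apply synth_ext; [easy|].
  intros m q _ Hq; unfold arrof, restr2, code_set; rewrite Hq.
  destruct (F (code m q)), (Nat.ltb (code m q) M); simpl; try easy.
  now apply ucoord_code.
Qed.

Lemma ucoord_uvec (j i : nat) : copy_pos j = false ->
  ucoord j (uvec i) = delta i j.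
Proof.
intros Hj; unfold ucoord.
rewrite (@ana_ext K iota p (entry (uvec i)) (synth (arrof (delta i))))
  by (intros; now apply entry_uvec).
rewrite (ana_synth iota Hp) by apply valid_dec.
unfold copy_pos in Hj; rewrite Hj; unfold arrof; now rewrite valid_dec, code_dec.
Qed.

Lemma ucoord_copy_pos (j : nat) (b : Bp) : copy_pos j = true -> ucoord j b = zero.
Proof.
intros H; unfold ucoord, array_coef; rewrite valid_dec.
unfold copy_pos in H; now rewrite (is_copy_not_gblock H), (is_copy_not_rcoord H), H.
Qed.

Lemma ucoord_plus (j : nat) (x y : Bp) :
  ucoord j (plus x y) = plus (ucoord j x) (ucoord j y).
Proof.
unfold ucoord.
refine (eq_trans _ (eq_trans (ana_lin iota p one (entry x) (entry y) (fst (dec j)) (snd (dec j))) _)); [|kring].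
f_equal; apply functional_extensionality; intros m.
apply functional_extensionality; intros q; rewrite entry_plus; kring.
Qed.

Lemma ucoord_scal (j : nat) (c : K) (x : Bp) :
  ucoord j (scal c x) = mult c (ucoord j x).
Proof.
unfold ucoord.
refine (eq_trans _ (eq_trans (ana_lin iota p c (fun _ _ => zero) (entry x)
  (fst (dec j)) (snd (dec j))) _)).
- f_equal; apply functional_extensionality; intros m.
  apply functional_extensionality; intros q; rewrite entry_scal; kring.
- rewrite ana_zero; kring.
Qed.

Lemma ucoord_bound : exists C, 0 < C /\ forall j b, abs (ucoord j b) <= C * norm b.
Proof.
assert (Hc := rpow2_ge1 Hp).
exists (3 + 2 * rpow 2 p); split; [lra|]; intros j b.
apply (@bound_from_unit_ball K iota Bp (fun b => abs (ucoord j b)) (fun _ => True)); try easy.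
- intros c x; rewrite ucoord_scal; apply (abs_multE iota).
- intros x Hx _; apply (ana_abs_le iota Hp), unit_array_of_norm, Hx.
Qed.

(** The coordinates of the copy are exactly those that [array_coef] never
    reads. *)
Lemma ucoord_copy (j : nat) (b : Bp) : ucoord j (copy b) = zero.
Proof.
destruct (copy_pos j) eqn:Hj; [now apply ucoord_copy_pos|].
unfold ucoord; set (n := fst (dec j)); set (i := snd (dec j)).
assert (Hv : valid n i = true) by apply valid_dec.
rewrite (@ana_ext K iota p (entry (copy b)) (fun m q => if is_copy m q then entry (copy b) m q else zero)).
2:{ intros m q _ Hm; rewrite entry_copy by easy; now destruct (is_copy m q). }
unfold array_coef; rewrite Hv.
assert (Hg : forall q, is_copy (gblock (cluster n)) q = false).
{ intros q; destruct (is_copy (gblock (cluster n)) q) eqn:Ec; [|easy].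
  apply is_copy_not_gblock in Ec; now rewrite is_gblock_gblock in Ec by apply cluster_pos. }
unfold copy_pos in Hj; fold n i in Hj.
destruct (is_gblock n) eqn:En.
- assert (Hi := valid_is_gblock Hv En); apply is_gblock_eq in En.
  transitivity (group_coef iota p (fun _ => zero) (fun _ => zero) i).
  + apply (@coef_ext K iota p _ _ _ _ (cluster n)); [easy| |].
    * intros q _; rewrite En at 1; now rewrite Hg.
    * intros l Hl; unfold rvals.
      destruct (is_copy (rblock (cluster n) l) (S (rblock (cluster n) l))) eqn:Ec; [|easy].
      apply is_copy_not_rcoord in Ec; rewrite is_rcoord_rblock in Ec; easy.
  + unfold group_coef, level_lift; rewrite avg_zero by easy.
    destruct (Nat.log2 i); simpl; kring.
- destruct (is_rcoord n i); [|now rewrite Hj].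
  apply avg_zero; intros q _; now rewrite Hg.
Qed.

Lemma uncopy_uvec (j : nat) : copy_pos j = false -> uncopy (uvec j) = zero.
Proof.
intros Hj; apply uncopy_zero; intros n i Hv Hc.
rewrite entry_uvec by easy; unfold array_synth.
now rewrite (is_copy_not_gblock Hc), (is_copy_not_rcoord Hc), Hc.
Qed.

Lemma uproj_scal (F : nat -> bool) (M : nat) (c : K) (b : Bp) :
  uproj F M (scal c b) = scal c (uproj F M b).
Proof.
unfold uproj; rewrite <- (bsum_scal iota); apply (@bsum_ext Bp); intros j _.
destruct (F j).
- rewrite ucoord_scal; symmetry; exact (scal_assoc c (ucoord j b) (uvec j)).
- symmetry; exact (@scal_zero_r K Bp c).
Qed.

Definition uadmissible (F : nat -> bool) (M : nat) (b : Bp) : Prop :=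
  forall k, (1 <= k)%nat ->
    admissible k (code_set F M (gblock k))
      (fun i => if valid (gblock k) i then ucoord (code (gblock k) i) b else zero).

Lemma admissible_ext (k : nat) (F : nat -> bool) (f g : nat -> K) :
  (forall i, (1 <= i < 2 ^ k)%nat -> f i = g i) ->
  admissible k F f -> admissible k F g.
Proof.
intros E [H|[t [Ht [H0 H1]]]]; [now left|right; exists t; split; [easy|]].
split; intros i Hi Hf; rewrite <- E by easy; [apply H0|apply H1]; easy.
Qed.

Lemma uproj_unit_bound : exists C, 1 <= C /\ forall F M b,
  norm b <= 1 -> uadmissible F M b -> norm (uproj F M b) <= C.
Proof.
destruct (synth_bound iota Hp) as [C [HC H]].
exists C; split; [easy|]; intros F M b Hb HF.
apply norm_le_of_blocks; [lra|]; intros n.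
apply Rle_trans with C; [|now apply rpow_ge_self].
apply Rle_trans with (lp_sum p (S n) (synth (restr2 (code_set F M) (ana (entry b))) n)).
- apply lp_sum_le; [easy|]; intros i Hi; rewrite entry_uproj by now apply valid_iff.
  apply Rle_refl.
- apply H; [now apply unit_array_of_norm|]; intros k Hk.
  refine (admissible_ext _ (HF k Hk)).
  intros i Hi; rewrite (proj2 (valid_gblock i Hk) Hi).
  rewrite ucoord_code by now apply valid_gblock.
  now apply ana_gblock.
Qed.

(** Positions are consecutive along a block, so an initial segment of the
    positions meets each block in an initial segment. *)
Lemma uprefix_admissible (M : nat) (b : Bp) : uadmissible (fun _ => true) M b.
Proof.
intros k Hk; left.
set (n := gblock k); set (T := Nat.div2 (n * S n)).
assert (HT : (2 * T = n * S n)%nat).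
{ unfold T; rewrite Nat.div2_div.
  destruct (Nat.Even_or_Odd n) as [[m Hm]|[m Hm]].
  - replace (n * S n)%nat with (m * S n * 2)%nat by (rewrite Hm at 2; ring).
    rewrite Nat.div_mul; lia.
  - replace (n * S n)%nat with (n * S m * 2)%nat by (rewrite Hm at 3; ring).
    rewrite Nat.div_mul; lia. }
(* The block starts at position [T]; clipping keeps the bound between 1 and [2 ^ k]. *)
exists (Nat.min (2 ^ k) (Nat.max 1 (M + 1 - T))).
assert (H2 := pow2_pos k); split; [lia|].
intros i Hi; unfold code_set; rewrite Bool.andb_true_l.
assert (Hc : (code n i = T + i - 1)%nat).
{ assert (E := @code_spec n i (proj2 (valid_gblock i Hk) Hi)); lia. }
rewrite Hc; apply Bool.eq_iff_eq_true; rewrite !Nat.ltb_lt; lia.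
Qed.

Lemma uprefix_bound : exists C, 1 <= C /\ forall M b,
  norm (uproj (fun _ => true) M b) <= C * norm b.
Proof.
destruct uproj_unit_bound as [C [HC H]]; exists C; split; [easy|]; intros M b.
apply (@bound_from_unit_ball K iota Bp (fun b => norm (uproj (fun _ => true) M b))
  (fun _ => True)); try easy.
- intros c x; rewrite uproj_scal; apply (norm_scalE iota).
- intros x Hx _; apply H; [easy|apply uprefix_admissible].
Qed.

Lemma greedy_threshold (v : nat -> R) (F : nat -> bool) (M : nat) (K0 : R) :
  (forall j, 0 <= v j <= K0) -> (forall j, F j = true -> (j < M)%nat) ->
  (forall j k, F j = false -> F k = true -> v j <= v k) ->
  exists t, 0 <= t /\ (forall j, F j = false -> v j <= t) /\
    (forall j, F j = true -> t <= v j).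
Proof.
intros Hv HM HF.
assert (HFM : F M = false).
{ destruct (F M) eqn:E; [|easy]; specialize (HM M E); lia. }
(* The threshold is the supremum over the rejected indices. *)
destruct (completeness (fun x => exists j, F j = false /\ x = v j)) as [t [Ht1 Ht2]].
- exists K0; intros x [j [_ ->]]; apply Hv.
- exists (v M), M; auto.
- exists t; repeat split.
  + apply Rle_trans with (v M); [apply Hv|apply Ht1; exists M; auto].
  + intros j Hj; apply Ht1; exists j; auto.
  + intros j Hj; apply Ht2; intros x [i [Hi ->]]; now apply HF.
Qed.

Lemma ugreedy_bound : exists C, 1 <= C /\ forall F M b,
  (forall j, F j = true -> (j < M)%nat) ->
  greedy_set F (fun j => ucoord j b) ->
  norm (uproj F M b) <= C * norm b.
Proof.
destruct uproj_unit_bound as [C [HC H]]; exists C; split; [easy|]; intros F M b HM.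
destruct ucoord_bound as [C1 [HC1 Hco]].
apply (@bound_from_unit_ball K iota Bp (fun b => norm (uproj F M b))
  (fun b => greedy_set F (fun j => ucoord j b))).
- intros c x; rewrite uproj_scal; apply (norm_scalE iota).
- intros c x HQ j k Hj Hk; rewrite !ucoord_scal, !(abs_multE iota).
  apply Rmult_le_compat_l; [apply abs_ge_0|now apply HQ].
- intros x Hx HQ; apply H; [easy|].
  destruct (@greedy_threshold (fun j => abs (ucoord j x)) F M (C1 * norm x)) as [t [Ht [H0 H1]]];
    try easy.
  { intros j; split; [apply abs_ge_0|apply Hco]. }
  intros k Hk; right; exists t; split; [easy|].
  split; intros i Hi; rewrite (proj2 (valid_gblock i Hk) Hi); unfold code_set;
    destruct (F (code (gblock k) i)) eqn:E; simpl; try easy.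
  + intros E1; apply Nat.ltb_ge in E1; specialize (HM _ E); lia.
  + intros _; now apply H0.
  + intros _; now apply H1.
Qed.

Lemma rsum_at_most_one (u : nat -> R) (c : R) (n : nat) : 0 <= c ->
  (forall i, u i <= c) -> (forall i j, u i <> 0 -> u j <> 0 -> i = j) ->
  rsum u n <= c.
Proof.
intros Hc Hu H1; induction n as [|n IH]; simpl; [easy|].
destruct (Req_dec_T (u n) 0) as [E|E]; [lra|].
rewrite (@rsum_ext u (fun _ => 0)), rsum_const; [specialize (Hu n); lra|].
intros i Hi; destruct (Req_dec_T (u i) 0) as [E'|E']; [easy|].
specialize (H1 i n E' E); lia.
Qed.

Lemma rho_le2 : rho p <= 2.
Proof.
unfold rho; rewrite <- (Rpower_1 2) at 2 by lra.
destruct (Rle_lt_or_eq_dec 1 p Hp) as [H| <-].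
- apply Rlt_le, Rpower_lt; [lra|]; rewrite <- Rinv_1; apply Rinv_lt_contravar; lra.
- rewrite Rinv_1; lra.
Qed.

Lemma code_inj (n i m q : nat) : valid n i = true -> valid m q = true ->
  code n i = code m q -> n = m /\ i = q.
Proof.
intros H1 H2 E; assert (E' := f_equal dec E); rewrite !dec_code in E' by easy.
injection E'; easy.
Qed.

Lemma arrof_delta (j n i : nat) : arrof (delta j) n i <> zero ->
  valid n i = true /\ code n i = j.
Proof.
unfold arrof, delta; destruct (valid n i); [|easy].
destruct (Nat.eqb (code n i) j) eqn:E; [|easy]; now apply Nat.eqb_eq in E.
Qed.

Lemma abs_arrof_delta (j n i : nat) :
  abs (arrof (delta j) n i) <= 1 /\
  rpow (abs (arrof (delta j) n i)) p = abs (arrof (delta j) n i).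
Proof.
unfold arrof, delta; destruct (valid n i); [destruct (Nat.eqb (code n i) j)|].
- rewrite abs_one; split; [lra|now apply rpow_1].
- rewrite abs_zero; split; [lra|apply rpow0].
- rewrite abs_zero; split; [lra|apply rpow0].
Qed.

Lemma rpow_abs_neq0 (x : K) : rpow (abs x) p <> 0 -> x <> zero.
Proof. intros H E; apply H; rewrite E, abs_zero; apply rpow0. Qed.

Lemma unit_arrof_delta (j : nat) : unit_array p (arrof (delta j)).
Proof.
intros n; rewrite lp_sum_rsum; apply rsum_at_most_one; [lra| |].
- intros i; destruct (abs_arrof_delta j n (S i)) as [H ->]; easy.
- intros i q Hi Hq; apply rpow_abs_neq0, arrof_delta in Hi.
  apply rpow_abs_neq0, arrof_delta in Hq; destruct Hi as [Vi Ei], Hq as [Vq Eq].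
  destruct (@code_inj n (S i) n (S q) Vi Vq); [congruence|lia].
Qed.

(** For coefficients 0 and 1 the modulus equals its p-th power, and the factor
    [(rho / 2) ^ l] of the averages is at most 1. *)
Lemma avg_sum_le (f : nat -> K) (k : nat) :
  (forall i, rpow (abs (f i)) p = abs (f i)) ->
  rsum (fun l => abs (level_avg iota p f l)) k <= dyadic_sum p k f.
Proof.
intros H; apply rsum_le; intros l Hl.
eapply Rle_trans; [apply (abs_avg_le iota Hp)|].
apply rsum_le; intros i Hi; rewrite H.
assert (H1 := rho_gt1 Hp); assert (H2 := rho_le2).
assert ((rho p / 2) ^ l <= 1).
{ rewrite <- (pow1 l); apply pow_incr; lra. }
assert (H3 := abs_ge_0 (f (2 ^ l + i)%nat)); nra.
Qed.

(** The image of a unit array has at most one nonzero coefficient in its level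
    block and at most one at the normalized constant vectors; both kinds are
    estimated at once. *)
Lemma synth_delta_bound (j n : nat) :
  lp_sum p (S n) (synth (arrof (delta j)) n) <= rpow 2 p * (rpow 2 p * 2 + 1) + 2.
Proof.
set (a := arrof (delta j)).
assert (Hu := unit_arrof_delta j); fold a in Hu.
assert (Hc := rpow2_ge1 Hp).
assert (Hk := cluster_pos n); set (k := cluster n) in *.
destruct (unit_array_group Hp Hu Hk) as [Hf _].
destruct (is_gblock n) eqn:Hg.
- apply is_gblock_eq in Hg; fold k in Hg; rewrite Hg.
  rewrite S_gblock, lp_sum_dyadic_sum by easy.
  set (f := a (gblock k)) in *; set (d := rvals a k).
  set (g := fun i => minus (f i) (level_lift iota p (level_avg iota p f) i)).
  assert (Hd : dyadic_sum p k (level_lift iota p d) <= 1).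
  { rewrite (dyadic_sum_lift iota Hp); apply rsum_at_most_one; [lra| |].
    - intros l; unfold d, rvals, a.
      destruct (abs_arrof_delta j (rblock k l) (S (rblock k l))) as [H ->]; easy.
    - intros l q Hl Hq; apply rpow_abs_neq0, arrof_delta in Hl.
      apply rpow_abs_neq0, arrof_delta in Hq; destruct Hl as [Vl El], Hq as [Vq Eq].
      destruct (code_inj Vl Vq) as [E _]; [congruence|unfold rblock in E; lia]. }
  assert (Hgb : dyadic_sum p k g <= rpow 2 p * 2).
  { eapply Rle_trans.
    - apply (@dyadic_sum_add_le K p Hp k f (fun i => opp (level_lift iota p (level_avg iota p f) i))).
      intros; easy.
    - apply Rmult_le_compat_l; [lra|].
      assert (H : dyadic_sum p k (fun i => opp (level_lift iota p (level_avg iota p f) i)) <= dyadic_sum p k f).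
      { eapply Rle_trans; [|apply (dyadic_sum_lift_avg iota Hp)].
        apply (dyadic_sum_mono Hp); intros; rewrite abs_opp; lra. }
      lra. }
  eapply Rle_trans.
  { apply (@dyadic_sum_add_le K p Hp k g (level_lift iota p d)).
    intros i Hi; now rewrite synth_gblock. }
  assert (rpow 2 p * (dyadic_sum p k g + dyadic_sum p k (level_lift iota p d)) <= rpow 2 p * (rpow 2 p * 2 + 1));
    [|lra].
  apply Rmult_le_compat_l; lra.
- assert (Hlow : forall i, is_rcoord n i = false -> abs (synth a n i) <= abs (a n i)).
  { intros i Er; unfold array_synth; rewrite Hg, Er.
    destruct (is_copy n i); [rewrite abs_zero; apply abs_ge_0|lra]. }
  assert (Hlast : rpow (abs (synth a n (S n))) p <= 1).
  { apply rpow_le_1; [easy|]; split; [apply abs_ge_0|].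
    destruct (is_rcoord n (S n)) eqn:Er.
    - destruct (is_rcoord_inv Er) as [l [Hl [_ [_ El]]]]; fold k in Hl.
      unfold array_synth; rewrite Hg, Er, El; fold k.
      unfold group_sums; eapply Rle_trans; [apply abs_bsum|].
      eapply Rle_trans; [apply avg_sum_le; intros i; apply abs_arrof_delta|].
      apply Rle_trans with (dyadic_sum p k (a (gblock k))); [|easy].
      apply rsum_le_extend; [lia|intros; apply level_ge0].
    - eapply Rle_trans; [apply Hlow, Er|].
      apply (unit_array_coord Hp Hu (valid_last n)). }
  assert (Hfirst : lp_sum p n (synth a n) <= 1).
  { eapply Rle_trans; [|apply (Hu n)].
    apply Rle_trans with (lp_sum p n (a n)).
    - apply lp_sum_le; [easy|]; intros i Hi; apply Hlow.
      destruct (is_rcoord n i) eqn:Er; [|easy].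
      destruct (is_rcoord_inv Er) as [l [_ [_ [Ei _]]]]; lia.
    - rewrite !lp_sum_rsum; simpl; assert (H := rpow_ge0 (abs (a n (S n))) p); lra. }
  rewrite lp_sum_rsum in Hfirst |- *; simpl; nra.
Qed.

Lemma uvec_bound : exists alpha beta, 0 < alpha /\
  forall j, copy_pos j = false -> alpha <= norm (uvec j) <= beta.
Proof.
destruct ucoord_bound as [C [HC Hco]].
assert (Hc := rpow2_ge1 Hp).
set (beta := rpow 2 p * (rpow 2 p * 2 + 1) + 2).
assert (Hbeta : 1 <= beta) by (unfold beta; nra).
exists (/ C), beta; split; [now apply Rinv_0_lt_compat|].
intros j Hj; split.
- assert (H := Hco j (uvec j)).
  rewrite ucoord_uvec in H by easy; unfold delta in H; rewrite Nat.eqb_refl in H.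
  rewrite abs_one in H; apply Rmult_le_reg_l with C; [easy|].
  rewrite Rinv_r by lra; exact H.
- apply norm_le_of_blocks; [lra|]; intros n.
  apply Rle_trans with beta; [|now apply rpow_ge_self].
  eapply Rle_trans; [|apply (synth_delta_bound j n)].
  apply lp_sum_le; [easy|]; intros i Hi; rewrite entry_uvec by now apply valid_iff.
  lra.
Qed.

Lemma uproj_minus (F : nat -> bool) (M : nat) (x y : Bp) :
  uproj F M (minus x y) = minus (uproj F M x) (uproj F M y).
Proof.
unfold uproj; rewrite <- (bsum_minus iota); apply (@bsum_ext Bp); intros j _.
destruct (F j).
- unfold minus at 1; rewrite ucoord_plus.
  transitivity (plus (scal (ucoord j x) (uvec j)) (scal (ucoord j (opp y)) (uvec j))).
  + exact (scal_distr_r (ucoord j x) (ucoord j (opp y)) (uvec j)).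
  + unfold minus; f_equal.
    replace (opp y) with (scal (opp one : K) y) by exact (scal_opp_one y).
    rewrite ucoord_scal.
    transitivity (scal (opp (ucoord j y)) (uvec j)).
    * f_equal; kring.
    * exact (scal_opp_l (ucoord j y) (uvec j)).
- symmetry; exact (@minus_eq_zero Bp zero).
Qed.

(** Elements with finitely many nonzero blocks have finitely many nonzero
    coefficients, since the change of coordinates preserves clusters. *)
Lemma uproj_fin_array (b : Bp) (N M : nat) :
  let N' := (2 * 2 ^ cluster N)%nat in
  ((N' + 1) * (N' + 1) <= M)%nat ->
  let h := fin_array (entry b) N in
  uproj (fun _ => true) M h = minus h (copy (uncopy h)).
Proof.
intros N' HM h; apply entry_ext; intros n i Hv.
rewrite entry_uproj, entry_minus, entry_copy_uncopy by easy.
transitivity (synth (ana (entry h)) n i).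
2:{ rewrite (synth_ana iota Hp) by easy; destruct (is_copy n i); kring. }
f_equal; apply functional_extensionality; intros m.
apply functional_extensionality; intros q.
unfold restr2, code_set; rewrite Bool.andb_true_l.
destruct (Nat.ltb (code m q) M) eqn:E; [easy|].
destruct (valid m q) eqn:Hq; [|unfold array_coef; now rewrite Hq].
apply Nat.ltb_ge in E.
assert (Hm : (N' < m)%nat).
{ destruct (le_lt_dec m N') as [Hle|]; [|easy].
  assert (H := code_le Hq Hle); lia. }
symmetry; rewrite <- (ana_zero iota p m q); apply ana_ext.
intros m' q' Hm' Hq'; unfold h; rewrite entry_fin_array by easy.
destruct (Nat.ltb m' N) eqn:E'; [|easy].
exfalso; apply Nat.ltb_lt in E'.
assert (Hcl : (cluster m' <= cluster N)%nat) by (apply Nat.log2_le_mono; lia).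
destruct (cluster_bounds m) as [_ Hm2]; rewrite <- Hm' in Hm2.
assert (2 ^ cluster m' <= 2 ^ cluster N)%nat by (apply Nat.pow_le_mono_r; lia).
unfold N' in Hm; lia.
Qed.

Lemma tail_small (b : Bp) (e : R) : 0 < e ->
  exists N, norm (minus b (fin_array (entry b) N)) <= e.
Proof.
intros He.
assert (H := @c0_coord_lim K (fun n => lp K Hp (S n)) b).
apply is_lim_seq_spec in H; destruct (H (mkposreal e He)) as [N HN]; simpl in HN.
exists N; apply norm_le_of_blocks; [lra|]; intros n.
destruct (le_lt_dec N n) as [Hn|Hn].
- apply Rle_trans with (lp_sum p (S n) (entry b n)).
  + apply lp_sum_le; [easy|]; intros i Hi; apply valid_iff in Hi.
    rewrite entry_minus, entry_fin_array by easy.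
    rewrite (proj2 (Nat.ltb_ge n N) Hn), abs_minus_zero by exact iota; lra.
  + rewrite <- (rpowVK (p := p) (x := lp_sum p (S n) (entry b n)));
      [|lra|apply lp_sum_ge0].
    apply rpow_le; [lra|]; split; [apply rpow_ge0|].
    specialize (HN n Hn); rewrite Rminus_0_r in HN.
    change (Rabs (norm (block b n)) < e) in HN.
    rewrite Rabs_pos_eq in HN by apply norm_ge_0; rewrite norm_block in HN; lra.
- rewrite lp_sum_zero; [apply rpow_ge0|].
  intros i Hi; apply valid_iff in Hi; rewrite entry_minus, entry_fin_array by easy.
  rewrite (proj2 (Nat.ltb_lt n N) Hn); kring.
Qed.

(** The partial sums are uniformly bounded and converge on the dense set of
    elements with finitely many nonzero blocks. *)
Lemma useries (b : Bp) :
  is_series (fun j => scal (ucoord j b) (uvec j)) (minus b (copy (uncopy b))).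
Proof.
apply series_iff; intros e He.
destruct uprefix_bound as [C [HC Hpre]].
destruct (linear_norm _ copy_linear) as [M1 [HM1 H1]].
destruct (linear_norm _ uncopy_linear) as [M2 [HM2 H2]].
assert (HM12 : 0 < M1 * M2) by nra.
set (D := C + 1 + M1 * M2); assert (HD : 0 < D) by (unfold D; lra).
assert (HeD : 0 < e / (2 * D)) by (apply Rdiv_lt_0_compat; lra).
destruct (tail_small b HeD) as [N HN].
set (h := fin_array (entry b) N) in *; set (t := minus b h) in *.
(* From this position on, all blocks lie in later clusters than the first [N] blocks. *)
set (N' := (2 * 2 ^ cluster N)%nat); exists ((N' + 1) * (N' + 1))%nat; intros M HM.
assert (Hh := @uproj_fin_array b N M HM); cbv zeta in Hh; fold h in Hh.
change (norm (minus (uproj (fun _ => true) M b) (minus b (copy (uncopy b)))) < e).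
assert (Et : minus (uproj (fun _ => true) M b) (minus b (copy (uncopy b)))
  = plus (minus (uproj (fun _ => true) M t) t) (copy (uncopy t))).
{ unfold t at 1 3; rewrite uproj_minus, Hh.
  rewrite (lin_minus iota uncopy_linear), (lin_minus iota copy_linear).
  unfold t; generalize (uproj (fun _ => true) M b) (copy (uncopy b)) (copy (uncopy h)).
  intros x y z; generalize h; intros h0.
  module_norm K (B_p0 K Hp); kring. }
rewrite Et; eapply Rle_lt_trans; [apply @norm_triangle|].
assert (A1 := norm_minus_le (uproj (fun _ => true) M t) t).
assert (A2 := Hpre M t).
assert (A3 := H1 (uncopy t)); assert (A4 := H2 t).
assert (A5 : M1 * norm (uncopy t) <= M1 * (M2 * norm t))
  by (apply Rmult_le_compat_l; lra).
apply Rle_lt_trans with (D * norm t); [unfold D; lra|].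
apply Rle_lt_trans with (D * (e / (2 * D))); [apply Rmult_le_compat_l; lra|].
replace (D * (e / (2 * D))) with (e / 2) by (field; lra); lra.
Qed.

Definition alt_array (k n i : nat) : K :=
  if andb (Nat.eqb (cluster n) k) (andb (is_rcoord n i) (Nat.even (rindex n)))
  then one else zero.

Lemma bsum_even (n : nat) :
  @bsum K (fun l => if Nat.even l then one else zero) n = ofR iota (INR (Nat.div2 (S n))).
Proof.
assert (H : forall m, @bsum K (fun l => if Nat.even l then one else zero) (2 * m)
                      = ofR iota (INR m)).
{ induction m as [|m IH]; [simpl; symmetry; apply ofR_zero|].
  replace (2 * S m)%nat with (S (S (2 * m))) by lia.
  cbn [bsum]; rewrite IH, (S_INR m), (ofR_plus iota), (ofR_one iota).
  replace (Nat.even (2 * m)) with true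
    by (symmetry; apply Nat.even_spec; exists m; lia).
  replace (Nat.even (S (2 * m))) with false; [kring|].
  symmetry; rewrite Nat.even_succ; apply odd_2m. }
destruct (Nat.Even_or_Odd n) as [[m Hm]|[m Hm]]; subst n.
- now rewrite H, Nat.div2_succ_double.
- replace (S (2 * m + 1)) with (2 * S m)%nat by lia; rewrite Nat.div2_double.
  rewrite Nat.add_1_r; cbn [bsum]; rewrite H, (S_INR m), (ofR_plus iota), (ofR_one iota).
  replace (Nat.even (2 * m)) with true
    by (symmetry; apply Nat.even_spec; exists m; lia).
  kring.
Qed.

(** The l_infty part of [b] is 1, 0, 1, 0, ..., with summing-basis coordinates
    1, -1, 1, -1, ...; keeping the even levels leaves at least [k / 2] averages equal
    to 1, which accumulate in the last l_infty coordinate. *)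
Lemma alternating_vector (k : nat) : (1 <= k)%nat ->
  exists (b : Bp) (A : nat -> bool),
    norm b <= 1 /\ b <> zero /\ uncopy b = zero /\
    (forall j, ucoord j b <> zero -> (j < 4 ^ k)%nat) /\
    INR k / 2 <= norm (uproj A (4 ^ k) b).
Proof.
intros Hk.
set (b := fin_array (alt_array k) (2 * 2 ^ k)).
assert (Hb : forall n i, valid n i = true -> entry b n i = alt_array k n i).
{ intros n i Hv; unfold b; rewrite entry_fin_array by easy.
  destruct (Nat.ltb n (2 * 2 ^ k)) eqn:E; [easy|]; apply Nat.ltb_ge in E.
  unfold alt_array; destruct (Nat.eqb (cluster n) k) eqn:Ek; [|easy].
  apply Nat.eqb_eq in Ek; destruct (cluster_bounds n) as [_ H]; rewrite Ek in H; lia. }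
assert (Hr : forall l, (l < k)%nat ->
  rvals (entry b) k l = if Nat.even l then one else zero).
{ intros l Hl; unfold rvals; rewrite Hb by apply valid_last; unfold alt_array.
  now rewrite cluster_rblock, Nat.eqb_refl, is_rcoord_rblock, rindex_rblock. }
assert (Hg : forall i, (1 <= i < 2 ^ k)%nat -> entry b (gblock k) i = zero).
{ intros i Hi; rewrite Hb by (now apply valid_gblock); unfold alt_array.
  destruct (is_rcoord (gblock k) i) eqn:E; [|now destruct (Nat.eqb _ _)].
  apply is_rcoord_not_gblock in E; now rewrite is_gblock_gblock in E. }
set (A := fun j => Nat.even (Nat.log2 (snd (dec j)))).
assert (Hcode : forall i, (1 <= i < 2 ^ k)%nat -> (code (gblock k) i < 4 ^ k)%nat).
{ intros i Hi; assert (H := code_le (proj2 (valid_gblock i Hk) Hi) (le_n _)).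
  rewrite Nat.add_1_r, S_gblock in H by easy.
  assert (E : (4 ^ k = 2 ^ k * 2 ^ k)%nat) by (rewrite <- Nat.pow_mul_l; easy).
  rewrite E; nia. }
exists b, A; repeat apply conj.
- apply norm_le_of_blocks; [lra|]; intros n; rewrite rpow_1.
  rewrite lp_sum_rsum; apply rsum_at_most_one; [lra| |].
  + intros i; destruct (valid n (S i)) eqn:Hv.
    * rewrite Hb by easy; unfold alt_array.
      destruct (andb _ _); [rewrite abs_one, rpow_1; lra|].
      rewrite abs_zero, rpow0; lra.
    * rewrite entry_out, abs_zero, rpow0 by easy; lra.
  + assert (H : forall i, rpow (abs (entry b n (S i))) p <> 0 -> i = n).
    { intros i Hi; apply rpow_abs_neq0 in Hi.
      destruct (valid n (S i)) eqn:Hv; [|exfalso; apply Hi, entry_out, Hv].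
      rewrite Hb in Hi by easy; unfold alt_array in Hi.
      destruct (is_rcoord n (S i)) eqn:E; [|now destruct (Nat.eqb _ _)].
      destruct (is_rcoord_inv E) as [l [_ [_ [Ei _]]]]; lia. }
    intros i q Hi Hq; apply H in Hi; apply H in Hq; congruence.
- intros E; assert (H := Hr 0%nat Hk); simpl in H.
  rewrite E in H; unfold rvals in H; rewrite entry_zero in H.
  exact (one_neq_zero (eq_sym H)).
- apply uncopy_zero; intros n i Hv Hc; rewrite Hb by easy; unfold alt_array.
  rewrite (is_copy_not_rcoord Hc); now destruct (Nat.eqb _ _).
- intros j Hj; unfold ucoord in Hj.
  set (n := fst (dec j)) in *; set (i := snd (dec j)) in *.
  assert (Hv : valid n i = true) by apply valid_dec.
  destruct (Nat.eq_dec (cluster n) k) as [Ek|Ek].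
  2:{ exfalso; apply Hj; rewrite <- (ana_zero iota p n i); apply ana_ext.
      intros m q Hm Hq; rewrite Hb by easy; unfold alt_array; rewrite Hm.
      now rewrite (proj2 (Nat.eqb_neq _ _) Ek). }
  assert (Ej : j = code n i) by (symmetry; apply code_dec).
  destruct (is_gblock n) eqn:En.
  + assert (Hi := valid_is_gblock Hv En); apply is_gblock_eq in En.
    rewrite Ek in Hi, En; rewrite Ej, En; now apply Hcode.
  + exfalso; apply Hj; unfold array_coef; rewrite Hv, En, Ek.
    destruct (is_rcoord n i) eqn:Er.
    * destruct (is_rcoord_inv Er) as [l [Hl [_ [_ ->]]]]; rewrite Ek in Hl.
      apply avg_zero; intros q Hq; apply Hg, level_valid; easy.
    * destruct (is_copy n i); [easy|]; rewrite Hb by easy; unfold alt_array.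
      rewrite Er; now destruct (Nat.eqb _ _).
(* This coordinate carries the sum of all [k] averages. *)
- set (l := pred k); assert (Hl : (l < k)%nat) by (unfold l; lia).
  eapply Rle_trans; [|apply (entry_le_norm _ (valid_last (rblock k l)))].
  rewrite entry_uproj by apply valid_last.
  fold (rvals (synth (restr2 (code_set A (4 ^ k)) (ana (entry b)))) k l).
  rewrite synth_rblock by easy; unfold group_sums; replace (S l) with k by (unfold l; lia).
  rewrite (@bsum_ext K _ (fun l => if Nat.even l then one else zero) k).
  + rewrite bsum_even, abs_ofR_ge0 by apply pos_INR.
    assert (H : INR k <= 2 * INR (Nat.div2 (S k))); [|lra].
    replace 2 with (INR 2) by (simpl; ring); rewrite <- mult_INR; apply le_INR.
    destruct (Nat.Even_or_Odd k) as [[m Hm]|[m Hm]]; rewrite Hm.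
    * rewrite Nat.div2_succ_double; lia.
    * replace (S (2 * m + 1)) with (2 * S m)%nat by lia; rewrite Nat.div2_double; lia.
  + intros l' Hl'.
    assert (E : forall q, (q < 2 ^ l')%nat ->
      restr2 (code_set A (4 ^ k)) (ana (entry b)) (gblock k) (2 ^ l' + q)
      = if Nat.even l' then group_coef iota p (entry b (gblock k)) (rvals (entry b) k) (2 ^ l' + q)
        else zero).
    { intros q Hq; assert (Hi := level_valid Hl' Hq).
      assert (Hv := proj2 (valid_gblock _ Hk) Hi).
      unfold restr2, code_set, A; rewrite dec_code by easy; cbn [snd].
      rewrite log2_level by easy.
      rewrite (proj2 (Nat.ltb_lt _ _) (Hcode _ Hi)), Bool.andb_true_r.
      destruct (Nat.even l'); [now apply ana_gblock|easy]. }
    destruct (Nat.even l') eqn:Ev.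
    * rewrite (avg_ext iota p E), (avg_coef iota Hp).
      destruct l' as [|l']; simpl diff.
      -- now rewrite Hr.
      -- rewrite !Hr by lia; rewrite Ev.
         rewrite Nat.even_succ, <- Nat.negb_even in Ev.
         apply Bool.negb_true_iff in Ev; rewrite Ev; kring.
    * now apply avg_zero.
Qed.

End MixedSpace.

(** * Interlacing a basis with a complementary system *)

Section Enumeration.

Variable P : nat -> bool.
Hypothesis Pinf : forall N, exists j, (N <= j)%nat /\ P j = true.

Fixpoint count_below (m : nat) : nat :=
  match m with
  | O => O
  | S m => if P m then S (count_below m) else count_below m
  end.

Lemma count_below_mono (m n : nat) : (m <= n)%nat -> (count_below m <= count_below n)%nat.
Proof.
induction 1 as [|n H IH]; [easy|]; simpl; destruct (P n); lia.
Qed.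

Lemma count_below_unbounded (N : nat) : exists m, (N < count_below m)%nat.
Proof.
induction N as [|N [m Hm]].
- destruct (Pinf 0) as [j [_ Hj]]; exists (S j); simpl; rewrite Hj; lia.
- destruct (Pinf m) as [j [Hj Pj]]; exists (S j); simpl; rewrite Pj.
  assert (H := count_below_mono Hj); lia.
Qed.

Lemma nth_true_exists (j : nat) : exists m, P m = true /\ count_below m = j.
Proof.
destruct (count_below_unbounded j) as [N HN].
induction N as [|N IH]; simpl in HN; [lia|].
destruct (P N) eqn:E; [|now apply IH].
destruct (Nat.eq_dec (count_below N) j) as [Ej|Ej]; [now exists N|apply IH; lia].
Qed.

(** The increasing enumeration of the positions where [P] holds; it is inverse
    to [count_below P] on them. *)
Definition nth_true (j : nat) : nat :=
  proj1_sig (constructive_indefinite_description _ (nth_true_exists j)).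

Lemma nth_true_spec (j : nat) : P (nth_true j) = true /\ count_below (nth_true j) = j.
Proof. unfold nth_true; destruct (constructive_indefinite_description _ _); easy. Qed.

Lemma count_below_lt (m n : nat) : P m = true -> (m < n)%nat ->
  (count_below m < count_below n)%nat.
Proof.
intros Hm Hmn; apply Nat.lt_le_trans with (count_below (S m)).
- simpl; rewrite Hm; lia.
- now apply count_below_mono.
Qed.

Lemma nth_true_count (m : nat) : P m = true -> nth_true (count_below m) = m.
Proof.
intros Hm; destruct (nth_true_spec (count_below m)) as [H1 H2].
destruct (Nat.lt_trichotomy (nth_true (count_below m)) m) as [H|[H|H]]; [|easy|].
- assert (H3 := count_below_lt H1 H); lia.
- assert (H3 := count_below_lt Hm H); lia.
Qed.

Lemma count_below_le (m : nat) : (count_below m <= m)%nat.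
Proof. induction m as [|m IH]; simpl; [easy|destruct (P m); lia]. Qed.

Lemma le_nth_true (j : nat) : (j <= nth_true j)%nat.
Proof.
destruct (nth_true_spec j) as [_ H]; rewrite <- H at 1; apply count_below_le.
Qed.

End Enumeration.

Section Merge.

Variable K : AbsRing.
Variable iota : real_subfield K.
Add Ring K_ring : (scalar_ring_theory iota).
Ltac kring := kring_norm K; ring.
Variable X : NormedModule K.
Ltac mring := module_norm K X; kring.

Variable B0 : SchauderBasis X.
Hypothesis Hqg0 : quasi_greedy B0.
Variables J Q : X -> X.
Hypothesis HJ : is_linear J.
Hypothesis HQ : is_linear Q.
Hypothesis HQJ : forall x, Q (J x) = x.
Variable P : nat -> bool.
Hypothesis Pinf : forall N, exists j, (N <= j)%nat /\ P j = true.
Variable y : nat -> X.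
Variable ys : nat -> X -> K.
Hypothesis HQy : forall j, P j = false -> Q (y j) = zero.
Hypothesis HysJ : forall j x, ys j (J x) = zero.
Hypothesis Hysy : forall j i, P j = false -> ys j (y i) = @delta K i j.
Hypothesis HysP : forall j f, P j = true -> ys j f = zero.
Hypothesis Hys_plus : forall j f g, ys j (plus f g) = plus (ys j f) (ys j g).
Hypothesis Hys_scal : forall j c f, ys j (scal c f) = mult c (ys j f).
Hypothesis Hys_bound : exists C, 0 < C /\ forall j f, abs (ys j f) <= C * norm f.
Hypothesis Hseries : forall f,
  is_series (fun j => scal (ys j f) (y j)) (minus f (J (Q f))).
Hypothesis Hy : exists alpha beta, 0 < alpha /\
  forall j, P j = false -> alpha <= norm (y j) <= beta.
Hypothesis Hgreedy : exists C, 1 <= C /\ forall F M f,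
  (forall j, F j = true -> (j < M)%nat) ->
  greedy_set F (fun j => ys j f) ->
  norm (@bsum X (fun j => if F j then scal (ys j f) (y j) else zero) M) <= C * norm f.

Notation c := (count_below P).
Notation g := (nth_true Pinf).
Notation x := (basis_vec B0).
Notation xs := (basis_coord B0).

(** The basis [B0], transported by [J], occupies the positions in [P]; the
    complementary system [y] occupies the others. *)
Definition merged_vec (m : nat) : X := if P m then J (x (c m)) else y m.
Definition merged_coord (m : nat) (f : X) : K := if P m then xs (c m) (Q f) else ys m f.

Lemma merged_sum (F : nat -> bool) (f : X) (M : nat) :
  @bsum X (fun m => if F m then scal (merged_coord m f) (merged_vec m) else zero) M
  = plus (J (@bsum X (fun j => if F (g j) then scal (xs j (Q f)) (x j) else zero) (c M)))
         (@bsum X (fun j => if andb (F j) (negb (P j)) then scal (ys j f) (y j) else zero) M).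
Proof.
induction M as [|M IH]; cbn [bsum count_below].
- rewrite (lin_zero HJ); mring.
- rewrite IH; unfold merged_coord, merged_vec; destruct (P M) eqn:E; cbn [bsum].
  + rewrite (linear_plus J HJ), nth_true_count, Bool.andb_false_r by easy.
    destruct (F M); [rewrite (linear_scal J HJ); mring|rewrite (lin_zero HJ); mring].
  + rewrite Bool.andb_true_r; destruct (F M); mring.
Qed.

Lemma count_below_large (N : nat) : exists M, forall m, (M <= m)%nat -> (N <= c m)%nat.
Proof.
destruct (count_below_unbounded Pinf N) as [M HM]; exists M; intros m Hm.
assert (H := count_below_mono P Hm); lia.
Qed.

Lemma ys_zero (j : nat) : ys j zero = zero.
Proof.
transitivity (ys j (scal (zero : K) zero)).
- f_equal; symmetry; exact (scal_zero_l (@zero X)).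
- rewrite Hys_scal; kring.
Qed.

Lemma ys_minus (j : nat) (f h : X) : ys j (minus f h) = minus (ys j f) (ys j h).
Proof.
transitivity (plus (ys j f) (mult (opp one) (ys j h))); [|kring].
rewrite <- Hys_scal, <- Hys_plus; f_equal; mring.
Qed.

Lemma merged_expansion (f : X) :
  is_series (fun m => scal (merged_coord m f) (merged_vec m)) f.
Proof.
apply series_iff; intros e He.
assert (H1 := lin_series iota HJ (basis_expansion B0 (f := Q f))).
assert (H2 := @Hseries f); apply series_iff with (e := e / 2) in H2; [|lra].
apply series_iff with (e := e / 2) in H1; [|lra].
destruct H1 as [N1 H1], H2 as [N2 H2].
destruct (count_below_large N1) as [N3 H3].
exists (N2 + N3)%nat; intros n Hn.
replace (@bsum X (fun m => scal (merged_coord m f) (merged_vec m)) n)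
  with (plus (@bsum X (fun j => J (scal (xs j (Q f)) (x j))) (c n))
             (@bsum X (fun j => scal (ys j f) (y j)) n)).
2:{ rewrite <- (lin_bsum HJ).
    refine (eq_trans _ (eq_sym (merged_sum (fun _ => true) f n))).
    f_equal; apply (@bsum_ext X); intros i _; simpl.
    destruct (P i) eqn:E; simpl; [|easy].
    now apply scal_zeroE, HysP. }
set (s1 := @bsum X (fun j => J (scal (xs j (Q f)) (x j))) (c n)) in *.
set (s2 := @bsum X (fun j => scal (ys j f) (y j)) n) in *.
replace (minus (plus s1 s2) f)
  with (plus (minus s1 (J (Q f))) (minus s2 (minus f (J (Q f))))) by mring.
eapply Rle_lt_trans; [apply @norm_triangle|].
assert (A1 : norm (minus s1 (J (Q f))) < e / 2) by (apply H1, H3; lia).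
assert (A2 : norm (minus s2 (minus f (J (Q f)))) < e / 2) by (apply H2; lia).
lra.
Qed.

Lemma merged_prefix_Q (a : nat -> K) (M : nat) :
  Q (@bsum X (fun m => scal (a m) (merged_vec m)) M)
  = @bsum X (fun j => scal (a (g j)) (x j)) (c M).
Proof.
induction M as [|M IH]; cbn [bsum count_below]; [apply (lin_zero HQ)|].
rewrite (linear_plus Q HQ), IH, (linear_scal Q HQ); unfold merged_vec.
destruct (P M) eqn:E; cbn [bsum].
- now rewrite HQJ, nth_true_count.
- rewrite HQy by easy; mring.
Qed.

(** Applying [Q] removes the vectors [y] and leaves a series in the basis [B0],
    whose uniqueness applies; the functionals [ys] are continuous and remove
    the range of [J]. *)
Lemma merged_unique (f : X) (a : nat -> K) :
  is_series (fun m => scal (a m) (merged_vec m)) f ->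
  forall m, a m = merged_coord m f.
Proof.
intros H m; unfold merged_coord; destruct (P m) eqn:Pm.
- assert (HR : is_series (fun j => scal (a (g j)) (x j)) (Q f)).
  { apply series_iff; intros e He.
    destruct (linear_norm Q HQ) as [MQ [HMQ HQb]].
    destruct (proj1 (series_iff _ _) H (e / MQ)) as [N HN];
      [now apply Rdiv_lt_0_compat|].
    exists N; intros n Hn.
    destruct (nth_true_spec Pinf n) as [_ En].
    rewrite <- En at 1; rewrite <- merged_prefix_Q, <- (lin_minus iota HQ).
    eapply Rle_lt_trans; [apply HQb|].
    apply Rlt_le_trans with (MQ * (e / MQ)); [|apply Req_le; field; lra].
    apply Rmult_lt_compat_l; [easy|]; apply HN.
    assert (Hle := le_nth_true Pinf n); lia. }
  assert (E := basis_unique HR (c m)).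
  cbv beta in E; now rewrite nth_true_count in E.
- destruct Hys_bound as [C [HC Hb]].
  apply (@norm_small_eq K iota (AbsRing_NormedModule K)); intros e He.
  change (abs (minus (a m) (ys m f)) < e).
  destruct (proj1 (series_iff _ _) H (e / C)) as [N HN]; [now apply Rdiv_lt_0_compat|].
  set (n := (N + S m)%nat).
  assert (E : ys m (@bsum X (fun m => scal (a m) (merged_vec m)) n) = a m).
  { rewrite (@bsum_morph X K (ys m)); [|apply ys_zero|apply Hys_plus].
    rewrite (@bsum_single K _ n m); [|unfold n; lia|].
    - unfold merged_vec; rewrite Pm, Hys_scal, Hysy by easy.
      unfold delta; rewrite Nat.eqb_refl; kring.
    - intros i Hi Hne; rewrite Hys_scal; unfold merged_vec.
      destruct (P i) eqn:Pi; [rewrite HysJ; kring|].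
      rewrite Hysy by easy; unfold delta.
      rewrite (proj2 (Nat.eqb_neq m i)) by lia; kring. }
  rewrite <- E, <- ys_minus.
  eapply Rle_lt_trans; [apply Hb|].
  apply Rlt_le_trans with (C * (e / C)); [|apply Req_le; field; lra].
  apply Rmult_lt_compat_l; [easy|]; apply HN; unfold n; lia.
Qed.

Lemma merged_seminormalized : exists a b, 0 < a /\
  forall m, a <= norm (merged_vec m) <= b.
Proof.
destruct (basis_seminormalized B0) as [a0 [b0 [Ha0 H0]]].
destruct Hy as [a1 [b1 [Ha1 H1]]].
destruct (linear_norm J HJ) as [MJ [HMJ HJb]].
destruct (linear_norm Q HQ) as [MQ [HMQ HQb]].
assert (HaQ : 0 < a0 / MQ) by now apply Rdiv_lt_0_compat.
exists (Rmin (a0 / MQ) a1), (Rmax (MJ * b0) b1); split; [now apply Rmin_glb_lt|].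
intros m; unfold merged_vec; destruct (P m) eqn:E.
- destruct (H0 (c m)) as [L U]; split.
  + eapply Rle_trans; [apply Rmin_l|].
    assert (A := HQb (J (x (c m)))); rewrite HQJ in A.
    apply Rmult_le_reg_l with MQ; [easy|].
    replace (MQ * (a0 / MQ)) with a0 by (field; lra); lra.
  + eapply Rle_trans; [|apply Rmax_l]; eapply Rle_trans; [apply HJb|].
    apply Rmult_le_compat_l; lra.
- destruct (H1 m E) as [L U]; split.
  + eapply Rle_trans; [apply Rmin_r|easy].
  + eapply Rle_trans; [|apply Rmax_r]; easy.
Qed.

Definition merged_basis : SchauderBasis X :=
  {| basis_vec := merged_vec; basis_coord := merged_coord;
     basis_expansion := merged_expansion; basis_unique := merged_unique;
     basis_seminormalized := merged_seminormalized |}.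

Lemma merged_quasi_greedy : quasi_greedy merged_basis.
Proof.
destruct Hqg0 as [C0 HC0].
destruct Hgreedy as [C1 [HC1 H1]].
destruct (linear_norm J HJ) as [MJ [HMJ HJb]].
destruct (linear_norm Q HQ) as [MQ [HMQ HQb]].
set (D := Rmax C0 0 + 1).
assert (HD : 0 <= D) by (unfold D; assert (H := Rmax_r C0 0); lra).
exists (1 + (MJ * (D * MQ) + C1)); intros f s F [N HN] HF Hs.
assert (Es : s = finproj merged_basis F (fun j => merged_coord j f) N).
{ apply (is_S_finite iota (B := merged_basis)); [|exact Hs].
  intros j Hj Fj; specialize (HN j Fj); lia. }
assert (Hsum := merged_sum F f N).
change (s = @bsum X (fun m => if F m then scal (merged_coord m f) (merged_vec m) else zero) N)
  in Es.
rewrite <- Es in Hsum.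
set (s1 := @bsum X (fun j => if F (g j) then scal (xs j (Q f)) (x j) else zero) (c N)) in *.
set (s2 := @bsum X (fun j => if andb (F j) (negb (P j)) then scal (ys j f) (y j) else zero) N)
  in *.
assert (A1 : norm s1 <= D * norm (Q f)).
{ assert (HFg : forall j, F (g j) = true -> (j < c N)%nat).
  { intros j Hj; destruct (nth_true_spec Pinf j) as [Pj Ej].
    rewrite <- Ej; apply count_below_lt; [easy|now apply HN]. }
  assert (A : norm (minus (Q f) s1) <= C0 * norm (Q f)).
  { apply (HC0 (Q f) s1 (fun j => F (g j))).
    - now exists (c N).
    - intros j k Hj Hk; specialize (HF (g j) (g k) Hj Hk).
      change (abs (merged_coord (g j) f) <= abs (merged_coord (g k) f)) in HF.
      unfold merged_coord in HF.
      destruct (nth_true_spec Pinf j) as [Pj Ej], (nth_true_spec Pinf k) as [Pk Ek].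
      rewrite Pj, Pk, Ej, Ek in HF; exact HF.
    - apply (finproj_is_S iota (B := B0) (A := fun j => F (g j)) (N := c N)).
      intros j Hj Fj; specialize (HFg j Fj); lia. }
  assert (A' := norm_le_minus iota s1 (Q f)); rewrite (norm_minus_sym iota) in A'.
  assert (C0 * norm (Q f) <= Rmax C0 0 * norm (Q f)).
  { apply Rmult_le_compat_r; [apply norm_ge_0|apply Rmax_l]. }
  unfold D; lra. }
assert (A2 : norm s2 <= C1 * norm f).
{ apply H1.
  - intros j Hj; apply Bool.andb_true_iff in Hj; now apply HN.
  - intros j k Hj Hk; apply Bool.andb_true_iff in Hk; destruct Hk as [Fk Pk].
    apply Bool.negb_true_iff in Pk.
    destruct (P j) eqn:Pj; [rewrite (HysP f Pj), abs_zero; apply abs_ge_0|].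
    rewrite Bool.andb_true_r in Hj.
    specialize (HF j k Hj Fk).
    change (abs (merged_coord j f) <= abs (merged_coord k f)) in HF.
    unfold merged_coord in HF; now rewrite Pj, Pk in HF. }
assert (A3 := HJb s1); assert (A4 := HQb f).
assert (A5 : MJ * norm s1 <= MJ * (D * (MQ * norm f))).
{ apply Rmult_le_compat_l; [lra|]; eapply Rle_trans; [exact A1|].
  now apply Rmult_le_compat_l. }
eapply Rle_trans; [apply norm_minus_le|].
rewrite Hsum.
assert (A6 := norm_triangle (J s1) s2); lra.
Qed.

End Merge.

(** * The basis of the theorem *)

Section Main.

Variable K : AbsRing.
Variable iota : real_subfield K.
Add Ring K_ring : (scalar_ring_theory iota).
Ltac kring := kring_norm K; ring.
Variable X : NormedModule K.
Ltac mring := module_norm K X; kring.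

Lemma copy_pos_infinite (N : nat) : exists j, (N <= j)%nat /\ copy_pos j = true.
Proof.
exists (code (2 * N + 1) 1).
assert (Hv : valid (2 * N + 1) 1 = true) by (apply valid_iff; lia).
split.
- assert (H := code_spec Hv); nia.
- rewrite copy_pos_code by easy; apply is_copy_true; lia.
Qed.

(** With [T] the embedding of the mixed-norm space and [S] the left inverse given
    by the projection, [J] and [Q] are the maps [copy] and [uncopy] carried over
    to [X] and extended by the identity on the kernel of the projection.  The
    complement of the range of [J] is then the span of the system [T (uvec j)]. *)
Theorem conditional_basis (B0 : SchauderBasis X) (p : R) (Hp : 1 <= p) (V : X -> Prop) :
  quasi_greedy B0 -> complemented V -> isomorphic_to_subspace (B_p0 K Hp) V ->
  exists B : SchauderBasis X, quasi_greedy B /\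
    exists delta, 0 < delta /\ forall k m, (1 <= k)%nat -> (4 ^ k <= m)%nat ->
      Rbar_le (Finite (delta * INR k)) (L_ B m).
Proof.
intros Hqg [P0 [HP0 [HP0V HP0id]]] [T [HT [[c0 [Hc0 HTlow]] HTV]]].
set (S := fun f => proj1_sig (constructive_indefinite_description _
                      (proj1 (HTV (P0 f)) (HP0V f)))).
assert (HTS : forall f, T (S f) = P0 f).
{ intros f; unfold S; destruct (constructive_indefinite_description _ _); easy. }
assert (Tinj : forall b b', T b = T b' -> b = b').
{ intros b b' E; apply (norm_small_eq iota); intros e He.
  assert (H := HTlow (minus b b')); rewrite (lin_minus iota HT), E, norm_minus_self in H
    by exact iota.
  assert (H0 := norm_ge_0 (minus b b')).
  apply Rmult_lt_reg_l with c0; [easy|].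
  eapply Rle_lt_trans; [exact H|]; now apply Rmult_lt_0_compat. }
assert (HST : forall b, S (T b) = b).
{ intros b; apply Tinj; rewrite HTS; apply HP0id, HTV; now exists b. }
assert (HS : is_linear S).
{ constructor.
  - intros f h; apply Tinj; now rewrite (linear_plus T HT), !HTS, (linear_plus P0 HP0).
  - intros a f; apply Tinj; now rewrite (linear_scal T HT), !HTS, (linear_scal P0 HP0).
  - destruct (linear_norm P0 HP0) as [M [HM HMb]].
    exists (M / c0); split; [now apply Rdiv_lt_0_compat|]; intros f.
    apply Rmult_le_reg_l with c0; [easy|].
    eapply Rle_trans; [apply HTlow|]; rewrite HTS; eapply Rle_trans; [apply HMb|].
    apply Req_le; field; lra. }
set (cp := @copy K p Hp); set (ucp := @uncopy K p Hp).
assert (Hcp : is_linear cp) by exact (copy_linear iota Hp).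
assert (Hucp : is_linear ucp) by exact (@uncopy_linear K p Hp).
set (J := fun f => plus (minus f (T (S f))) (T (cp (S f)))).
set (Q := fun f => plus (minus f (T (S f))) (T (ucp (S f)))).
assert (HSJ : forall f, S (J f) = cp (S f)).
{ intros f; unfold J; rewrite (linear_plus S HS), (lin_minus iota HS), !HST.
  generalize (S f) (cp (S f)); intros a b; module_norm K (B_p0 K Hp); kring. }
assert (HSQ : forall f, S (Q f) = ucp (S f)).
{ intros f; unfold Q; rewrite (linear_plus S HS), (lin_minus iota HS), !HST.
  generalize (S f) (ucp (S f)); intros a b; module_norm K (B_p0 K Hp); kring. }
assert (Hlin : forall r : B_p0 K Hp -> B_p0 K Hp, is_linear r ->
  is_linear (fun f => plus (minus f (T (S f))) (T (r (S f))))).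
{ intros r Hr; constructor.
  - intros f h; rewrite !(linear_plus S HS), (linear_plus r Hr), !(linear_plus T HT); mring.
  - intros a f; rewrite !(linear_scal S HS), (linear_scal r Hr), !(linear_scal T HT); mring.
  - destruct (linear_norm S HS) as [MS [HMS HSb]], (linear_norm T HT) as [MT [HMT HTb]].
    destruct (linear_norm r Hr) as [Mr [HMr Hrb]].
    exists (1 + MT * MS + MT * (Mr * MS)).
    assert (0 < MT * MS) by (now apply Rmult_lt_0_compat).
    assert (0 < MT * (Mr * MS)) by (apply Rmult_lt_0_compat; nra).
    split; [lra|]; intros f.
    eapply Rle_trans; [apply @norm_triangle|].
    assert (A1 := norm_minus_le f (T (S f))).
    assert (A2 := HTb (S f)); assert (A3 := HTb (r (S f))).
    assert (A4 := Hrb (S f)); assert (A5 := HSb f).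
    assert (A6 : MT * norm (S f) <= MT * (MS * norm f)) by (apply Rmult_le_compat_l; lra).
    assert (A7 : MT * norm (r (S f)) <= MT * (Mr * (MS * norm f))).
    { apply Rmult_le_compat_l; [lra|]; eapply Rle_trans; [exact A4|].
      apply Rmult_le_compat_l; lra. }
    lra. }
assert (HJ : is_linear J) by now apply Hlin.
assert (HQ : is_linear Q) by now apply Hlin.
assert (HQJ : forall f, Q (J f) = f).
{ intros f; unfold Q at 1; rewrite HSJ.
  assert (E : ucp (cp (S f)) = S f) by apply uncopy_copy.
  rewrite E; unfold J; mring. }
set (y := fun j => T (@uvec K iota p Hp j)).
set (ys := fun j f => @ucoord K iota p Hp j (S f)).
assert (HQT : forall b, ucp b = zero -> Q (T b) = zero).
{ intros b E; unfold Q; rewrite HST, E, (lin_zero HT); mring. }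
destruct (linear_norm S HS) as [MS [HMS HSb]], (linear_norm T HT) as [MT [HMT HTb]].
destruct (@ucoord_bound K iota p Hp) as [Cu [HCu Hub]].
assert (Hybound : exists C, 0 < C /\ forall j f, abs (ys j f) <= C * norm f).
{ exists (Cu * MS); split; [nra|]; intros j f; eapply Rle_trans; [apply Hub|].
  rewrite Rmult_assoc; apply Rmult_le_compat_l; [lra|apply HSb]. }
assert (Hyser : forall f, is_series (fun j => scal (ys j f) (y j)) (minus f (J (Q f)))).
{ intros f.
  assert (H := lin_series iota HT (@useries K iota p Hp (S f))).
  replace (minus f (J (Q f))) with (T (minus (S f) (copy (uncopy (S f))))).
  - apply is_series_ext with (2 := H); intros j; apply (linear_scal T HT).
  - unfold J; rewrite HSQ; unfold Q; rewrite (lin_minus iota HT).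
    fold (ucp (S f)); fold (cp (ucp (S f))); mring. }
assert (Hysn : exists alpha beta, 0 < alpha /\
  forall j, copy_pos j = false -> alpha <= norm (y j) <= beta).
{ destruct (uvec_bound iota Hp) as [al [be [Hal H]]].
  exists (c0 * al), (MT * be); split; [nra|]; intros j Hj; destruct (H j Hj) as [L U].
  unfold y; split.
  - eapply Rle_trans; [|apply HTlow]; apply Rmult_le_compat_l; lra.
  - eapply Rle_trans; [apply HTb|]; apply Rmult_le_compat_l; lra. }
assert (HTsum : forall (F : nat -> bool) (M : nat) (f : X),
  @bsum X (fun j => if F j then scal (ys j f) (y j) else zero) M
  = T (uproj iota F M (S f))).
{ intros F M f; unfold uproj; rewrite (lin_bsum HT); apply (@bsum_ext X); intros j _.
  destruct (F j); [symmetry; apply (linear_scal T HT)|symmetry; apply (lin_zero HT)]. }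
assert (Hygr : exists C, 1 <= C /\ forall (F : nat -> bool) (M : nat) (f : X),
  (forall j, F j = true -> (j < M)%nat) ->
  greedy_set F (fun j => ys j f) ->
  norm (@bsum X (fun j => if F j then scal (ys j f) (y j) else zero) M) <= C * norm f).
{ destruct (ugreedy_bound iota Hp) as [C [HC H]].
  exists (1 + MT * (C * MS)); split; [assert (0 < C * MS) by nra; nra|].
  intros F M f HF HG; rewrite HTsum; eapply Rle_trans; [apply HTb|].
  assert (A1 := H F M (S f) HF HG); assert (A2 := HSb f); assert (A3 := norm_ge_0 f).
  assert (A4 : MT * norm (uproj iota F M (S f)) <= MT * (C * (MS * norm f))).
  { apply Rmult_le_compat_l; [lra|]; eapply Rle_trans; [exact A1|].
    apply Rmult_le_compat_l; lra. }
  lra. }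
assert (Hysy : forall j i, copy_pos j = false -> ys j (y i) = @delta K i j).
{ intros j i Hj; unfold ys, y; rewrite HST; now apply ucoord_uvec. }
assert (HysJ : forall j f, ys j (J f) = zero).
{ intros j f; unfold ys; rewrite HSJ; apply ucoord_copy. }
assert (HysP : forall j f, copy_pos j = true -> ys j f = zero).
{ intros j f Hj; now apply ucoord_copy_pos. }
assert (HQy : forall j, copy_pos j = false -> Q (y j) = zero).
{ intros j Hj; now apply HQT, uncopy_uvec. }
assert (Hysplus : forall j f h, ys j (plus f h) = plus (ys j f) (ys j h)).
{ intros j f h; unfold ys; rewrite (linear_plus S HS); apply ucoord_plus. }
assert (Hysscal : forall j a f, ys j (scal a f) = mult a (ys j f)).
{ intros j a f; unfold ys; rewrite (linear_scal S HS); apply ucoord_scal. }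
set (B := merged_basis iota B0 HJ HQ HQJ copy_pos_infinite HQy HysJ Hysy HysP
            Hysplus Hysscal Hybound Hyser Hysn).
exists B; split; [now apply merged_quasi_greedy|].
exists (c0 / (2 * MT)); split; [apply Rdiv_lt_0_compat; lra|].
intros k m Hk Hm.
destruct (@alternating_vector K iota p Hp k Hk) as [b [A [Hb1 [Hb0 [Hbu [Hbs HbA]]]]]].
set (f := T b).
assert (Hcoord : forall j, basis_coord B j f
  = if copy_pos j then zero else @ucoord K iota p Hp j b).
{ intros j; change (basis_coord B j f) with (merged_coord B0 Q copy_pos ys j f).
  unfold merged_coord, f; destruct (copy_pos j) eqn:Ej.
  - rewrite HQT by easy.
    exact (@basis_coord_finite K iota X B0 (fun _ => zero) 0 (fun _ _ => eq_refl) _).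
  - unfold ys; now rewrite HST. }
assert (Hsupp : forall j, basis_coord B j f <> zero -> (j < 4 ^ k)%nat).
{ intros j Hj; rewrite Hcoord in Hj; destruct (copy_pos j); [easy|now apply Hbs]. }
set (s := finproj B A (fun j => basis_coord B j f) (4 ^ k)).
assert (Hs : is_S B A f s).
{ apply (finproj_is_S iota); intros j Hj _.
  apply NNPP; intros H; specialize (Hsupp j H); lia. }
assert (Es : s = T (uproj iota A (4 ^ k) b)).
{ unfold s, finproj, uproj; rewrite (lin_bsum HT); apply (@bsum_ext X); intros j _.
  rewrite Hcoord; destruct (A j); [|symmetry; apply (lin_zero HT)].
  destruct (copy_pos j) eqn:Ej.
  - rewrite ucoord_copy_pos by easy; symmetry.
    rewrite (linear_scal T HT).
    transitivity (@zero X); [|symmetry]; now apply scal_zeroE.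
  - change (basis_vec B j) with (merged_vec B0 J copy_pos y j).
    unfold merged_vec; rewrite Ej; symmetry; apply (linear_scal T HT). }
assert (Hf0 : f <> zero).
{ intros E; apply Hb0, Tinj; rewrite (lin_zero HT); exact E. }
assert (Hfn : 0 < norm f).
{ destruct (norm_ge_0 f) as [H|H]; [easy|]; exfalso; apply Hf0.
  now apply norm_eq_zero. }
assert (HL : Rbar_le (Finite (norm s / norm f)) (L_ B m)).
{ apply (Lub_Rbar_correct _); exists f, s, A; repeat apply conj; try easy.
  intros j Hj; specialize (Hsupp j Hj); lia. }
refine (Rbar_le_trans _ _ _ _ HL); simpl.
apply Rmult_le_reg_r with (norm f); [easy|].
replace (norm s / norm f * norm f) with (norm s) by (field; lra).
assert (A1 : norm f <= MT).
{ eapply Rle_trans; [apply HTb|]; rewrite <- (Rmult_1_r MT) at 2.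
  apply Rmult_le_compat_l; lra. }
assert (A2 : c0 * (INR k / 2) <= norm s).
{ rewrite Es; eapply Rle_trans; [|apply HTlow]; apply Rmult_le_compat_l; lra. }
eapply Rle_trans; [|exact A2].
assert (Hk0 := pos_INR k).
apply Rle_trans with (c0 / (2 * MT) * INR k * MT).
- apply Rmult_le_compat_l; [|easy]; apply Rmult_le_pos; [|easy].
  apply Rdiv_le_0_compat; lra.
- apply Req_le; field; lra.
Qed.

Lemma L_ge_1 (B : SchauderBasis X) (m : nat) : (1 <= m)%nat -> Rbar_le (Finite 1) (L_ B m).
Proof.
intros Hm; apply (Lub_Rbar_correct _).
set (f := basis_vec B 0).
assert (Hf : 0 < norm f).
{ destruct (basis_seminormalized B) as [a [b [Ha H]]]; specialize (H 0%nat); unfold f; lra. }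
assert (Hc : forall j, basis_coord B j f = @delta K 0 j).
{ intros j.
  assert (E : f = fincomb B (@delta K 0) 1).
  { unfold fincomb, f; cbn [bsum]; unfold delta; rewrite Nat.eqb_refl; mring. }
  rewrite E; apply (basis_coord_finite iota).
  intros i Hi; unfold delta; now rewrite (proj2 (Nat.eqb_neq i 0)) by lia. }
exists f, f, (fun _ => true); repeat apply conj.
- intros E; rewrite E, norm_zero in Hf; lra.
- intros j Hj; rewrite Hc in Hj; unfold delta in Hj.
  destruct (Nat.eqb j 0) eqn:E; [apply Nat.eqb_eq in E; lia|easy].
- apply basis_expansion.
- field; lra.
Qed.

(** Take [k] about [log2 m / 2]; the trivial bound [1 <= L_m] absorbs the
    bounded error and the values of [m] with [k = 0]. *)
Lemma quasi_greedy_L_lower (B : SchauderBasis X) (delta : R) : 0 < delta ->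
  (forall k m, (1 <= k)%nat -> (4 ^ k <= m)%nat ->
     Rbar_le (Finite (delta * INR k)) (L_ B m)) ->
  lesssim (fun m : nat => (2 <= m)%nat) (fun m => Finite (ln (INR m))) (L_ B).
Proof.
intros Hd H.
assert (Hpos : 0 < 2 + 2 / delta).
{ assert (0 < 2 / delta) by (apply Rdiv_lt_0_compat; lra); lra. }
exists (2 + 2 / delta); split; [exact Hpos|]; intros m Hm.
set (k := Nat.div2 (Nat.log2 m)).
assert (Hlog : (Nat.log2 m <= 2 * k + 1 /\ 2 * k <= Nat.log2 m)%nat).
{ unfold k; destruct (Nat.Even_or_Odd (Nat.log2 m)) as [[q Hq]|[q Hq]]; rewrite Hq.
  - rewrite Nat.div2_double; lia.
  - rewrite Nat.add_1_r, Nat.div2_succ_double; lia. }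
assert (Hln : ln (INR m) <= 2 + 2 * INR k).
{ destruct (@log2_ln_bounds m) as [_ Hu]; [lia|].
  apply Rle_trans with (ln (2 ^ S (Nat.log2 m))).
  - apply Rcomplements.ln_le; [apply lt_0_INR; lia|easy].
  - rewrite ln_pow2.
    assert (Hl2 : ln 2 <= 1).
    { rewrite <- (ln_exp 1); apply Rcomplements.ln_le; [lra|].
      assert (E := exp_ineq1_le 1); lra. }
    assert (Hl0 := ln_2_pos).
    assert (Hk : INR (S (Nat.log2 m)) <= 2 + 2 * INR k).
    { replace (2 + 2 * INR k) with (INR (2 + 2 * k))
        by (rewrite plus_INR, mult_INR; simpl; ring).
      apply le_INR; lia. }
    assert (H0 := pos_INR (S (Nat.log2 m))); nra. }
assert (H1 : Rbar_le (Finite 1) (L_ B m)) by (apply L_ge_1; lia).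
assert (H2 : Rbar_le (Finite (delta * INR k)) (L_ B m)).
{ destruct (le_lt_dec 1 k) as [Hk|Hk].
  - apply H; [easy|].
    destruct (Nat.log2_spec m) as [Hlo _]; [lia|].
    eapply Nat.le_trans; [|exact Hlo].
    replace 4%nat with (2 ^ 2)%nat by easy; rewrite <- Nat.pow_mul_r.
    apply Nat.pow_le_mono_r; lia.
  - replace k with 0%nat by lia; simpl INR; rewrite Rmult_0_r.
    refine (Rbar_le_trans _ _ _ _ H1); simpl; lra. }
destruct (L_ B m) as [l| |]; simpl in H1, H2.
- simpl; eapply Rle_trans; [exact Hln|].
  assert (INR k <= l / delta).
  { apply Rmult_le_reg_l with delta; [easy|].
    replace (delta * (l / delta)) with l by (field; lra); lra. }
  replace ((2 + 2 / delta) * l) with (2 * l + 2 * (l / delta)) by (field; lra); lra.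
- unfold Rbar_mult, Rbar_mult'.
  destruct (Rle_dec 0 (2 + 2 / delta)) as [H3|H3]; [|exfalso; lra].
  destruct (Rle_lt_or_eq_dec 0 (2 + 2 / delta) H3) as [H4|H4]; [easy|exfalso; lra].
- easy.
Qed.

End Main.

Theorem theorem4p21 (K : AbsRing) (HK : K = R_AbsRing \/ K = C_AbsRing)
  (X : CompleteNormedModule K)
  (Hqg : exists B : SchauderBasis X, quasi_greedy B)
  (Hcompl : exists (p : R) (Hp : (1 <= p)%R) (V : X -> Prop),
     complemented V /\ isomorphic_to_subspace (B_p0 K Hp) V) :
  exists B : SchauderBasis X,
    quasi_greedy B /\
    approx (fun m : nat => (2 <= m)%nat) (L_ B) (fun m => Finite (ln (INR m))).
Proof.
assert (Hiota : inhabited (real_subfield K)).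
{ destruct HK as [E|E]; rewrite E; constructor;
    [exact R_real_subfield|exact C_real_subfield]. }
destruct Hiota as [iota].
destruct Hqg as [B0 HB0].
destruct Hcompl as [p [Hp [V [HV1 HV2]]]].
destruct (conditional_basis iota HB0 HV1 HV2) as [B [HB [delta [Hdelta HL]]]].
exists B; split; [exact HB|split].
- now apply quasi_greedy_L_upper.
- now apply (quasi_greedy_L_lower iota Hdelta).
Qed.
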